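(* Consider an edge-to-edge unit-area tiling of a flat torus by efficient pentagons and Type 2 non-convex pentagons. Assume that each efficient pentagon in the tiling has at most four angles which tile with efficient pentagons. Then the tiling has more perimeter per tile than half the perimeter of a unit-area Prismatic pentagon, i.e. more than $\sqrt{2+\sqrt3}$.
   Context: Edge-to-edge means adjacent tiles meet only along entire edges or at vertices. The perimeter per tile of a tiling of a flat torus is the total length of all edges of the tiling (each edge counted once) divided by the number of tiles. A Cairo (respectively Prismatic) pentagon is a pentagon with three angles of $2\pi/3$ and two right angles which are nonadjacent (respectively adjacent), circumscribed about a circle; at unit area both have perimeter $2\sqrt{2+\sqrt3}\approx 3.86$. A unit-area pentagon is efficient if its perimeter is at most that of a unit-area Cairo pentagon. A Type 2 non-convex pentagon is a pentagon with two interior angles larger than $\pi$. Given a sequence of angles $a_i$, an angle $a_j$ of the sequence tiles if there are positive integers $m_i$, for $i$ in some finite set of indices containing $j$, with $\sum m_i a_i = 2\pi$. An angle of an efficient pentagon ''tiles with efficient pentagons'' if it tiles with respect to the collection of the angles of the efficient pentagons of the tiling. *)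

(* Defs.v *)
From mathcomp Require Import all_boot all_order all_algebra.
From mathcomp Require Import all_classical all_reals all_analysis.
Set Implicit Arguments.
Unset Strict Implicit.
Unset Printing Implicit Defensive.
Import Order.TTheory GRing.Theory Num.Theory.
Import numFieldNormedType.Exports.
Local Open Scope classical_set_scope.
Local Open Scope ring_scope.

Section Plane.
Context {R : realType}.
Implicit Types (x y u v : R * R) (A : set (R * R)).

Definition dot u v : R := u.1 * v.1 + u.2 * v.2.

(* The library norm on [R * R] is the sup norm. *)
Definition enorm u : R := Num.sqrt (dot u u).

Definition dist x y : R := enorm (y - x).

Definition segment x y : set (R * R) :=
  [set (1 - t) *: x + t *: y | t in [set t : R | 0 <= t <= 1]].

Definition area A : \bar R := (lebesgue_measure \x lebesgue_measure)%E A.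

End Plane.

(* A pentagon is given by its vertices in cyclic order, in either orientation. *)
Definition pentagon (R : realType) := 'I_5 -> R * R.

Section Pentagon.
Context {R : realType}.
Implicit Types (p : pentagon R) (k : 'I_5).

(* The edge following the vertex [k]. *)
Definition edge p k : set (R * R) := segment (p k) (p (ordS k)).

Definition edge_length p k : R := dist (p k) (p (ordS k)).

Definition perimeter p : R := \sum_(k < 5) edge_length p k.

(* Distinct edges share at most a common endpoint. *)
Definition simple p : Prop :=
  injective p /\
  forall k l, k != l ->
    edge p k `&` edge p l `<=`
    [set p k; p (ordS k)] `&` [set p l; p (ordS l)].

Definition boundary p : set (R * R) := \bigcup_k edge p k.

(* The closed region enclosed by the boundary curve: the curve together with
   the bounded component(s) of its complement. *)
Definition region p : set (R * R) :=
  boundary p `|`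
  [set x | ~ boundary p x /\
           bounded_set (connected_component (~` boundary p) x)].

(* The geometric angle, in [0, pi], between the two edges at the vertex [k]. *)
Definition corner p k : R :=
  let u := p (ordS k) - p k in
  let w := p (ord_pred k) - p k in
  acos (dot u w / (enorm u * enorm w)).

(* The convex sector between the two edges at the vertex [k] lies, near that
   vertex, on the inner side of the pentagon; it suffices to test one ray
   inside the sector. *)
Definition corner_inside p k : Prop :=
  \forall e \near 0^'+,
    region p (p k + e *: ((p (ordS k) - p k) + (p (ord_pred k) - p k))).

Definition angle p k : R :=
  if `[< corner_inside p k >] then corner p k else 2 * pi - corner p k.

Definition circumscribed p : Prop :=
  exists (c : R * R) (r : R),
    [/\ 0 < r,
        [set x | dist c x <= r] `<=` region p &
        forall k, exists x,
          [/\ edge p k x, dist c x = r &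
              dot (x - c) (p (ordS k) - p k) = 0]].

Definition adjacent k l : bool := (l == ordS k) || (k == ordS l).

(* The right angles are at the vertices [k] and [l]. *)
Definition two_right_angles p k l : Prop :=
  [/\ k != l, angle p k = pi / 2, angle p l = pi / 2 &
      forall m, m != k -> m != l -> angle p m = 2 * pi / 3].

Definition cairo p : Prop :=
  [/\ simple p, circumscribed p &
      exists k l, ~~ adjacent k l /\ two_right_angles p k l].

Definition prismatic p : Prop :=
  [/\ simple p, circumscribed p &
      exists k l, adjacent k l /\ two_right_angles p k l].

(* All unit-area Cairo pentagons are congruent, so which one is compared with
   does not matter. *)
Definition efficient p : Prop :=
  [/\ simple p, area (region p) = 1%:E &
      exists c, [/\ cairo c, area (region c) = 1%:E &
                    perimeter p <= perimeter c]].

Definition type2 p : Prop :=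
  simple p /\ #|[pred k | pi < angle p k]| = 2.

End Pentagon.

Definition angle_tiles {R : realType} (I : finType) (a : I -> R)
    (D : pred I) (j : I) : Prop :=
  exists (S : {set I}) (m : I -> nat),
    [/\ j \in S,
        forall i, i \in S -> D i && (0 < m i)%N &
        \sum_(i in S) (m i)%:R * a i = 2 * pi].

(* A tiling of the flat torus R^2 / (Z e1 + Z e2) by [n] pentagons is given by
   one lift [P i] to the plane of each tile; the translates of the [P i] by the
   lattice then tile the plane. *)
Section Tiling.
Context {R : realType} {n : nat}.
Variables (e1 e2 : R * R) (P : 'I_n -> pentagon R).

Definition lattice_basis : Prop := e1.1 * e2.2 - e1.2 * e2.1 != 0.

Definition lift_tile (s : 'I_n * (int * int)) : pentagon R :=
  fun k => P s.1 k + (e1 *~ s.2.1 + e2 *~ s.2.2).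

Definition edge_to_edge : Prop :=
  forall s t, s != t ->
  forall x, region (lift_tile s) x -> region (lift_tile t) x ->
    (exists k l, lift_tile s k = x /\ lift_tile t l = x) \/
    (exists k l, edge (lift_tile s) k = edge (lift_tile t) l /\
                 edge (lift_tile s) k x).

Definition torus_tiling : Prop :=
  [/\ lattice_basis,
      forall i, simple (P i),
      \bigcup_s region (lift_tile s) = setT &
      forall s t, s != t ->
        interior (region (lift_tile s)) `&` interior (region (lift_tile t))
        = set0].

Definition unit_area_tiling : Prop := forall i, area (region (P i)) = 1%:E.

(* [e = (i, k)] stands for the edge [k] of the tile [i]; two such edges are the
   same edge of the torus when they differ by a lattice translation. *)
Definition same_edge : rel ('I_n * 'I_5) := fun e f =>
  `[< exists z : int * int, edge (lift_tile (f.1, z)) f.2 = edge (P e.1) e.2 >].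

Definition tiling_perimeter : R :=
  \sum_(e in transversal (equivalence_partition same_edge [set: 'I_n * 'I_5]%SET)
                         [set: 'I_n * 'I_5]%SET)
     edge_length (P e.1) e.2.

Definition perimeter_per_tile : R := tiling_perimeter / n%:R.

Definition tile_angle (v : 'I_n * 'I_5) : R := angle (P v.1) v.2.

Definition tiles_with_efficient (v : 'I_n * 'I_5) : Prop :=
  angle_tiles tile_angle [pred w | `[< efficient (P w.1) >]] v.

End Tiling.

(* Main.v *)
(* A unit-area pentagon with an angle [t] has perimeter at least
   3.86371 - 0.099 t / pi, where 3.86371 is just above the perimeter of the
   Prismatic pentagon: cut off the triangle at the vertex of [t] and estimate the
   remaining quadrilateral by Bretschneider's inequality. A Type 2 pentagon lies
   in the triangle of its three other vertices, so that its perimeter is at least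
   4.559. The angles at a vertex of the tiling add up to [2 * pi]; hence an angle
   of an efficient pentagon which does not tile with efficient pentagons meets a
   Type 2 pentagon. Every efficient pentagon has such an angle, and as the five
   angles of a Type 2 pentagon add up to [3 * pi], those at its vertices amount to
   at most [7 * pi]. So each Type 2 pentagon makes up for a loss of at most
   0.099 * 7 = 0.693, less than its own excess 4.559 - 3.86371 over the target.
   Finally every edge belongs to at most two tiles. *)
Require Import Defs.
From mathcomp Require Import all_boot all_order all_algebra.
From mathcomp Require Import all_classical all_reals all_analysis.
From mathcomp Require Import measurable_realfun ring lra zify.
Import Order.TTheory GRing.Theory Num.Theory.
Import numFieldNormedType.Exports.
Set Implicit Arguments.
Unset Strict Implicit.
Unset Printing Implicit Defensive.
Local Open Scope classical_set_scope.
Local Open Scope ring_scope.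

(** The loss allowed to an efficient pentagon is linear in its angle because all that is known of
    the angles at a vertex is their total. The slope 0.099 has little room: the regular pentagon,
    with angle 3 pi / 5 and perimeter about 3.81193, forces at least 0.0863, and the charging allows
    at most (4.559 - 3.86371) / 7, about 0.0993. The other obstacle is topological. A region
    consists of a curve and the bounded components of its complement, and the Jordan curve theorem
    is replaced by a local fact: all along the boundary, one and the same side lies in the region
    and the other does not. This yields the sectors at the vertices, but the sum of the angles of a
    pentagon only modulo 2 pi; for a Type 2 pentagon the two reflex angles then exclude the value
    pi. Areas of regions enter through inequalities alone: from above by covers with triangles, and
    from below, for the Prismatic pentagon, by disjoint triangles inside it. *)

(** * Areas of triangles for the product measure *)

Section Area.
Context {R : realType}.
Implicit Types (u v : R * R).

Local Notation mu := (@lebesgue_measure R).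

(* No measurability is needed, since the integral of a nonnegative function is a supremum. *)
Lemma le_integral_ge0 (d : measure_display) (T : measurableType d)
    (m : {measure set T -> \bar R}) (f g : T -> \bar R) :
  (forall x, 0 <= f x)%E -> (forall x, f x <= g x)%E ->
  (\int[m]_x f x <= \int[m]_x g x)%E.
Proof.
move=> f0 fg; have g0 x : (0 <= g x)%E by exact: le_trans (f0 x) (fg x).
rewrite !ge0_integralTE//; apply: le_ereal_sup => _ [h hf <-].
by exists h => // x; exact: le_trans (hf x) (fg x).
Qed.

Lemma le_lebesgue_measure (A B : set R) : A `<=` B -> (mu A <= mu B)%E.
Proof. by move=> AB; apply: le_mu_ext. Qed.

Lemma le_area (A B : set (R * R)) : A `<=` B -> (area A <= area B)%E.
Proof.
move=> AB; apply: le_integral_ge0 => x /=; first exact: mu_ext_ge0.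
by apply: le_lebesgue_measure => y; rewrite /xsection/= !inE => /AB.
Qed.

Lemma integral_affine (a b x0 x1 : R) : x0 < x1 ->
  (\int[mu]_(x in `[x0, x1]) (a + b * x)%:E =
   ((a + b * (x0 + x1) / 2) * (x1 - x0))%:E)%E.
Proof.
move=> x01; rewrite (@continuous_FTC2 _ _ (fun x => a * x + b * x ^+ 2 / 2))//.
- by rewrite -EFinB; congr EFin; field.
- apply: continuous_subspaceT => x.
  by apply: cvgD; [exact: cvg_cst|apply: cvgM; [exact: cvg_cst|exact: cvg_id]].
- have D x : derivable (fun x => a * x + b * x ^+ 2 / 2) x 1 by exact: ex_derive.
  have C x : {for x, continuous (fun x => a * x + b * x ^+ 2 / 2)}.
    by apply: differentiable_continuous; exact/derivable1_diffP.
  by split => //; [exact: cvg_at_right_filter (C x0)|exact: cvg_at_left_filter (C x1)].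
- move=> x _; rewrite derive1E derive_val /GRing.scale/=.
  by field.
Qed.

Definition closed_trapezoid (x0 x1 a b c d : R) : set (R * R) :=
  [set p | x0 <= p.1 <= x1 /\ a + b * p.1 <= p.2 <= c + d * p.1].

Definition open_trapezoid (x0 x1 a b c d : R) : set (R * R) :=
  [set p | x0 < p.1 < x1 /\ a + b * p.1 < p.2 < c + d * p.1].

Lemma area_trapezoid_le (x0 x1 a b c d : R) : x0 < x1 ->
  (forall x, x0 <= x <= x1 -> a + b * x <= c + d * x) ->
  (area (closed_trapezoid x0 x1 a b c d) <=
   (((c - a) + (d - b) * (x0 + x1) / 2) * (x1 - x0))%:E)%E.
Proof.
move=> x01 abcd; rewrite -(integral_affine _ _ x01) integral_mkcond.
apply: le_integral_ge0 => x /=; first exact: mu_ext_ge0.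
rewrite patchE; case: ifPn => xI.
  move: xI; rewrite inE/= in_itv/= => xI.
  apply: (@le_trans _ _ (mu `[a + b * x, c + d * x])).
    apply: le_lebesgue_measure => y; rewrite /xsection/= inE/= in_itv/=.
    by case.
  rewrite lebesgue_measure_itv/= lte_fin; case: ifPn => _.
    by rewrite -EFinB lee_fin; lra.
  by rewrite lee_fin; have := abcd x xI; lra.
rewrite [X in (mu X <= _)%E](_ : _ = set0) ?measure0//.
apply/seteqP; split=> y //; rewrite /xsection/= inE/= => -[xJ _].
by move: xI; rewrite notin_setE/= in_itv/=; apply.
Qed.

Lemma area_trapezoid_ge (x0 x1 a b c d : R) : x0 < x1 ->
  (forall x, x0 < x < x1 -> a + b * x <= c + d * x) ->
  ((((c - a) + (d - b) * (x0 + x1) / 2) * (x1 - x0))%:E <=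
   area (open_trapezoid x0 x1 a b c d))%E.
Proof.
move=> x01 abcd; rewrite -(integral_affine _ _ x01).
have m : measurable_fun setT (fun x : R => c - a + (d - b) * x).
  by apply: measurable_funD => //; exact: measurable_funM.
rewrite -integral_itv_bndo_bndc; last first.
  by apply/measurable_EFinP; exact: measurable_funTS.
rewrite -integral_itv_obnd_cbnd; last first.
  by apply/measurable_EFinP; exact: measurable_funTS.
rewrite integral_mkcond.
apply: le_integral_ge0 => x /=; rewrite patchE; case: ifPn => //.
- rewrite inE/= in_itv/= => xI; rewrite lee_fin.
  by have := abcd x xI; lra.
- rewrite inE/= in_itv/= => xI.
  apply: (@le_trans _ _ (mu `]a + b * x, c + d * x[)).
    rewrite lebesgue_measure_itv/= lte_fin; case: ifPn => [_|].
      by rewrite -EFinB lee_fin; lra.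
    by rewrite lee_fin -leNgt; lra.
  by apply: le_lebesgue_measure => y; rewrite /xsection/= inE/= in_itv/=.
- by move=> _; exact: mu_ext_ge0.
Qed.

(* The part of a vertical strip between two lines, whichever of them is above. *)
Definition strip (x0 x1 a b c d : R) : set (R * R) :=
  [set p | x0 <= p.1 <= x1 /\ (p.2 - (a + b * p.1)) * (p.2 - (c + d * p.1)) <= 0].

Definition open_strip (x0 x1 a b c d : R) : set (R * R) :=
  [set p | x0 < p.1 < x1 /\ (p.2 - (a + b * p.1)) * (p.2 - (c + d * p.1)) < 0].

Lemma area_strip_le (x0 x1 a b c d : R) : x0 < x1 ->
  0 <= (c - a + (d - b) * x0) * (c - a + (d - b) * x1) ->
  (area (strip x0 x1 a b c d) <=
   (`|c - a + (d - b) * (x0 + x1) / 2| * (x1 - x0))%:E)%E.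
Proof.
move=> x01 sgn.
wlog : a b c d sgn / 0 <= c - a + (d - b) * x0 /\ 0 <= c - a + (d - b) * x1.
  move=> W; have [h|h] : (0 <= c - a + (d - b) * x0 /\ 0 <= c - a + (d - b) * x1) \/
    (0 <= a - c + (b - d) * x0 /\ 0 <= a - c + (b - d) * x1) by nra.
  - exact: W.
  - rewrite -normrN [X in `|X|](_ : _ = a - c + (b - d) * (x0 + x1) / 2); last by field.
    apply: le_trans (W _ _ _ _ _ h); last by nra.
    by apply: le_area => p [px pp]; split => //; rewrite mulrC.
move=> [h0 h1]; rewrite ger0_norm; last by nra.
have H x : x0 <= x <= x1 -> a + b * x <= c + d * x by nra.
apply: le_trans (area_trapezoid_le x01 H); apply: le_area => p [px pp].
by split => //; have := H _ px; nra.
Qed.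

Lemma area_strip_ge (x0 x1 a b c d : R) : x0 < x1 ->
  0 <= (c - a + (d - b) * x0) * (c - a + (d - b) * x1) ->
  ((`|c - a + (d - b) * (x0 + x1) / 2| * (x1 - x0))%:E <=
   area (open_strip x0 x1 a b c d))%E.
Proof.
move=> x01 sgn.
wlog : a b c d sgn / 0 <= c - a + (d - b) * x0 /\ 0 <= c - a + (d - b) * x1.
  move=> W; have [h|h] : (0 <= c - a + (d - b) * x0 /\ 0 <= c - a + (d - b) * x1) \/
    (0 <= a - c + (b - d) * x0 /\ 0 <= a - c + (b - d) * x1) by nra.
  - exact: W.
  - rewrite -normrN [X in `|X|](_ : _ = a - c + (b - d) * (x0 + x1) / 2); last by field.
    apply: le_trans (W _ _ _ _ _ h) _; first by nra.
    by apply: le_area => p [px pp]; split => //; rewrite mulrC.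
move=> [h0 h1]; rewrite ger0_norm; last by nra.
have H x : x0 < x < x1 -> a + b * x <= c + d * x by nra.
apply: le_trans (area_trapezoid_ge x01 H) _; apply: le_area => p [px pp].
by split => //; nra.
Qed.

Lemma measurable_quadratic (a b c d : R) :
  measurable_fun setT
    (fun p : R * R => (p.2 - (a + b * p.1)) * (p.2 - (c + d * p.1))).
Proof.
have m (e f : R) : measurable_fun setT (fun p : R * R => p.2 - (e + f * p.1)).
  apply: measurable_funB; first exact: measurable_snd.
  apply: measurable_funD => //.
  by apply: measurable_funM => //; exact: measurable_fst.
exact: measurable_funM.
Qed.

Lemma measurable_strip (x0 x1 a b c d : R) : measurable (strip x0 x1 a b c d).
Proof.
rewrite [X in measurable X](_ : _ = ((fst : R * R -> R) @^-1` `[x0, x1]) `&`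
  ((fun p : R * R => (p.2 - (a + b * p.1)) * (p.2 - (c + d * p.1))) @^-1` `]-oo, 0])).
  apply: measurableI; rewrite -[X in measurable X]setTI.
    exact: measurable_fst.
  exact: measurable_quadratic.
by apply/seteqP; split => p /=; rewrite !in_itv.
Qed.

Lemma measurable_open_strip (x0 x1 a b c d : R) : measurable (open_strip x0 x1 a b c d).
Proof.
rewrite [X in measurable X](_ : _ = ((fst : R * R -> R) @^-1` `]x0, x1[) `&`
  ((fun p : R * R => (p.2 - (a + b * p.1)) * (p.2 - (c + d * p.1))) @^-1` `]-oo, 0[)).
  apply: measurableI; rewrite -[X in measurable X]setTI.
    exact: measurable_fst.
  exact: measurable_quadratic.
by apply/seteqP; split => p /=; rewrite !in_itv.
Qed.

Lemma area_vertical_line (x0 : R) : area ([set x0] `*` setT) = 0%E.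
Proof.
rewrite /area product_measure1E//.
transitivity (0 * mu setT)%E; last by rewrite mul0e.
by congr (_ * _)%E; exact: lebesgue_measure_set1.
Qed.

Definition cross (u v : R * R) : R := u.1 * v.2 - u.2 * v.1.

Definition triangle (a b c : R * R) : set (R * R) :=
  [set x | exists s t, [/\ 0 <= s, 0 <= t, s + t <= 1 &
     x = a + s *: (b - a) + t *: (c - a)]].

Definition open_triangle (a b c : R * R) : set (R * R) :=
  [set x | exists s t, [/\ 0 < s, 0 < t, s + t < 1 &
     x = a + s *: (b - a) + t *: (c - a)]].

Lemma plane_eq u v : u.1 = v.1 -> u.2 = v.2 -> u = v.
Proof. by case: u v => [a b] [c d] /= -> ->. Qed.

Lemma triangle_rotate a b c : triangle a b c `<=` triangle b c a.
Proof.
move=> _ [s [t [s0 t0 st ->]]]; exists t, (1 - s - t); split; [lra|lra|lra|].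
by apply: plane_eq => /=; rewrite /GRing.scale/=; ring.
Qed.

Lemma triangle_swap a b c : triangle a b c `<=` triangle a c b.
Proof.
move=> _ [s [t [s0 t0 st ->]]]; exists t, s; split; [lra|lra|lra|].
by rewrite addrAC.
Qed.

Lemma open_triangle_rotate a b c : open_triangle a b c `<=` open_triangle b c a.
Proof.
move=> _ [s [t [s0 t0 st ->]]]; exists t, (1 - s - t); split; [lra|lra|lra|].
by apply: plane_eq => /=; rewrite /GRing.scale/=; ring.
Qed.

Lemma open_triangle_swap a b c : open_triangle a b c `<=` open_triangle a c b.
Proof.
move=> _ [s [t [s0 t0 st ->]]]; exists t, s; split; [lra|lra|lra|].
by rewrite addrAC.
Qed.

Lemma cross_rotate a b c : cross (b - a) (c - a) = cross (c - b) (a - b).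
Proof. by rewrite /cross/=; ring. Qed.

Lemma cross_swap a b c : cross (b - a) (c - a) = - cross (c - a) (b - a).
Proof. by rewrite /cross/=; ring. Qed.

(** Rotations and swaps generate all permutations of three points, so the vertices of a triangle may
    be taken in the order of their abscissas. *)
Lemma sorted_ind (P : R * R -> R * R -> R * R -> Prop) :
  (forall a b c, P a b c -> P c a b) -> (forall a b c, P a b c -> P a c b) ->
  (forall a b c, a.1 <= b.1 -> b.1 <= c.1 -> P a b c) -> forall a b c, P a b c.
Proof.
move=> rot swap srt a b c.
have [ab|/ltW ba] := lerP a.1 b.1; have [bc|/ltW cb] := lerP b.1 c.1.
- exact: srt.
- have [ac|/ltW ca] := lerP a.1 c.1; first exact/swap/srt.
  exact/rot/rot/srt.
- have [ac|/ltW ca] := lerP a.1 c.1; last exact/rot/srt.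
  exact/rot/swap/srt.
- exact/rot/rot/swap/srt.
Qed.

(** The vertical line through the middle vertex [b] cuts the triangle in two; the left part lies
    between the lines [a c] and [a b], whichever is above. The same lines serve for a closed strip
    outside and an open strip inside, and the part has the share [(b.1 - a.1) / (c.1 - a.1)] of the
    whole area. *)
Lemma half_triangle_left a b c :
  a.1 < b.1 -> b.1 <= c.1 ->
  exists m0 n0 m1 n1, [/\
    triangle a b c `&` [set x | x.1 <= b.1] `<=` strip a.1 b.1 m0 n0 m1 n1,
    open_strip a.1 b.1 m0 n0 m1 n1 `<=` open_triangle a b c `&` [set x | x.1 < b.1],
    0 <= (m1 - m0 + (n1 - n0) * a.1) * (m1 - m0 + (n1 - n0) * b.1) &
    `|m1 - m0 + (n1 - n0) * (a.1 + b.1) / 2| * (b.1 - a.1) =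
    `|cross (b - a) (c - a)| / 2 * ((b.1 - a.1) / (c.1 - a.1))].
Proof.
move=> ab bc.
pose m := (c.2 - a.2) / (c.1 - a.1); pose n := (b.2 - a.2) / (b.1 - a.1).
have B0 : 0 < b.1 - a.1 by lra.
have C0 : 0 < c.1 - a.1 by lra.
have Ec : c.2 - a.2 = m * (c.1 - a.1) by rewrite /m; field; lra.
have Eb : b.2 - a.2 = n * (b.1 - a.1) by rewrite /n; field; lra.
have crossE : cross (b - a) (c - a) = (m - n) * ((b.1 - a.1) * (c.1 - a.1)).
  by rewrite /cross/= -[b.2 + - a.2]/(b.2 - a.2) -[c.2 + - a.2]/(c.2 - a.2) Ec Eb; ring.
exists (a.2 - m * a.1), m, (a.2 - n * a.1), n; split.
- move=> _ [[s [t [s0 t0 st ->]]] /= h]; rewrite /strip/= /GRing.scale/=.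
  rewrite -[c.2 + - a.2]/(c.2 - a.2) -[b.2 + - a.2]/(b.2 - a.2) Ec Eb.
  split; first by apply/andP; split; [nra|exact: h].
  rewrite [X in X <= 0](_ : _ = - (s * t * ((b.1 - a.1) * (c.1 - a.1)) * (m - n) ^+ 2)).
    by rewrite oppr_le0 mulr_ge0 ?sqr_ge0// !mulr_ge0// ltW.
  by ring.
- move=> x [/= /andP[x0 x1] xx]; split => //.
  pose X := x.1 - a.1; pose Y := x.2 - a.2.
  have xx' : (Y - m * X) * (Y - n * X) < 0 by move: xx; rewrite /X /Y; congr (_ < 0); ring.
  have mn : m != n.
    by apply/eqP => mn; move: xx'; rewrite mn -expr2 ltNge sqr_ge0.
  have nm0 : n - m != 0 by rewrite subr_eq0 eq_sym.
  (* These solve [x - a = s *: (b - a) + t *: (c - a)], with both sides expressed by the slopes [m]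
     of [a c] and [n] of [a b]. *)
  exists ((Y - m * X) / ((b.1 - a.1) * (n - m))), ((n * X - Y) / ((c.1 - a.1) * (n - m))).
  have X0 : 0 < X by rewrite /X; lra.
  have s0 : 0 < (Y - m * X) / ((b.1 - a.1) * (n - m)).
    rewrite invfM mulrCA mulr_gt0 ?invr_gt0//.
    rewrite -(pmulr_lgt0 _ (_ : 0 < (n - m) ^+ 2)); last by rewrite lt_def sqrf_eq0 nm0 sqr_ge0.
    rewrite [X in 0 < X](_ : _ = (Y - m * X) * (n - m)); last by field.
    rewrite -(pmulr_lgt0 _ X0); have := sqr_ge0 (Y - m * X).
    by move: xx'; clearbody X Y; nra.
  have t0 : 0 < (n * X - Y) / ((c.1 - a.1) * (n - m)).
    rewrite invfM mulrCA mulr_gt0 ?invr_gt0//.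
    rewrite -(pmulr_lgt0 _ (_ : 0 < (n - m) ^+ 2)); last by rewrite lt_def sqrf_eq0 nm0 sqr_ge0.
    rewrite [X in 0 < X](_ : _ = (n * X - Y) * (n - m)); last by field.
    rewrite -(pmulr_lgt0 _ X0); have := sqr_ge0 (Y - n * X).
    by move: xx'; clearbody X Y; nra.
  have E : (Y - m * X) / ((b.1 - a.1) * (n - m)) * (b.1 - a.1) +
           (n * X - Y) / ((c.1 - a.1) * (n - m)) * (c.1 - a.1) = X.
    by field; rewrite nm0 !gt_eqF.
  split => //.
  - have : X < b.1 - a.1 by rewrite /X; lra.
    set s := (_ / _) in s0 E *; set t := (_ / _) in t0 E *; nra.
  - apply: plane_eq => /=; rewrite /GRing.scale/=.
      by move: E; rewrite /X; lra.
    rewrite -[c.2 + - a.2]/(c.2 - a.2) -[b.2 + - a.2]/(b.2 - a.2) Ec Eb.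
    by rewrite /X /Y; field; rewrite nm0 !gt_eqF.
- by rewrite [X in 0 <= X * _](_ : _ = 0) ?mul0r//; ring.
- rewrite crossE normrM [`|(_ - _) * (_ - _)|]gtr0_norm ?mulr_gt0//.
  rewrite [X in `|X|](_ : _ = (m - n) * (- ((b.1 - a.1) / 2))); last by field.
  by rewrite normrM normrN [`|(_ - _) / _|]gtr0_norm ?divr_gt0//; field; rewrite gt_eqF.
Qed.

(** The right half of a triangle is treated as the left half of its mirror image. *)
Let mirror u : R * R := (- u.1, u.2).

Let mirrorK : involutive mirror.
Proof. by move=> u; apply: plane_eq => //=; rewrite opprK. Qed.

Let mirror_triangle a b c x : triangle a b c x -> triangle (mirror c) (mirror b) (mirror a) (mirror x).
Proof.
move=> [s [t [s0 t0 st ->]]]; exists s, (1 - s - t); split; [lra|lra|lra|].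
by apply: plane_eq => /=; rewrite /GRing.scale/=; ring.
Qed.

Let mirror_open_triangle a b c x :
  open_triangle a b c x -> open_triangle (mirror c) (mirror b) (mirror a) (mirror x).
Proof.
move=> [s [t [s0 t0 st ->]]]; exists s, (1 - s - t); split; [lra|lra|lra|].
by apply: plane_eq => /=; rewrite /GRing.scale/=; ring.
Qed.

Lemma half_triangle_right a b c :
  a.1 <= b.1 -> b.1 < c.1 ->
  exists m0 n0 m1 n1, [/\
    triangle a b c `&` [set x | b.1 <= x.1] `<=` strip b.1 c.1 m0 n0 m1 n1,
    open_strip b.1 c.1 m0 n0 m1 n1 `<=` open_triangle a b c `&` [set x | b.1 < x.1],
    0 <= (m1 - m0 + (n1 - n0) * b.1) * (m1 - m0 + (n1 - n0) * c.1) &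
    `|m1 - m0 + (n1 - n0) * (b.1 + c.1) / 2| * (c.1 - b.1) =
    `|cross (b - a) (c - a)| / 2 * ((c.1 - b.1) / (c.1 - a.1))].
Proof.
move=> ab bc.
have [||m0 [n0 [m1 [n1 [H1 H2 H3 H4]]]]] :=
  @half_triangle_left (mirror c) (mirror b) (mirror a); [by rewrite /=; lra..|].
exists m0, (- n0), m1, (- n1); split.
- move=> x [/mirror_triangle xT /= xb].
  have [] := H1 (mirror x); first by split => //=; lra.
  move=> /= /andP[h1 h2] h3; split; first by apply/andP; split; lra.
  by move: h3; rewrite !mulrN !mulNr.
- move=> x [/= /andP[h1 h2] h3].
  have [] := H2 (mirror x).
    split; first by apply/andP; split => /=; lra.
    by move: h3 => /=; rewrite !mulrN !mulNr.
  by move=> /mirror_open_triangle; rewrite !mirrorK => ? /=; split => //; lra.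
- by move: H3 => /=; congr (0 <= _); ring.
- move: H4 => /= H4.
  rewrite [X in `|X| * _](_ : _ = m1 - m0 + (n1 - n0) * (- c.1 + - b.1) / 2); last by ring.
  rewrite [c.1 - b.1 in LHS](_ : _ = - b.1 - - c.1); last by ring.
  rewrite H4 [cross _ _](_ : _ = cross (b - a) (c - a)); last by rewrite /cross/=; ring.
  by congr (_ * (_ / _)); ring.
Qed.

(** A measurable superset is provided because areas of several triangles will be added by
    subadditivity. If the middle abscissa equals an extreme one, a single half remains; if all three
    agree, the triangle lies on a vertical line, of area zero. *)
Lemma triangle_cover a b c : exists B : set (R * R),
  [/\ measurable B, triangle a b c `<=` B &
      (area B <= (`|cross (b - a) (c - a)| / 2)%:E)%E].
Proof.
move: a b c; apply: sorted_ind => a b c.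
- move=> [B [mB sB aB]]; exists B; split => //.
    by apply: subset_trans sB; exact: triangle_rotate.
  by rewrite cross_rotate.
- move=> [B [mB sB aB]]; exists B; split => //.
    by apply: subset_trans sB; exact: triangle_swap.
  by rewrite cross_swap normrN.
move=> ab bc; set K := `|_| / 2.
have [ab'|ba] := ltP a.1 b.1; have [bc'|cb] := ltP b.1 c.1.
- have [m0 [n0 [m1 [n1 [H1 _ H3 H4]]]]] := half_triangle_left ab' bc.
  have [m2 [n2 [m3 [n3 [H5 _ H7 H8]]]]] := half_triangle_right ab bc'.
  exists (strip a.1 b.1 m0 n0 m1 n1 `|` strip b.1 c.1 m2 n2 m3 n3); split.
  + by apply: measurableU; exact: measurable_strip.
  + move=> x xT; have [xb|bx] := leP x.1 b.1; [left; exact: H1|right].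
    by apply: H5; split => //=; exact: ltW.
  + apply: le_trans (measureU2 _ _ _) _; [exact: measurable_strip..|].
    apply: le_trans (leeD (area_strip_le ab' H3) (area_strip_le bc' H7)) _.
    rewrite H4 H8 -EFinD lee_fin -/K -mulrDr -mulrDl.
    by rewrite [X in _ * (X / _)](_ : _ = c.1 - a.1) ?divff ?mulr1//; [lra|ring].
- have [m0 [n0 [m1 [n1 [H1 _ H3 H4]]]]] := half_triangle_left ab' bc.
  exists (strip a.1 b.1 m0 n0 m1 n1); split; first exact: measurable_strip.
  + move=> x xT; apply: H1; split => //=; move: xT => [s [t [s0 t0 st ->]]] /=.
    by rewrite /GRing.scale/=; nra.
  + apply: le_trans (area_strip_le ab' H3) _; rewrite H4 lee_fin -/K.
    by rewrite (_ : c.1 = b.1) ?divff ?mulr1//; lra.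
- have [m2 [n2 [m3 [n3 [H5 _ H7 H8]]]]] := half_triangle_right ab bc'.
  exists (strip b.1 c.1 m2 n2 m3 n3); split; first exact: measurable_strip.
  + move=> x xT; apply: H5; split => //=; move: xT => [s [t [s0 t0 st ->]]] /=.
    by rewrite /GRing.scale/=; nra.
  + apply: le_trans (area_strip_le bc' H7) _; rewrite H8 lee_fin -/K.
    by rewrite (_ : a.1 = b.1) ?divff ?mulr1//; lra.
- exists ([set a.1] `*` setT); split.
  + by apply: measurableX.
  + move=> _ [s [t [s0 t0 st ->]]]; split => //=.
    have -> : b.1 = a.1 by lra.
    have -> : c.1 = a.1 by lra.
    by rewrite !subrr !scaler0 !addr0.
  + by rewrite area_vertical_line lee_fin divr_ge0.
Qed.

(** The open strips leave out the vertical line through the middle vertex, so that they fill the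
    open triangle only up to a null set. *)
Lemma open_triangle_core a b c : exists B : set (R * R),
  [/\ measurable B, B `<=` open_triangle a b c &
      ((`|cross (b - a) (c - a)| / 2)%:E <= area B)%E].
Proof.
move: a b c; apply: sorted_ind => a b c.
- move=> [B [mB sB aB]]; exists B; split => //.
    by apply: subset_trans sB _ => x /open_triangle_rotate/open_triangle_rotate.
  by rewrite cross_rotate.
- move=> [B [mB sB aB]]; exists B; split => //.
    by apply: subset_trans sB _; exact: open_triangle_swap.
  by rewrite cross_swap normrN.
move=> ab bc; set K := `|_| / 2.
have [ab'|ba] := ltP a.1 b.1; have [bc'|cb] := ltP b.1 c.1.
- have [m0 [n0 [m1 [n1 [_ H2 H3 H4]]]]] := half_triangle_left ab' bc.
  have [m2 [n2 [m3 [n3 [_ H6 H7 H8]]]]] := half_triangle_right ab bc'.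
  exists (open_strip a.1 b.1 m0 n0 m1 n1 `|` open_strip b.1 c.1 m2 n2 m3 n3); split.
  + by apply: measurableU; exact: measurable_open_strip.
  + by move=> x [/H2[]|/H6[]].
  + rewrite [X in (_ <= X)%E]measureU; [|exact: measurable_open_strip..|].
    * apply: le_trans (leeD (area_strip_ge ab' H3) (area_strip_ge bc' H7)).
      rewrite H4 H8 -EFinD lee_fin -/K -mulrDr -mulrDl.
      by rewrite [X in _ * (X / _)](_ : _ = c.1 - a.1) ?divff ?mulr1//; [lra|ring].
    * by apply/seteqP; split => // x [[/= /andP[_ h] _] [/= /andP[h' _] _]]; move: h'; rewrite ltNge (ltW h).
- have [m0 [n0 [m1 [n1 [_ H2 H3 H4]]]]] := half_triangle_left ab' bc.
  exists (open_strip a.1 b.1 m0 n0 m1 n1); split; first exact: measurable_open_strip.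
  + by move=> x /H2[].
  + apply: le_trans (area_strip_ge ab' H3); rewrite H4 lee_fin -/K.
    by rewrite (_ : c.1 = b.1) ?divff ?mulr1//; lra.
- have [m2 [n2 [m3 [n3 [_ H6 H7 H8]]]]] := half_triangle_right ab bc'.
  exists (open_strip b.1 c.1 m2 n2 m3 n3); split; first exact: measurable_open_strip.
  + by move=> x /H6[].
  + apply: le_trans (area_strip_ge bc' H7); rewrite H8 lee_fin -/K.
    by rewrite (_ : a.1 = b.1) ?divff ?mulr1//; lra.
- exists set0; split => //.
  rewrite /area measure0 lee_fin /K (_ : cross _ _ = 0) ?normr0 ?mul0r//.
  by rewrite /cross/=; have -> : b.1 = a.1 by [lra]; have -> : c.1 = a.1 by [lra]; ring.
Qed.

End Area.

(** * Isoperimetric inequalities for triangles, quadrilaterals and pentagons *)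

Section Isoperimetry.
Context {R : realType}.
Implicit Types (a b c u v : R * R).

Lemma dot_ge0 u : 0 <= dot u u.
Proof. by rewrite /dot addr_ge0// -expr2 sqr_ge0. Qed.

Lemma enorm_ge0 u : 0 <= enorm u.
Proof. exact: sqrtr_ge0. Qed.

Lemma sqr_enorm u : enorm u ^+ 2 = dot u u.
Proof. by rewrite sqr_sqrtr// dot_ge0. Qed.

(** Lagrange's identity, from which the area formulas in terms of side lengths are derived. *)
Lemma cross_dot u v : cross u v ^+ 2 + dot u v ^+ 2 = enorm u ^+ 2 * enorm v ^+ 2.
Proof. by rewrite !sqr_enorm /cross /dot; ring. Qed.

Lemma ler_dot_enorm u v : dot u v <= enorm u * enorm v.
Proof.
apply: le_trans (ler_norm _) _; rewrite -ler_sqr ?nnegrE ?mulr_ge0 ?enorm_ge0//.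
by rewrite exprMn -cross_dot real_normK ?num_real// lerDr sqr_ge0.
Qed.

Lemma ler_enormD u v : enorm (u + v) <= enorm u + enorm v.
Proof.
rewrite -ler_sqr ?nnegrE ?addr_ge0 ?enorm_ge0//.
have -> : enorm (u + v) ^+ 2 = enorm u ^+ 2 + enorm v ^+ 2 + 2 * dot u v.
  by rewrite !sqr_enorm /dot/=; ring.
by have := ler_dot_enorm u v; lra.
Qed.

Lemma enormN u : enorm (- u) = enorm u.
Proof. by congr Num.sqrt; rewrite /dot/=; ring. Qed.

Lemma distC a b : dist a b = dist b a.
Proof. by rewrite /dist -enormN opprB. Qed.

Lemma dist_triangle a b c : dist a c <= dist a b + dist b c.
Proof. by rewrite /dist -[c - a](subrKA b) addrC ler_enormD. Qed.

Lemma dist_ge0 a b : 0 <= dist a b.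
Proof. exact: enorm_ge0. Qed.

Lemma sqr_dist_dot a b c :
  dist b c ^+ 2 = dist a b ^+ 2 + dist a c ^+ 2 - 2 * dot (b - a) (c - a).
Proof. by rewrite !sqr_enorm /dot/=; ring. Qed.

(** Among triangles with given base [b c] and given sum of the legs the isosceles one is largest: by
    Heron's formula, with legs [x], [y] and base [d], the two sides differ by
    [((x + y) ^+ 2 - d ^+ 2) * (x - y) ^+ 2]. *)
Lemma isosceles_bound a b c :
  4 * cross (b - a) (c - a) ^+ 2 <=
  dist b c ^+ 2 * ((dist a b + dist a c) ^+ 2 - dist b c ^+ 2).
Proof.
have := cross_dot (b - a) (c - a); rewrite -!/(dist _ _) => h.
have := sqr_dist_dot a b c; set X := dot _ _ in h *; set d := dist b c.
set x := dist a b in h *; set y := dist a c in h * => E.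
have := sqr_ge0 (x ^+ 2 - y ^+ 2).
have : X = (x ^+ 2 + y ^+ 2 - d ^+ 2) / 2 by rewrite E; field.
move=> XE _; move: h; rewrite XE; set C := cross _ _ => h.
have -> : 4 * C ^+ 2 = 4 * (x ^+ 2 * y ^+ 2) - (x ^+ 2 + y ^+ 2 - d ^+ 2) ^+ 2.
  by lra.
rewrite -subr_ge0.
rewrite [X in 0 <= X](_ : _ = ((x + y) ^+ 2 - d ^+ 2) * (x - y) ^+ 2); last by ring.
rewrite mulr_ge0 ?sqr_ge0// subr_ge0 ler_sqr ?nnegrE ?addr_ge0 ?dist_ge0//.
by rewrite /d /x /y [dist a b]distC; exact: dist_triangle.
Qed.

Lemma AGM3 (x y z : R) : 0 <= x -> 0 <= y -> 0 <= z ->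
  27 * (x * y * z) <= (x + y + z) ^+ 3.
Proof.
move=> x0 y0 z0; have h (u v : R) : 0 <= (u - v) ^+ 2 by exact: sqr_ge0.
have := mulr_ge0 x0 (h y z); have := mulr_ge0 y0 (h x z); have := mulr_ge0 z0 (h x y).
have := mulr_ge0 x0 (h x y); have := mulr_ge0 x0 (h x z); have := mulr_ge0 y0 (h x y).
have := mulr_ge0 y0 (h y z); have := mulr_ge0 z0 (h x z); have := mulr_ge0 z0 (h y z).
by lra.
Qed.

(* Bretschneider's inequality; the two triangles cut off by a diagonal may be
   on the same side of it, by reflection. *)
Lemma bretschneider a b c e :
  (`|cross (b - a) (c - a)| + `|cross (c - a) (e - a)|) ^+ 2 * 4 <=
  (dist b c + dist c e + dist a e - dist a b) *
  (dist a b + dist c e + dist a e - dist b c) *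
  (dist a b + dist b c + dist a e - dist c e) *
  (dist a b + dist b c + dist c e - dist a e).
Proof.
have := cross_dot (a - b) (c - b); have := cross_dot (c - e) (a - e).
rewrite -!/(dist _ _) [dist b a]distC [dist e c]distC [dist e a]distC.
have := sqr_dist_dot b a c; have := sqr_dist_dot e c a.
rewrite [dist b a]distC [dist e c]distC [dist e a]distC [dist c a]distC.
have -> : cross (c - e) (a - e) = - cross (c - a) (e - a) by rewrite /cross/=; ring.
have -> : cross (a - b) (c - b) = - cross (b - a) (c - a) by rewrite /cross/=; ring.
rewrite !sqrrN -[in cross (b - a) _ ^+ 2]real_normK ?num_real//.
rewrite -[in cross (c - a) _ ^+ 2]real_normK ?num_real//.
have := normr_ge0 (cross (b - a) (c - a)); have := normr_ge0 (cross (c - a) (e - a)).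
set X := `|cross (b - a) _|; set Y := `|cross (c - a) _|.
set C := dot (a - b) _; set D := dot (c - e) _.
have := dist_ge0 a b; have := dist_ge0 b c; have := dist_ge0 c e; have := dist_ge0 a e.
move: (dist a b) (dist b c) (dist c e) (dist a e) (dist a c) => s1 s2 s3 d f.
move=> d0 s30 s20 s10 Y0 X0 E1 E2 H1 H2.
have CD : C - D = (s1 ^+ 2 + s2 ^+ 2 - s3 ^+ 2 - d ^+ 2) / 2 by lra.
have XYCD : X * Y - C * D <= s1 * s2 * (s3 * d).
  apply: le_trans (ler_norm _) _; rewrite -ler_sqr ?nnegrE ?mulr_ge0//.
  rewrite real_normK ?num_real// exprMn [(s1 * s2) ^+ 2]exprMn [(s3 * d) ^+ 2]exprMn.
  rewrite -H1 -H2 -subr_ge0.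
  by rewrite [X in 0 <= X](_ : _ = (X * D + Y * C) ^+ 2) ?sqr_ge0//; ring.
rewrite -subr_ge0.
have : 0 <= 8 * (s1 * s2 * (s3 * d) - (X * Y - C * D)) by rewrite mulr_ge0// subr_ge0.
congr (0 <= _).
have -> : (s2 + s3 + d - s1) * (s1 + s3 + d - s2) * (s1 + s2 + d - s3) * (s1 + s2 + s3 - d) =
  4 * (s1 * s2 + s3 * d) ^+ 2 - 4 * ((s1 ^+ 2 + s2 ^+ 2 - s3 ^+ 2 - d ^+ 2) / 2) ^+ 2 by field.
rewrite -CD.
have -> : (X + Y) ^+ 2 * 4 = 4 * (X ^+ 2 + C ^+ 2) + 4 * (Y ^+ 2 + D ^+ 2) + 8 * (X * Y - C * D) - 4 * (C - D) ^+ 2 by ring.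
by rewrite H1 H2; ring.
Qed.

(** The arithmetic-geometric mean inequality for the three factors of Bretschneider's product in
    which [dist a e] has a plus sign; their sum is [3 * (s + dist a e)]. The extremal shape is the
    trapezoid with three sides [s] on the base [a e]. *)
Lemma quadrilateral_bound a b c e (s := (dist a b + dist b c + dist c e) / 3) :
  (`|cross (b - a) (c - a)| + `|cross (c - a) (e - a)|) ^+ 2 * 4 <=
  (s + dist a e) ^+ 3 * (3 * s - dist a e).
Proof.
apply: le_trans (bretschneider a b c e) _.
have s3 : 3 * s = dist a b + dist b c + dist c e by rewrite /s; field.
rewrite s3 ler_wpM2r//.
  rewrite subr_ge0; apply: le_trans (dist_triangle _ c _) _.
  by rewrite lerD2r; exact: dist_triangle.
have t1 := dist_triangle a c e; have t2 := dist_triangle a b c.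
have t3 := dist_triangle a e b; have t4 := dist_triangle e c b.
have t5 := dist_triangle b a c; have t6 := dist_triangle a e c.
have t7 := dist_triangle c b e; have t8 := dist_triangle b a e.
rewrite ?[dist b a]distC ?[dist e b]distC ?[dist e c]distC ?[dist c b]distC in t3 t4 t5 t6 t7 t8.
have := @AGM3 (dist b c + dist c e + dist a e - dist a b)
  (dist a b + dist c e + dist a e - dist b c) (dist a b + dist b c + dist a e - dist c e).
rewrite [X in 27 * _ <= X ^+ 3](_ : _ = 3 * (s + dist a e)); last by rewrite mulrDr s3; ring.
rewrite exprMn; move=> /(_ _ _ _) h.
suff : 27 * ((dist b c + dist c e + dist a e - dist a b) *
  (dist a b + dist c e + dist a e - dist b c) * (dist a b + dist b c + dist a e - dist c e)) <=
  3 ^+ 3 * (s + dist a e) ^+ 3 by lra.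
by apply: h; lra.
Qed.

(** Two sufficient conditions: a nonpositive discriminant, or nonnegative coefficients, since both
    variables are nonnegative. *)
Lemma quadratic_form_ge0 (A B C m w : R) : 0 <= m -> 0 <= w ->
  0 < A /\ B ^+ 2 <= 4 * A * C \/ [/\ 0 <= A, 0 <= B & 0 <= C] ->
  0 <= A * m ^+ 2 + B * (m * w) + C * w ^+ 2.
Proof.
move=> m0 w0 [[A0 disc]|[A0 B0 C0]]; last by rewrite !addr_ge0 ?mulr_ge0 ?sqr_ge0.
rewrite -(pmulr_rge0 _ A0); have := sqr_ge0 (2 * A * m + B * w).
have : 0 <= (4 * A * C - B ^+ 2) * w ^+ 2 by rewrite mulr_ge0 ?sqr_ge0// subr_ge0.
by lra.
Qed.

(* [C] and [D] are twice the areas of the triangle cut off by a diagonal [d]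
   and of the remaining quadrilateral; [m] and [3 * s] are the lengths of the
   two arcs of the boundary, and [x] is the square root of
   [(3 * s - d) / (s + d)]. *)
Lemma pentagon_certificate (W k l t x m w s d C D A B E : R) :
  0 < k -> 0 <= l <= 1 -> 0 <= m -> 0 <= w ->
  s = (1 + x ^+ 2) * w / 4 -> d = (3 - x ^+ 2) * w / 4 ->
  4 * C <= d * ((k + k^-1) * m - (k - k^-1) * d) ->
  l = 1 \/ 2 * C <= t * (m ^+ 2 - d ^+ 2) ->
  2 * D <= x * w ^+ 2 ->
  A = W - (1 - l) * t / 4 ->
  B = 3 / 2 * (1 + x ^+ 2) * W - l * (k + k^-1) * (3 - x ^+ 2) / 32 ->
  E = 9 / 16 * (1 + x ^+ 2) ^+ 2 * W
    + (l * (k - k^-1) / 128 + (1 - l) * t / 64) * (3 - x ^+ 2) ^+ 2 - x / 4 ->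
  0 < A /\ B ^+ 2 <= 4 * A * E \/ [/\ 0 <= A, 0 <= B & 0 <= E] ->
  (C + D) / 2 <= W * (m + 3 * s) ^+ 2.
Proof.
move=> k0 /andP[l0 l1] m0 w0 sE dE hC hT hD AE BE EE /(quadratic_form_ge0 m0 w0) h.
(* The area of the triangle is bounded by a mean of two bounds: weight [l] for the isosceles one,
   weight [1 - l] for the one given by the angle. *)
have {hT} hC' : (1 - l) * C <= (1 - l) * (t * (m ^+ 2 - d ^+ 2) / 2).
  case: hT => [->|hT]; first by rewrite subrr !mul0r.
  by rewrite ler_wpM2l ?subr_ge0// ler_pdivlMr// mulrC.
have {h} : 0 <= W * (m + 3 * s) ^+ 2
  - (l * (d * ((k + k^-1) * m - (k - k^-1) * d)) / 4 + (1 - l) * (t * (m ^+ 2 - d ^+ 2) / 2)) / 2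
  - x * w ^+ 2 / 4.
  by move: h; rewrite AE BE EE sE dE; move: (k^-1) => k'; lra.
have := ler_wpM2l l0 hC; move: hC' hD.
move: (W * _) (d * _) (t * _ / 2) (x * _) => p q r y; clear.
set lq := l * q; set lr := (1 - l) * r; rewrite mulrBl mul1r mulrCA.
by set lC := l * C; lra.
Qed.

(** The Bernstein basis of degree 4 on [[u, v]], up to positive factors. The discriminant
    [4 * A * E - B ^+ 2] is a quartic in [x]; once its Bernstein coefficients are nonnegative, [lra]
    finds it as a combination of these five. *)
Lemma bernstein4 (x u v : R) : u <= x -> x <= v ->
  [/\ 0 <= (v - x) ^+ 4, 0 <= (x - u) * (v - x) ^+ 3,
      0 <= (x - u) ^+ 2 * (v - x) ^+ 2, 0 <= (x - u) ^+ 3 * (v - x) &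
      0 <= (x - u) ^+ 4].
Proof.
by move=> ux xv; split; rewrite ?mulr_ge0 ?exprn_ge0 ?subr_ge0.
Qed.

(** The number [x] is the tangent of half the base angle of the trapezoid with three sides [s] and
    base [d]. The three numbers given to [pentagon_certificate] are [k], [l], [t]; the bound with
    [k] is sharp for [k ^+ 2 = (m + d) / (m - d)], and [l = 1] ignores the angle. For small [x] the
    quadrilateral is so flat that no information on the angle is needed. The constant 0.06698 is
    just below [1 / (4 * (2 + sqrt 3))], the ratio of area to squared perimeter of the Prismatic
    pentagon. *)
Lemma pentagon_bound_low (x m w s d C D : R)
  (hm : 0 <= m) (hw : 0 <= w)
  (sE : s = (1 + x ^+ 2) * w / 4) (dE : d = (3 - x ^+ 2) * w / 4)
  (hC : forall k, 0 < k -> 4 * C <= d * ((k + k^-1) * m - (k - k^-1) * d))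
  (hD : 2 * D <= x * w ^+ 2) :
  0 <= x -> x <= 51 / 100 -> (C + D) / 2 <= (66 + 98 / 100) / 1000 * (m + 3 * s) ^+ 2.
Proof.
move=> x0 x1.
apply: (@pentagon_certificate _ (5 / 2) (1) (0) x m w s d C D _ _ _ _ _ hm hw sE dE (hC _ _) _ hD erefl erefl erefl); [clear; lra|clear; lra|clear; lra|by left|].
left; clear -x0 x1; split; first by lra.
by have [] := bernstein4 x0 x1; lra.
Qed.

(** Here the base [d] is at most about 1.08 times [s], again far enough from the optimal shape to
    ignore the angle. The upper end 1.733 exceeds [sqrt 3], the value of [x] at [d = 0]. *)
Lemma pentagon_bound_high (x m w s d C D : R)
  (hm : 0 <= m) (hw : 0 <= w)
  (sE : s = (1 + x ^+ 2) * w / 4) (dE : d = (3 - x ^+ 2) * w / 4)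
  (hC : forall k, 0 < k -> 4 * C <= d * ((k + k^-1) * m - (k - k^-1) * d))
  (hD : 2 * D <= x * w ^+ 2) :
  24 / 25 <= x -> x <= 1733 / 1000 -> (C + D) / 2 <= (66 + 98 / 100) / 1000 * (m + 3 * s) ^+ 2.
Proof.
move=> x0 x1.
have [xu0|/ltW ux0] := lerP x (139 / 125).
  apply: (@pentagon_certificate _ (79 / 20) (1) (0) x m w s d C D _ _ _ _ _ hm hw sE dE (hC _ _) _ hD erefl erefl erefl); [clear; lra|clear; lra|clear; lra|by left|].
  left; clear -x0 xu0; split; first by lra.
  by have [] := bernstein4 x0 xu0; lra.
have [xu1|/ltW ux1] := lerP x (697 / 500).
  apply: (@pentagon_certificate _ (61 / 10) (1) (0) x m w s d C D _ _ _ _ _ hm hw sE dE (hC _ _) _ hD erefl erefl erefl); [clear; lra|clear; lra|clear; lra|by left|].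
  left; clear -ux0 xu1; split; first by lra.
  by have [] := bernstein4 ux0 xu1; lra.
apply: (@pentagon_certificate _ (59 / 20) (1) (0) x m w s d C D _ _ _ _ _ hm hw sE dE (hC _ _) _ hD erefl erefl erefl); [clear; lra|clear; lra|clear; lra|by left|].
(* On this last interval all three coefficients are nonnegative, and the discriminant is not
   consulted. *)
right; clear -ux1 x1; split; [lra|nra|].
by have [] := bernstein4 ux1 x1; lra.
Qed.

(** The isoperimetric inequality for pentagons, nearly sharp: 0.06883 is just above
    [1 / (20 * tan 36)] (in degrees), about 0.068819, the ratio for the regular pentagon. That
    pentagon has [x] about 0.7265 and optimal [k] about 3.078, whence 61/20 and 31/10 around the cut
    at 0.73. *)
Lemma pentagon_bound (x m w s d C D : R)
  (hm : 0 <= m) (hw : 0 <= w)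
  (sE : s = (1 + x ^+ 2) * w / 4) (dE : d = (3 - x ^+ 2) * w / 4)
  (hC : forall k, 0 < k -> 4 * C <= d * ((k + k^-1) * m - (k - k^-1) * d))
  (hD : 2 * D <= x * w ^+ 2) :
  0 <= x -> x <= 1733 / 1000 ->
  (C + D) / 2 <= (68 + 83 / 100) / 1000 * (m + 3 * s) ^+ 2.
Proof.
move=> x0 x3.
have L0 := sqr_ge0 (m + 3 * s).
have [xl|/ltW lx] := lerP x (51 / 100).
  by apply: le_trans (pentagon_bound_low hm hw sE dE hC hD x0 xl) _; clear -L0; lra.
have [xh|/ltW hx] := lerP x (24 / 25); last first.
  by apply: le_trans (pentagon_bound_high hm hw sE dE hC hD hx x3) _; clear -L0; lra.
have [xu0|/ltW ux0] := lerP x (73 / 100).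
  apply: (@pentagon_certificate _ (61 / 20) (1) (0) x m w s d C D _ _ _ _ _ hm hw sE dE (hC _ _) _ hD erefl erefl erefl); [clear; lra|clear; lra|clear; lra|by left|].
  left; clear -lx xu0; split; first by lra.
  by have [] := bernstein4 lx xu0; lra.
have [xu1|/ltW ux1] := lerP x (391 / 500).
  apply: (@pentagon_certificate _ (31 / 10) (1) (0) x m w s d C D _ _ _ _ _ hm hw sE dE (hC _ _) _ hD erefl erefl erefl); [clear; lra|clear; lra|clear; lra|by left|].
  left; clear -ux0 xu1; split; first by lra.
  by have [] := bernstein4 ux0 xu1; lra.
apply: (@pentagon_certificate _ (67 / 20) (1) (0) x m w s d C D _ _ _ _ _ hm hw sE dE (hC _ _) _ hD erefl erefl erefl); [clear; lra|clear; lra|clear; lra|by left|].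
left; clear -ux1 xh; split; first by lra.
by have [] := bernstein4 ux1 xh; lra.
Qed.

(** The factor 23/20 bounds the tangent of half an angle up to 0.527 pi. The constant 0.06873 is
    just below the inverse square of 3.81421, the target for an angle [pi / 2]. *)
Lemma pentagon_bound_obtuse (x m w s d C D : R)
  (hm : 0 <= m) (hw : 0 <= w)
  (sE : s = (1 + x ^+ 2) * w / 4) (dE : d = (3 - x ^+ 2) * w / 4)
  (hC : forall k, 0 < k -> 4 * C <= d * ((k + k^-1) * m - (k - k^-1) * d))
  (hD : 2 * D <= x * w ^+ 2) :
  0 <= x -> x <= 1733 / 1000 ->
  2 * C <= 23 / 20 * (m ^+ 2 - d ^+ 2) ->
  (C + D) / 2 <= (68 + 73 / 100) / 1000 * (m + 3 * s) ^+ 2.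
Proof.
move=> x0 x3 hT.
have L0 := sqr_ge0 (m + 3 * s).
have [xl|/ltW lx] := lerP x (51 / 100).
  by apply: le_trans (pentagon_bound_low hm hw sE dE hC hD x0 xl) _; clear -L0; lra.
have [xh|/ltW hx] := lerP x (24 / 25); last first.
  by apply: le_trans (pentagon_bound_high hm hw sE dE hC hD hx x3) _; clear -L0; lra.
have [xu0|/ltW ux0] := lerP x (369 / 500).
  apply: (@pentagon_certificate _ (29 / 10) (19 / 20) (23 / 20) x m w s d C D _ _ _ _ _ hm hw sE dE (hC _ _) _ hD erefl erefl erefl); [clear; lra|clear; lra|clear; lra|by right|].
  left; clear -lx xu0; split; first by lra.
  (* On shorter intervals the Bernstein test is finer; [k] and [l] stay the same. *)
  have [xv0_0|/ltW vx0_0] := lerP x (567 / 1000).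
    by have [] := bernstein4 lx xv0_0; lra.
  have [xv0_1|/ltW vx0_1] := lerP x (78 / 125).
    by have [] := bernstein4 vx0_0 xv0_1; lra.
  by have [] := bernstein4 vx0_1 xu0; lra.
have [xu1|/ltW ux1] := lerP x (433 / 500).
  apply: (@pentagon_certificate _ (3) (9 / 10) (23 / 20) x m w s d C D _ _ _ _ _ hm hw sE dE (hC _ _) _ hD erefl erefl erefl); [clear; lra|clear; lra|clear; lra|by right|].
  left; clear -ux0 xu1; split; first by lra.
  by have [] := bernstein4 ux0 xu1; lra.
apply: (@pentagon_certificate _ (33 / 10) (17 / 20) (23 / 20) x m w s d C D _ _ _ _ _ hm hw sE dE (hC _ _) _ hD erefl erefl erefl); [clear; lra|clear; lra|clear; lra|by right|].
left; clear -ux1 xh; split; first by lra.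
by have [] := bernstein4 ux1 xh; lra.
Qed.

(** The factor 1 is the tangent of [pi / 4], for angles up to [pi / 2]. The constant 0.06814 is just
    below the inverse square of 3.83071, the target for an angle [pi / 3]. *)
Lemma pentagon_bound_right (x m w s d C D : R)
  (hm : 0 <= m) (hw : 0 <= w)
  (sE : s = (1 + x ^+ 2) * w / 4) (dE : d = (3 - x ^+ 2) * w / 4)
  (hC : forall k, 0 < k -> 4 * C <= d * ((k + k^-1) * m - (k - k^-1) * d))
  (hD : 2 * D <= x * w ^+ 2) :
  0 <= x -> x <= 1733 / 1000 ->
  2 * C <= 1 * (m ^+ 2 - d ^+ 2) ->
  (C + D) / 2 <= (68 + 14 / 100) / 1000 * (m + 3 * s) ^+ 2.
Proof.
move=> x0 x3 hT.
have L0 := sqr_ge0 (m + 3 * s).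
have [xl|/ltW lx] := lerP x (51 / 100).
  by apply: le_trans (pentagon_bound_low hm hw sE dE hC hD x0 xl) _; clear -L0; lra.
have [xh|/ltW hx] := lerP x (24 / 25); last first.
  by apply: le_trans (pentagon_bound_high hm hw sE dE hC hD hx x3) _; clear -L0; lra.
have [xu0|/ltW ux0] := lerP x (33 / 50).
  apply: (@pentagon_certificate _ (5 / 2) (17 / 20) (1) x m w s d C D _ _ _ _ _ hm hw sE dE (hC _ _) _ hD erefl erefl erefl); [clear; lra|clear; lra|clear; lra|by right|].
  left; clear -lx xu0; split; first by lra.
  by have [] := bernstein4 lx xu0; lra.
have [xu1|/ltW ux1] := lerP x (351 / 500).
  apply: (@pentagon_certificate _ (49 / 20) (4 / 5) (1) x m w s d C D _ _ _ _ _ hm hw sE dE (hC _ _) _ hD erefl erefl erefl); [clear; lra|clear; lra|clear; lra|by right|].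
  left; clear -ux0 xu1; split; first by lra.
  by have [] := bernstein4 ux0 xu1; lra.
have [xu2|/ltW ux2] := lerP x (94 / 125).
  apply: (@pentagon_certificate _ (13 / 5) (4 / 5) (1) x m w s d C D _ _ _ _ _ hm hw sE dE (hC _ _) _ hD erefl erefl erefl); [clear; lra|clear; lra|clear; lra|by right|].
  left; clear -ux1 xu2; split; first by lra.
  by have [] := bernstein4 ux1 xu2; lra.
have [xu3|/ltW ux3] := lerP x (413 / 500).
  apply: (@pentagon_certificate _ (57 / 20) (4 / 5) (1) x m w s d C D _ _ _ _ _ hm hw sE dE (hC _ _) _ hD erefl erefl erefl); [clear; lra|clear; lra|clear; lra|by right|].
  left; clear -ux2 xu3; split; first by lra.
  by have [] := bernstein4 ux2 xu3; lra.
apply: (@pentagon_certificate _ (17 / 5) (17 / 20) (1) x m w s d C D _ _ _ _ _ hm hw sE dE (hC _ _) _ hD erefl erefl erefl); [clear; lra|clear; lra|clear; lra|by right|].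
left; clear -ux3 xh; split; first by lra.
by have [] := bernstein4 ux3 xh; lra.
Qed.

(** The factor 29/50 is just above the tangent of [pi / 6], for angles up to [pi / 3]. The constant
    0.06698 is just below the inverse square of 3.86371, the target for the angle 0. *)
Lemma pentagon_bound_acute (x m w s d C D : R)
  (hm : 0 <= m) (hw : 0 <= w)
  (sE : s = (1 + x ^+ 2) * w / 4) (dE : d = (3 - x ^+ 2) * w / 4)
  (hC : forall k, 0 < k -> 4 * C <= d * ((k + k^-1) * m - (k - k^-1) * d))
  (hD : 2 * D <= x * w ^+ 2) :
  0 <= x -> x <= 1733 / 1000 ->
  2 * C <= 29 / 50 * (m ^+ 2 - d ^+ 2) ->
  (C + D) / 2 <= (66 + 98 / 100) / 1000 * (m + 3 * s) ^+ 2.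
Proof.
move=> x0 x3 hT.
have L0 := sqr_ge0 (m + 3 * s).
have [xl|/ltW lx] := lerP x (51 / 100).
  by apply: le_trans (pentagon_bound_low hm hw sE dE hC hD x0 xl) _; clear -L0; lra.
have [xh|/ltW hx] := lerP x (24 / 25); last first.
  by apply: le_trans (pentagon_bound_high hm hw sE dE hC hD hx x3) _; clear -L0; lra.
have [xu0|/ltW ux0] := lerP x (397 / 500).
  apply: (@pentagon_certificate _ (31 / 10) (7 / 10) (29 / 50) x m w s d C D _ _ _ _ _ hm hw sE dE (hC _ _) _ hD erefl erefl erefl); [clear; lra|clear; lra|clear; lra|by right|].
  left; clear -lx xu0; split; first by lra.
  by have [] := bernstein4 lx xu0; lra.
have [xu1|/ltW ux1] := lerP x (469 / 500).
  apply: (@pentagon_certificate _ (39 / 10) (7 / 10) (29 / 50) x m w s d C D _ _ _ _ _ hm hw sE dE (hC _ _) _ hD erefl erefl erefl); [clear; lra|clear; lra|clear; lra|by right|].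
  left; clear -ux0 xu1; split; first by lra.
  by have [] := bernstein4 ux0 xu1; lra.
apply: (@pentagon_certificate _ (15 / 4) (17 / 20) (29 / 50) x m w s d C D _ _ _ _ _ hm hw sE dE (hC _ _) _ hD erefl erefl erefl); [clear; lra|clear; lra|clear; lra|by right|].
left; clear -ux1 xh; split; first by lra.
by have [] := bernstein4 ux1 xh; lra.
Qed.

End Isoperimetry.

(** * Bounds for the tangent of a half angle, [sin x / (1 + cos x)] *)

Section Trigonometry.
Context {R : realType}.
Implicit Types x t : R.

Lemma sin_le_id x : 0 <= x -> sin x <= x.
Proof.
move=> x0; have D (y : R) : y \in `]0, x[ -> is_derive y 1 sin (cos y).
  by move=> _; exact: is_derive_sin.
have C : {within `[0, x], continuous (@sin R)}.
  by apply: continuous_subspaceT => y; exact: continuous_sin.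
have [c _] := MVT_segment x0 D C; rewrite sin0 !subr0 => ->.
by rewrite ler_piMl// cos_le1.
Qed.

Lemma cos_pi3 : cos (pi / 3) = 1 / 2 :> R.
Proof.
have p0 : 0 < pi :> R by exact: pi_gt0.
have c0 : 0 < cos (pi / 3 : R) by apply: cos_gt0_pihalf; lra.
have : cos (pi / 3 *+ 2) = - cos (pi / 3) :> R.
  rewrite (_ : pi / 3 *+ 2 = - (pi / 3) + pi); last by field.
  by rewrite cosDpi cosN.
by rewrite cos_mulr2n; nra.
Qed.

Lemma cos_2pi3 : cos (2 * pi / 3) = - (1 / 2) :> R.
Proof.
rewrite (_ : 2 * pi / 3 = - (pi / 3) + pi); last by field.
by rewrite cosDpi cosN cos_pi3.
Qed.

Lemma sin_le_acute x : 0 <= x <= pi / 3 -> sin x <= 29 / 50 * (1 + cos x).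
Proof.
move=> /andP[x0 x1]; have p0 : 0 < pi :> R by exact: pi_gt0.
have c : 1 / 2 <= cos x.
  rewrite -cos_pi3; move: x1; rewrite le_eqVlt => /predU1P[->//|x1].
  by apply/ltW; rewrite ltr_cos// in_itv/=; lra.
rewrite -ler_sqr ?nnegrE; [|by apply: sin_ge0_pi; lra|lra].
by rewrite sin2cos2; have := cos_le1 x; nra.
Qed.

Lemma sin_le_right x : 0 <= x <= pi / 2 -> sin x <= 1 * (1 + cos x).
Proof.
move=> /andP[x0 x1]; have p0 : 0 < pi :> R by exact: pi_gt0.
have : 0 <= cos x by apply: cos_ge0_pihalf; lra.
by have := sin_le1 x; lra.
Qed.

(** The crude estimate [pi < 4] suffices: it gives [cos x >= - 0.108], and 1.15 times 0.892 exceeds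
    1. *)
Lemma sin_le_obtuse x : pi / 2 <= x -> x <= 527 / 1000 * pi ->
  sin x <= 23 / 20 * (1 + cos x).
Proof.
move=> x0 x1; have p4 := @pihalf_lt2 R.
have : sin (x - pi / 2) <= x - pi / 2 by apply: sin_le_id; lra.
by rewrite sinBpihalf; have := sin_le1 x; lra.
Qed.

End Trigonometry.

Ltac numeric h := first [by clear; lra | by clear - h; lra].

(** * Perimeter bounds for five and for three points *)

Section FivePoints.
Context {R : realType}.
Implicit Types p : R * R.

(* The three triangles cover a pentagon with vertices [p0], ..., [p4]; for
   nonconvex ones they overlap, whence the unsigned areas. The constant
   [3.86371] is just above the perimeter [2 * sqrt (2 + sqrt 3)] of the Cairo
   and Prismatic pentagons. *)
Lemma five_point_bound (p0 p1 p2 p3 p4 : R * R) (t : R) :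
  dot (p1 - p0) (p4 - p0) = dist p0 p1 * dist p0 p4 * cos t ->
  0 <= t <= pi ->
  2 <= `|cross (p2 - p1) (p3 - p1)| + `|cross (p3 - p1) (p4 - p1)| +
       `|cross (p1 - p0) (p4 - p0)| ->
  (386 + 371 / 1000) / 100 - 99 / 1000 * (t / pi) <=
  dist p0 p1 + dist p1 p2 + dist p2 p3 + dist p3 p4 + dist p4 p0.
Proof.
move=> dotE /andP[t0 tpi]; have p0pi : 0 < pi :> R by exact: pi_gt0.
set D := `|_| + `|_|; set C := `|cross (p1 - p0) _| => CD.
set d := dist p1 p4; set m := dist p0 p1 + dist p0 p4.
set s := (dist p1 p2 + dist p2 p3 + dist p3 p4) / 3.
have -> : dist p0 p1 + dist p1 p2 + dist p2 p3 + dist p3 p4 + dist p4 p0 = m + 3 * s.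
  by rewrite /m /s [dist p4 p0]distC; field.
have m0 : 0 <= m by rewrite addr_ge0 ?dist_ge0.
have d0 : 0 <= d by exact: dist_ge0.
have dm : d <= m by rewrite /d /m [dist p0 p1]distC; exact: dist_triangle.
have s0 : 0 <= s by rewrite divr_ge0// !addr_ge0 ?dist_ge0.
have ds : d <= 3 * s.
  rewrite /s mulrC divfK//; apply: le_trans (dist_triangle _ p3 _) _.
  by rewrite lerD2r; exact: dist_triangle.
set w := s + d; have w0 : 0 <= w by rewrite addr_ge0.
(* If [w = 0], the division gives [x = 0]; then [s] and [d] vanish as well, and the relations below
   persist. *)
set x := Num.sqrt ((3 * s - d) / w).
have x0 : 0 <= x by exact: sqrtr_ge0.
have xE : x ^+ 2 * w = 3 * s - d.
  rewrite sqr_sqrtr ?divr_ge0 ?subr_ge0//.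
  have [w00|w00] := eqVneq w 0; last by rewrite divfK.
  by rewrite w00 mulr0; move: w00; rewrite /w; lra.
have sE : s = (1 + x ^+ 2) * w / 4 by rewrite mulrDl xE /w; field.
have dE : d = (3 - x ^+ 2) * w / 4 by rewrite mulrBl xE /w; field.
have x1 : x <= 1733 / 1000.
  rewrite -ler_sqr ?nnegrE; [|by []|lra].
  have [w00|w00] := eqVneq w 0.
    by rewrite /x w00 invr0 mulr0 sqrtr0; lra.
  have wp : 0 < w by rewrite lt_def w00.
  rewrite -(ler_pM2r wp) xE /w; lra.
(* The isosceles bound contains a square root of [(m - d) * (m + d)], which is linearised by twice
   the root being at most [k * (m - d) + k^-1 * (m + d)]. *)
have hC k : 0 < k -> 4 * C <= d * ((k + k^-1) * m - (k - k^-1) * d).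
  move=> k0; have E : d * ((k + k^-1) * m - (k - k^-1) * d) = d * (k * (m - d) + k^-1 * (m + d)) by ring.
  have k'0 : 0 < k^-1 by rewrite invr_gt0.
  have md : 0 <= m - d by rewrite subr_ge0.
  have md' : 0 <= m + d by exact: addr_ge0.
  have Y0 : 0 <= k * (m - d) + k^-1 * (m + d).
    by apply: addr_ge0; apply: mulr_ge0 => //; exact: ltW.
  rewrite E -ler_sqr ?nnegrE ?mulr_ge0 ?normr_ge0//.
  have := isosceles_bound p0 p1 p4; rewrite -/d -/m -[cross _ _ ^+ 2]real_normK ?num_real// -/C => h.
  have : 4 * (m ^+ 2 - d ^+ 2) <= (k * (m - d) + k^-1 * (m + d)) ^+ 2.
    have := sqr_ge0 (k * (m - d) - k^-1 * (m + d)).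
    have : k * k^-1 = 1 by rewrite divff ?gt_eqF.
    move: (k^-1) => k' kk' h2.
    have -> : 4 * (m ^+ 2 - d ^+ 2) = 4 * (k * k') * (m ^+ 2 - d ^+ 2) by rewrite kk' mulr1.
    by rewrite -subr_ge0; move: h2; congr (0 <= _); ring.
  move=> /(ler_wpM2l (sqr_ge0 d)); rewrite -exprMn => /(le_trans _); apply.
  by move: h; clear; lra.
have hD : 2 * D <= x * w ^+ 2.
  rewrite -ler_sqr ?nnegrE ?mulr_ge0 ?exprn_ge0 ?addr_ge0 ?normr_ge0//.
  have h : D ^+ 2 * 4 <= w ^+ 3 * (x ^+ 2 * w).
    by rewrite xE; exact: quadrilateral_bound.
  rewrite exprMn [(x * _) ^+ 2]exprMn; apply: le_trans (le_trans h _).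
    by rewrite mulrC; clear; lra.
  by rewrite le_eqVlt; apply/orP; left; apply/eqP; ring.
have mdE : m ^+ 2 - d ^+ 2 = 2 * (dist p0 p1 * dist p0 p4 * (1 + cos t)).
  by rewrite /d (sqr_dist_dot p0) dotE /m; ring.
have CE : C = dist p0 p1 * dist p0 p4 * sin t.
  apply/eqP; rewrite -(@eqrXn2 _ 2) ?normr_ge0 ?mulr_ge0 ?dist_ge0 ?sin_ge0_pi ?t0//.
    have := cross_dot (p1 - p0) (p4 - p0); rewrite dotE.
    rewrite real_normK ?num_real// -!/(dist _ _) => h.
    apply/eqP; rewrite [RHS]exprMn sin2cos2.
    move: h; rewrite !exprMn; move: (cross _ _ ^+ 2) => z; clear; lra.
(* By the law of cosines [m ^+ 2 - d ^+ 2] is twice the product of the legs times [1 + cos t], so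
   [z] stands for a bound on the tangent of [t / 2]. *)
have hT z : sin t <= z * (1 + cos t) -> 2 * C <= z * (m ^+ 2 - d ^+ 2).
  move=> h; rewrite mdE CE.
  have : 0 <= dist p0 p1 * dist p0 p4 by rewrite mulr_ge0 ?dist_ge0.
  by move=> /ler_wpM2l/(_ _ _ h); clear; lra.
set y := t / pi; have yE : t = y * pi by rewrite /y divfK// gt_eqF.
have y0 : 0 <= y by rewrite divr_ge0// ltW.
have L0 : 0 <= m + 3 * s by rewrite addr_ge0// mulr_ge0.
have fin (W V : R) : 0 < V -> (C + D) / 2 <= W * (m + 3 * s) ^+ 2 -> W * V ^+ 2 <= 1 ->
    0 < W -> V <= m + 3 * s.
  move=> V0 h1 h2 W0; have : W * V ^+ 2 <= W * (m + 3 * s) ^+ 2 by clear -h1 h2 CD; lra.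
  by rewrite ler_pM2l// ler_sqr ?nnegrE//; exact: ltW.
(* The target decreases in [y], so on each range its value at the left end is proved: 3.86371 at 0,
   3.83071 at 1/3, 3.81421 at 1/2, and 3.81154 at 0.527. *)
have [ya|ay] := leP y (1 / 3).
  apply: le_trans (fin _ ((386 + 371 / 1000) / 100) _ (@pentagon_bound_acute _ _ _ _ _ _ _ _ m0 w0 sE dE hC hD x0 x1 (hT _ _)) _ _); [numeric y0|numeric y0| |numeric y0|numeric y0].
  clear -t0 yE y0 p0pi ya; apply: sin_le_acute; rewrite t0 yE; nra.
have [yb|by_] := leP y (1 / 2).
  apply: le_trans (fin _ ((383 + 71 / 1000) / 100) _ (@pentagon_bound_right _ _ _ _ _ _ _ _ m0 w0 sE dE hC hD x0 x1 (hT _ _)) _ _); [numeric ay|numeric ay| |numeric ay|numeric ay].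
  clear -t0 yE y0 p0pi yb; apply: sin_le_right; rewrite t0 yE; nra.
have [yc|cy] := leP y (527 / 1000).
  apply: le_trans (fin _ ((381 + 421 / 1000) / 100) _ (@pentagon_bound_obtuse _ _ _ _ _ _ _ _ m0 w0 sE dE hC hD x0 x1 (hT _ _)) _ _); [numeric by_|numeric by_| |numeric by_|numeric by_].
  clear -t0 yE y0 p0pi by_ yc; apply: sin_le_obtuse; rewrite yE; nra.
(* From here on the target lies below the perimeter of the regular pentagon, so the angle no longer
   matters. *)
apply: le_trans (fin _ ((381 + 154 / 1000) / 100) _ (@pentagon_bound _ _ _ _ _ _ _ _ m0 w0 sE dE hC hD x0 x1) _ _); numeric cy.
Qed.

(* The constant is just below [2 * 3 ^ (3 / 4)], the perimeter of the equilateral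
   triangle of unit area. *)
Lemma triangle_bound (a b c : R * R) : 2 <= `|cross (b - a) (c - a)| ->
  (455 + 9 / 10) / 100 <= dist a b + dist b c + dist c a.
Proof.
(* With the fourth vertex equal to the first, Bretschneider's inequality becomes Heron's formula. *)
move=> h; have := bretschneider a b c a.
have -> : cross (c - a) (a - a) = 0 by rewrite /cross/=; ring.
rewrite normr0 addr0 [dist a a](_ : _ = 0); last first.
  by rewrite /dist subrr /enorm /dot/= !mul0r addr0 sqrtr0.
rewrite !addr0 subr0; set L := dist a b + dist b c + dist c a => H.
have t1 := dist_triangle a c b; have t2 := dist_triangle b a c; have t3 := dist_triangle a b c.
rewrite ![dist a c]distC ![dist b a]distC ![dist c b]distC in t1 t2 t3 H *.
have := @AGM3 R (dist b c + dist c a - dist a b) (dist a b + dist c a - dist b c) (dist a b + dist b c - dist c a).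
move=> /(_ _ _ _) A; have {}A : 27 * ((dist b c + dist c a - dist a b) * (dist a b + dist c a - dist b c) * (dist a b + dist b c - dist c a)) <= L ^+ 3.
  apply: le_trans (A _ _ _) _; [clear -t1 t2 t3; lra|clear -t1 t2 t3; lra|clear -t1 t2 t3; lra|].
  by rewrite le_eqVlt; apply/orP; left; apply/eqP; rewrite /L; ring.
have L0 : 0 <= L by rewrite !addr_ge0 ?dist_ge0.
have H2 : 27 * 16 <= L ^+ 4.
  have : 27 * (`|cross (b - a) (c - a)| ^+ 2 * 4) <= L ^+ 3 * L.
    apply: le_trans (ler_wpM2l _ H) _; first lra.
    by rewrite mulrA ler_wpM2r// /L; lra.
  rewrite -exprSr; apply: le_trans; nra.
rewrite leNgt; apply/negP => Ls.
have : L ^+ 4 < ((455 + 9 / 10) / 100) ^+ 4 by rewrite ltr_pXn2r// nnegrE; lra.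
by lra.
Qed.

End FivePoints.

(** * Segments and compactness in the plane *)

Section Plane.
Context {R : realType}.
Implicit Types (x y u v : R * R) (A F : set (R * R)).

Lemma norm_fst_le u : `|u.1| <= `|u|.
Proof. by rewrite prod_normE le_max lexx. Qed.

Lemma norm_snd_le u : `|u.2| <= `|u|.
Proof. by rewrite prod_normE le_max lexx orbT. Qed.

Lemma continuous_affine_plane u v : continuous (fun t : R => u + t *: v).
Proof.
move=> t; apply: cvgD; first exact: cvg_cst.
by apply: cvgZr_tmp; exact: cvg_id.
Qed.

Lemma segmentE u v : segment u v = (fun t : R => u + t *: (v - u)) @` `[0, 1].
Proof.
apply/seteqP; split => x [t tI <-]; exists t; move: tI; rewrite /= ?in_itv//= => _;
  by apply: plane_eq => /=; rewrite /GRing.scale/=; ring.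
Qed.

Lemma connected_segment u v : connected (segment u v).
Proof.
rewrite segmentE; apply: connected_continuous_connected; first exact: segment_connected.
by apply: continuous_subspaceT; exact: continuous_affine_plane.
Qed.

Lemma compact_segment u v : compact (segment u v).
Proof.
rewrite segmentE; apply: continuous_compact; last exact: segment_compact.
by apply: continuous_subspaceT; exact: continuous_affine_plane.
Qed.

Lemma closed_segment u v : closed (segment u v).
Proof.
apply: compact_closed; last exact: compact_segment.
exact: norm_hausdorff.
Qed.

Lemma compact_closed_away A F : compact A -> closed F -> A `&` F = set0 ->
  exists2 e : R, 0 < e & forall x y, A x -> `|y - x| < e -> ~ F y.
Proof.
move=> /compact_near_coveringP cA cF AF.
have [|e /= e0 H] := cA R (0^'+) (fun e x => forall y, `|y - x| < e -> ~ F y) _.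
  move=> x Ax; have nF : nbhs x (~` F).
    apply: open_nbhs_nbhs; split; first exact: closed_openC.
    by move=> Fx; rewrite -[False]/(set0 x) -AF.
  have [d /= d0 dF] := (nbhs_ballP _ _).1 nF.
  exists (ball x (d / 2), [set e | e < d / 2]) => /=.
    split; first by apply: nbhsx_ballx; rewrite divr_gt0.
    by exists (d / 2) => /=; [rewrite divr_gt0|move=> e /=; rewrite sub0r normrN => h h0; rewrite (le_lt_trans (ler_norm _))].
  move=> [x' e] /= [xx' ed] y yx'; apply: dF; rewrite -ball_normE /=.
  rewrite -ball_normE /= in xx'.
  rewrite (_ : x - y = (x - x') - (y - x')); last by rewrite opprB addrA subrK.
  apply: le_lt_trans (ler_normB _ _) _.
  by rewrite [ltRHS](splitr d) ltrD// (lt_trans yx').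
exists (e / 2); first by rewrite divr_gt0.
move=> x y Ax yx; apply: (H (e / 2) _ _ x) => //=; last by rewrite divr_gt0.
by rewrite sub0r normrN gtr0_norm ?divr_gt0// ltr_pdivrMr// ltr_pMr// ltr1n.
Qed.

End Plane.

(** * The enclosed region: rays, fans and half-planes *)

Section Region.
Context {R : realType}.
Implicit Types (p : pentagon R) (k l : 'I_5) (x y u v : R * R).

Lemma closed_boundary p : closed (boundary p).
Proof.
apply: closed_bigcup => [|k _]; last exact: closed_segment.
exact: finite_finset.
Qed.

Lemma segment_left x y : segment x y x.
Proof. by exists 0 => /=; rewrite ?lexx ?ler01// scale0r addr0 subr0 scale1r. Qed.

Lemma segment_right x y : segment x y y.
Proof. by exists 1 => /=; rewrite ?lexx ?ler01// subrr scale0r add0r scale1r. Qed.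

Lemma region_connected p (B : set (R * R)) x y : connected B ->
  (forall z, B z -> ~ boundary p z) -> B x -> B y -> region p x -> region p y.
Proof.
move=> cB nB Bx By [bx|[nx bdx]]; first by have := nB _ Bx.
right; split; first exact: nB.
rewrite -(@same_connected_component _ _ x)//.
exact: (connected_component_max Bx nB cB).
Qed.

Lemma region_segment p x y : (forall z, segment x y z -> ~ boundary p z) ->
  region p x <-> region p y.
Proof.
move=> h; have c := region_connected (@connected_segment R x y) h.
by split; apply: c; [exact: segment_left|exact: segment_right|exact: segment_right|exact: segment_left].
Qed.

(** The ray joins [x] to points of arbitrarily large norm inside one component of the complement of
    the boundary, which is therefore unbounded. *)
Lemma region_escape p x v : v != 0 ->
  (forall s : R, 0 <= s -> ~ boundary p (x + s *: v)) -> ~ region p x.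
Proof.
move=> v0 h [bx|[nx]]; first by apply: (h 0); rewrite ?scale0r ?addr0.
move=> [M [Mr /(_ (`|M| + 1))]]; rewrite (le_lt_trans (ler_norm M)) ?ltrDl// => /(_ isT) H.
have vp : 0 < `|v| by rewrite normr_gt0.
pose s := (`|x| + `|M| + 2) / `|v|.
have s0 : 0 <= s by rewrite divr_ge0// !addr_ge0.
have : `|x + s *: v| <= `|M| + 1.
  apply: H; apply: (connected_component_max (segment_left x (x + s *: v)) _ (@connected_segment R _ _)).
    move=> _ [t /= /andP[t0 t1] <-].
    have -> : (1 - t) *: x + t *: (x + s *: v) = x + (t * s) *: v.
      by rewrite scalerDr addrA -scalerDl subrK scale1r scalerA.
    by apply: h; exact: mulr_ge0.
  exact: segment_right.
rewrite leNgt => /negP; apply.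
set w := _ *: v; have : `|w| <= `|x + w| + `|x|.
  by rewrite -{1}(addKr x w) addrC -[- x]opprK opprK ler_normB.
by rewrite /w /s normrZ ger0_norm// divfK ?gt_eqF//; lra.
Qed.

Lemma dotDr u v x : dot u (v + x) = dot u v + dot u x.
Proof. by rewrite /dot/=; ring. Qed.

Lemma dotZr u v (t : R) : dot u (t *: v) = t * dot u v.
Proof. by rewrite /dot/= /GRing.scale/=; ring. Qed.

(** The ray from [x] pointing away from [o] has to meet an edge, and [x] lies between [o] and that
    point. The apex [o] is arbitrary; for nonconvex pentagons the triangles overlap. *)
Lemma region_fan p o x : region p x -> exists k, triangle o (p k) (p (ordS k)) x.
Proof.
move=> rx; apply: contrapT => /forallNP nT.
have xo : x - o != 0.
  apply/eqP => /eqP; rewrite subr_eq0 => /eqP xo; apply: (nT ord0).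
  by exists 0, 0; split; rewrite ?scale0r ?addr0 ?ler01.
apply: (region_escape xo) rx => s s0 [k _ [t /= /andP[t0 t1] E]].
apply: (nT k); exists ((1 - t) / (1 + s)), (t / (1 + s)).
have s1 : 0 < 1 + s by rewrite ltr_wpDr.
split; rewrite ?divr_ge0 ?subr_ge0 ?(ltW s1)//.
  by rewrite -mulrDl subrK mul1r invf_le1// lerDl.
have /(congr1 fst) E1 := E; have /(congr1 snd) E2 := E.
rewrite /= /GRing.scale/= in E1 E2.
apply: plane_eq => /=; rewrite /GRing.scale/=; apply: (mulfI (lt0r_neq0 s1)).
  by transitivity (x.1 + s * (x.1 - o.1) + s * o.1); [ring|rewrite -E1; field; rewrite lt0r_neq0].
by transitivity (x.2 + s * (x.2 - o.2) + s * o.2); [ring|rewrite -E2; field; rewrite lt0r_neq0].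
Qed.

Lemma boundary_dot p u x : boundary p x -> exists k, dot u x <= dot u (p k).
Proof.
move=> [k _ [t /= /andP[t0 t1] <-]]; rewrite dotDr !dotZr.
have [h|h] := leP (dot u (p k)) (dot u (p (ordS k))).
  by exists (ordS k); nra.
by exists k; nra.
Qed.

(** The region lies in the convex hull of the vertices: otherwise the ray from [x] in the direction
    [u] would escape. *)
Lemma region_dot p u x : region p x -> exists k, dot u x <= dot u (p k).
Proof.
move=> rx; apply: contrapT => /forallNP n.
have n' k : dot u (p k) < dot u x by rewrite ltNge; apply/negP/n.
have u0 : u != 0.
  by apply/eqP => u0; have := n' ord0; rewrite u0 /dot/= !mul0r ltxx.
apply: (region_escape u0) rx => s s0 /(boundary_dot u)[k].
rewrite dotDr dotZr; have := n' k; have : 0 <= s * dot u u by rewrite mulr_ge0 ?dot_ge0.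
by lra.
Qed.

End Region.

(** * Polar coordinates *)

Section Direction.
Context {R : realType}.
Implicit Types (u v : R * R) (a b t s r : R).

Definition dir t : R * R := (cos t, sin t).

Definition perp u : R * R := (- u.2, u.1).

Lemma cos_eq1 t : - (2 * pi) < t < 2 * pi -> cos t = 1 -> t = 0.
Proof.
move=> /andP[t0 t1] ct; have : sin (t / 2) = 0.
  have := cos_mulr2n (t / 2); rewrite -[_ *+ 2 in LHS]mulr_natr divfK// ct cos2sin2 => h.
  by apply/eqP; rewrite -sqrf_eq0; apply/eqP; lra.
have [tp|tn|->//] := ltgtP 0 t => st.
- have : 0 < sin (t / 2) by apply: sin_gt0_pi; lra.
  by rewrite st ltxx.
- have : 0 < sin (- (t / 2)) by apply: sin_gt0_pi; lra.
  by rewrite sinN st oppr0 ltxx.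
Qed.

Lemma cosM_sign s t : s ^+ 2 = 1 -> cos (s * t) = cos t.
Proof. by move/eqP; rewrite sqrf_eq1 => /orP[] /eqP->; rewrite ?mul1r// mulN1r cosN. Qed.

Lemma sinM_sign s t : s ^+ 2 = 1 -> sin (s * t) = s * sin t.
Proof. by move/eqP; rewrite sqrf_eq1 => /orP[] /eqP->; rewrite ?mul1r// !mulN1r sinN. Qed.

Lemma dir_turn a s t : s ^+ 2 = 1 ->
  dir (a + s * t) = cos t *: dir a + sin t *: (s *: perp (dir a)).
Proof.
move=> s2; apply: plane_eq; rewrite /= /GRing.scale/= ?cosD ?sinD cosM_sign// sinM_sign//; ring.
Qed.

Lemma enorm_dir r t : 0 <= r -> enorm (r *: dir t) = r.
Proof.
move=> r0; rewrite /enorm (_ : dot _ _ = r ^+ 2) ?sqrtr_sqr ?ger0_norm//.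
by rewrite /dot/= /GRing.scale/= -[RHS]mulr1 -(cos2Dsin2 t); ring.
Qed.

Lemma enorm_eq0 u : enorm u = 0 -> u = 0.
Proof.
move=> u0; have : dot u u = 0 by rewrite -sqr_enorm u0 expr0n.
move=> /eqP; rewrite /dot -!expr2 paddr_eq0 ?sqr_ge0// !sqrf_eq0 => /andP[/eqP h1 /eqP h2].
exact: plane_eq.
Qed.

Lemma enorm_gt0 u : (0 < enorm u) = (u != 0).
Proof.
rewrite lt_def enorm_ge0 andbT; apply/idP/idP; apply: contra => /eqP.
  by move=> ->; rewrite /enorm /dot/= !mul0r addr0 sqrtr0.
by move=> /enorm_eq0 ->.
Qed.

Lemma norm_dir r t : 0 <= r -> `|r *: dir t| <= r.
Proof.
move=> r0; rewrite prod_normE ge_max /= /GRing.scale/= !normrM (ger0_norm r0).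
by apply/andP; split; rewrite ler_piMr ?cos_max ?sin_max.
Qed.

Lemma polar u : exists2 t, 0 <= t < 2 * pi & u = enorm u *: dir t.
Proof.
have pi0 := @pi_gt0 R.
have [u0|u0] := eqVneq u 0.
  exists 0; first by rewrite lexx mulr_gt0.
  by rewrite u0 /enorm /dot/= !mul0r addr0 sqrtr0 scale0r.
have n0 : 0 < enorm u by rewrite enorm_gt0.
have n2 : enorm u ^+ 2 = u.1 ^+ 2 + u.2 ^+ 2 by rewrite sqr_enorm /dot; ring.
have cI : -1 <= u.1 / enorm u <= 1.
  by rewrite ler_pdivrMr// ler_pdivlMr//; have := sqr_ge0 u.2; nra.
have c1 : u.1 = enorm u * cos (acos (u.1 / enorm u)).
  by rewrite acosK ?in_itv//= mulrC divfK ?gt_eqF.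
have s1 : `|u.2| = enorm u * sin (acos (u.1 / enorm u)).
  apply/eqP; rewrite -(@eqrXn2 _ 2)//; last first.
      by rewrite mulr_ge0 ?enorm_ge0// sin_ge0_pi// acos_ge0// acos_lepi.
    have c1' : u.1 ^+ 2 = enorm u ^+ 2 * cos (acos (u.1 / enorm u)) ^+ 2.
      by rewrite {1}c1 exprMn.
    by rewrite exprMn sin2cos2 real_normK ?num_real//; lra.
have a0 := acos_ge0 cI; have a1 := acos_lepi cI.
have [v0|v0] := leP 0 u.2.
  exists (acos (u.1 / enorm u)); first by rewrite a0; lra.
  by apply: plane_eq => //=; rewrite -[RHS]/(_ * _) -s1 ger0_norm.
exists (- acos (u.1 / enorm u) + pi *+ 2).
  have : acos (u.1 / enorm u) != 0.
    apply/eqP => h; move: s1; rewrite h sin0 mulr0 => /eqP; rewrite normr_eq0 => /eqP.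
    by move: v0 => /[swap] ->; rewrite ltxx.
  by rewrite -mulr_natr; lra.
apply: plane_eq => /=; rewrite /GRing.scale/= ?cosD2pi ?sinD2pi ?cosN ?sinN//.
by rewrite mulrN -s1 ltr0_norm// opprK.
Qed.

(** The sign [s] is the sense in which angles are measured from the direction [a], so that the left
    and the right of a ray are treated together. *)
Lemma polar_from a s u : s ^+ 2 = 1 ->
  exists2 t, 0 <= t < 2 * pi & u = enorm u *: dir (a + s * t).
Proof.
move=> s2; pose v : R * R := (dot (dir a) u, s * cross (dir a) u).
have [t tI vE] := polar v; exists t => //.
have c2 := cos2Dsin2 a.
have -> : enorm u = enorm v.
  congr Num.sqrt; rewrite /v /dot/= /cross/=.
  rewrite [in RHS](_ : s * _ * (s * _) = s ^+ 2 * (cos a * u.2 - sin a * u.1) ^+ 2); last by ring.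
  rewrite s2 mul1r -[LHS]mul1r -c2; ring.
move: vE => [E1 E2].
rewrite dir_turn// scalerDr !scalerA (_ : _ * cos t = dot (dir a) u); last by rewrite E1.
rewrite (_ : _ * sin t * s = s * cross (dir a) u * s); last by rewrite E2.

have E c : s * c * s = c by rewrite mulrAC -expr2 s2 mul1r.
by apply: plane_eq; rewrite /= /GRing.scale/= /dot /cross/= E -[LHS]mul1r -c2; ring.
Qed.

End Direction.

(** * The two sides of an edge *)

Section Sides.
Context {R : realType}.
Implicit Types (p : pentagon R) (k l : 'I_5) (x u v : R * R) (s y : R).

Lemma dot_perp u : dot (perp u) u = 0.
Proof. by rewrite /dot /perp/=; ring. Qed.

Lemma dot_perp2 u : dot (perp u) (perp u) = dot u u.
Proof. by rewrite /dot /perp/=; ring. Qed.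

Lemma dot_gt0 u : u != 0 -> 0 < dot u u.
Proof. by rewrite -enorm_gt0 -sqr_enorm => h; rewrite exprn_gt0. Qed.

Lemma ordS_neq k : ordS k != k.
Proof. by case: k => [[|[|[|[|[|]]]]]]. Qed.

Lemma ord_pred_neq k : ord_pred k != k.
Proof. by case: k => [[|[|[|[|[|]]]]]]. Qed.

Lemma edge_neq0 p k : simple p -> p (ordS k) - p k != 0.
Proof.
move=> [inj _]; rewrite subr_eq0; apply/eqP => /inj /eqP.
by rewrite (negbTE (ordS_neq k)).
Qed.

Lemma edgeE p k x : edge p k x <->
  exists2 t : R, 0 <= t <= 1 & x = p k + t *: (p (ordS k) - p k).
Proof.
rewrite /edge segmentE; split => [[t /=]|[t tI ->]]; first by rewrite in_itv/= => tI <-; exists t.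
by exists t; rewrite //= in_itv.
Qed.

Lemma other_edges_closed p (P : pred 'I_5) : closed (\bigcup_(l in [set l | P l]) edge p l).
Proof.
apply: closed_bigcup => [|l _]; last exact: closed_segment.
exact: finite_finset.
Qed.

(** A compact part of the open edge has positive distance from the other edges, and a displacement
    along the normal leaves the edge itself. *)
Lemma strip_away p k s1 s2 : simple p -> 0 < s1 -> s1 <= s2 -> s2 < 1 ->
  exists2 e, 0 < e & forall s t, s1 <= s <= s2 -> 0 < `|t| -> `|t| < e ->
   ~ boundary p (p k + s *: (p (ordS k) - p k) + t *: perp (p (ordS k) - p k)).
Proof.
move=> sp s10 s12 s21; set u := p (ordS k) - p k.
have u0 : u != 0 by exact: edge_neq0.
pose K := segment (p k + s1 *: u) (p k + s2 *: u).
pose F := \bigcup_(l in [set l | l != k]) edge p l.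
have inK s : s1 <= s <= s2 -> K (p k + s *: u).
  move=> /andP[h1 h2]; have [s12e|s12n] := eqVneq s1 s2.
    by have -> : s = s1 by [lra]; exact: segment_left.
  have d0 : 0 < s2 - s1 by rewrite subr_gt0 lt_def eq_sym s12n.
  rewrite /K segmentE; exists ((s - s1) / (s2 - s1)).
    by rewrite /= in_itv/= divr_ge0 ?subr_ge0//= ?ler_pdivrMr ?mul1r ?lerD2r// ltW.
  by apply: plane_eq => /=; rewrite /GRing.scale/=; field; rewrite gt_eqF.
have KF : K `&` F = set0.
  apply/seteqP; split => // x [Kx [l /= lk xl]].
  move: Kx; rewrite /K segmentE => -[t /=]; rewrite in_itv/= => /andP[t0 t1] xE.
  have xE' : x = p k + (s1 + t * (s2 - s1)) *: u.
    by rewrite -xE; apply: plane_eq => /=; rewrite /GRing.scale/=; ring.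
  have {xE'} [z zI xE'] : exists2 z, s1 <= z <= s2 & x = p k + z *: u.
    by exists (s1 + t * (s2 - s1)) => //; nra.
  have xk : edge p k x by apply/edgeE; exists z => //; lra.
  rewrite eq_sym in lk; have [[]] := sp.2 _ _ lk _ (conj xk xl).
    rewrite xE' => /eqP; rewrite addrC -subr_eq0 addrK scaler_eq0 (negbTE u0) orbF => /eqP.
    by lra.
  rewrite xE' (_ : p (ordS k) = p k + 1 *: u); last by rewrite scale1r addrC subrK.
  move=> /addrI /eqP; rewrite -subr_eq0 -scalerBl scaler_eq0 (negbTE u0) orbF => /eqP.
  by lra.
have [e e0 H] := compact_closed_away (@compact_segment R _ _) (@other_edges_closed p _) KF.
have n0 : 0 < `|perp u|.
  rewrite normr_gt0; apply: contraNneq u0 => /(congr1 (fun z => dot z z)).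
  rewrite dot_perp2 => h; apply/eqP/enorm_eq0/eqP; rewrite -sqrf_eq0 sqr_enorm h.
  by rewrite /dot/= !mul0r addr0.
exists (e / `|perp u|); first by rewrite divr_gt0.
move=> s t sI t0 te [l _ xl]; have [lk|lk] := eqVneq l k.
  move: xl; rewrite lk => /edgeE[z _]; rewrite -/u -addrA => /addrI.
  move=> /(congr1 (dot (perp u))); rewrite dotDr !dotZr dot_perp dot_perp2 !mulr0 add0r => /eqP.
  by rewrite mulf_eq0 -normr_eq0 (gt_eqF t0) gt_eqF// dot_gt0.
apply: (H (p k + s *: u) _ (inK _ sI)); last by exists l => //=; exact: xl.
by rewrite addrAC subrr add0r normrZ -ltr_pdivlMr.
Qed.

(** As [perp] is the counterclockwise quarter turn, [s = 1] is the left of the edge in its direction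
    of travel and [s = -1] the right. The test is made above the midpoint only; [edge_side_box]
    carries it to the other points of the open edge. *)
Definition side_in s p k := exists2 e, 0 < e & forall t, 0 < t < e ->
  region p (p k + 2^-1 *: (p (ordS k) - p k) + (s * t) *: perp (p (ordS k) - p k)).

Lemma convex_itv (a b y z r : R) : 0 <= r <= 1 -> a <= y <= b -> a <= z <= b ->
  a <= (1 - r) * y + r * z <= b.
Proof. by move=> /andP[? ?] /andP[? ?] /andP[? ?]; apply/andP; split; nra. Qed.

Lemma convex_itv_strict (a b y z r : R) : 0 <= r <= 1 -> a < y < b -> a < z < b ->
  a < (1 - r) * y + r * z < b.
Proof.
move=> /andP[r0 r1] /andP[ay yb] /andP[az zb].
move: r1; rewrite le_eqVlt => /predU1P[->|r1]; first by rewrite subrr mul0r add0r mul1r az zb.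
have q0 : 0 < 1 - r by rewrite subr_gt0.
have := mulr_gt0 q0 (_ : 0 < y - a); have := mulr_gt0 q0 (_ : 0 < b - y).
have : 0 <= r * (z - a) by rewrite mulr_ge0// subr_ge0 ltW.
have : 0 <= r * (b - z) by rewrite mulr_ge0// subr_ge0 ltW.
move=> ? ? /(_ _) H1 /(_ _) H2; apply/andP; split.
  by have := H2 ltac:(lra); lra.
by have := H1 ltac:(lra); lra.
Qed.

Lemma common_lt (e e' : R) : 0 < e -> 0 < e' -> exists2 t, 0 < t < e & 0 < t < e'.
Proof.
by move=> e0 e'0; have [h|h] := leP e e'; [exists (e / 2)|exists (e' / 2)]; lra.
Qed.

(** A thin open box beside the edge misses the boundary and is convex, so all or none of its points
    are in the region. Its base is enlarged to contain the midpoint. *)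
Lemma edge_side_box p k s z0 z1 : simple p -> s ^+ 2 = 1 -> 0 < z0 -> z1 < 1 ->
  exists2 e, 0 < e & forall z t, z0 <= z <= z1 -> 0 < t < e ->
    let x := p k + z *: (p (ordS k) - p k) + (s * t) *: perp (p (ordS k) - p k) in
    ~ boundary p x /\ (region p x <-> side_in s p k).
Proof.
move=> sp s2 z00 z11; set u := p (ordS k) - p k.
have [s1 [s3 [h1 h2 h3 [h4' h4 h5]]]] : exists s1 s3, [/\ 0 < s1, s1 <= s3, s3 < 1 &
    [/\ s1 <= z0, z1 <= s3 & s1 <= 2^-1 <= s3]].
  by clear -z00 z11; have [h|h] := leP z0 2^-1; have [h'|h'] := leP z1 2^-1;
    [exists z0, 2^-1|exists z0, z1|exists 2^-1, 2^-1|exists 2^-1, z1]; split; try lra; split; lra.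
have [e e0 H] := strip_away k sp h1 h2 h3.
pose X y t := p k + y *: u + (s * t) *: perp u.
have s1n : `|s| = 1 by move: s2 => /eqP; rewrite sqrf_eq1 => /orP[] /eqP ->; rewrite ?normrN normr1.
have off y t : s1 <= y <= s3 -> 0 < t < e -> ~ boundary p (X y t).
  move=> yI /andP[t0 t1]; apply: H => //; rewrite normrM s1n mul1r ?normr_gt0 ?gt_eqF//.
  by rewrite gtr0_norm.
have XX y y' t t' : s1 <= y <= s3 -> s1 <= y' <= s3 -> 0 < t < e -> 0 < t' < e ->
    region p (X y t) <-> region p (X y' t').
  move=> yI y'I tI t'I; apply: region_segment => _ [r /= rI <-].
  have -> : (1 - r) *: X y t + r *: X y' t' = X ((1 - r) * y + r * y') ((1 - r) * t + r * t').
    by apply: plane_eq; rewrite /X /= /GRing.scale/=; ring.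
  by apply: off; [exact: convex_itv|exact: convex_itv_strict].
exists e => // z t zI tI x.
have {}zI : s1 <= z <= s3 by clear -zI h4' h4; lra.
split; first exact: off.
split => [rx|[e' e'0 H']].
  by exists e => // t' t'I; apply/(XX z _ t) => //.
have [t' [t'0 t'e t'e']] : exists t', [/\ 0 < t', t' < e & t' < e'].
  by have [t' /andP[h1' h2'] /andP[_ h3']] := common_lt e0 e'0; exists t'.
apply/(XX z 2^-1 t t') => //; first by rewrite t'0.
by apply: H'; rewrite t'0.
Qed.

Lemma edge_side p k s z : simple p -> s ^+ 2 = 1 -> 0 < z < 1 ->
  exists2 e, 0 < e & forall t, 0 < t < e ->
    let x := p k + z *: (p (ordS k) - p k) + (s * t) *: perp (p (ordS k) - p k) in
    ~ boundary p x /\ (region p x <-> side_in s p k).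
Proof.
move=> sp s2 /andP[z0 z1]; have [e e0 H] := edge_side_box k sp s2 z0 z1.
by exists e => // t tI; apply: H; rewrite ?lexx.
Qed.

(* A thin strip along one side of a ray lies in every sector on that side,
   near the endpoint of the ray. *)
Lemma strip_in_sector a s b r d : s ^+ 2 = 1 -> 0 < b -> 0 < r -> 0 < d ->
  exists z e, [/\ 0 < z < 1, 0 < e & forall t, 0 < t < e ->
    exists q g, [/\ 0 < q < d, 0 < g < b, g < pi &
      z *: (r *: dir a) + (s * t) *: perp (r *: dir a) = q *: dir (a + s * g)]].
Proof.
move=> s2 b0 r0 d0; have pi0 := @pi_gt0 R.
pose b' := Num.min b (pi / 2).
have b'0 : 0 < b' by rewrite /b' lt_min b0 divr_gt0.
have b'b : b' <= b by rewrite /b' ge_min lexx.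
have b'pi : b' <= pi / 2 by rewrite /b' ge_min lexx orbT.
have sb : 0 < sin b' by apply: sin_gt0_pi; lra.
pose z := Num.min 2^-1 (d / (2 * r)).
have z0 : 0 < z by rewrite /z lt_min invr_gt0 ltr0n/= divr_gt0// mulr_gt0.
have z1 : z <= 2^-1 by rewrite /z ge_min lexx.
have zd : 2 * z * r <= d.
  have : z <= d / (2 * r) by rewrite /z ge_min lexx orbT.
  by rewrite ler_pdivlMr ?mulr_gt0//; lra.
exists z, (z * sin b'); split; [by apply/andP; split; lra|by rewrite mulr_gt0|].
move=> t /andP[t0 t1].
have [g gI] := @polar_from R a s (z *: (r *: dir a) + (s * t) *: perp (r *: dir a)) s2.
set v := _ + _; set q := enorm v => vE.
have tz : t < z by have := sin_le1 b'; nra.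
have v2 : q ^+ 2 = r ^+ 2 * (z ^+ 2 + t ^+ 2).
  rewrite sqr_enorm /v /dot /perp/= /GRing.scale/=.
  transitivity (r ^+ 2 * (z ^+ 2 + s ^+ 2 * t ^+ 2) * (cos a ^+ 2 + sin a ^+ 2)); first by ring.
  by rewrite s2 cos2Dsin2; ring.
have q0 : 0 < q.
  rewrite lt_def enorm_ge0 andbT -sqrf_eq0 v2 mulf_neq0 ?expf_neq0 ?gt_eqF//.
  by rewrite addr_gt0// exprn_gt0.
have qd : q < d.
  rewrite -ltr_sqr ?nnegrE ?enorm_ge0 ?(ltW d0)// v2.
  have rt : r * t < r * z by rewrite ltr_pM2l.
  have zt : 0 < r * (z + t) by rewrite mulr_gt0// addr_gt0.
  have : (r * (z + t)) ^+ 2 < d ^+ 2 by rewrite ltr_sqr ?nnegrE ?ltW//; lra.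
  have : 0 < r ^+ 2 * (z * t) by rewrite mulr_gt0 ?exprn_gt0// mulr_gt0.
  by lra.
have E1 : q * cos g = r * z /\ q * sin g = r * t.
  move: vE; rewrite dir_turn// => vE.
  have c2 := cos2Dsin2 a.
  have F1 : dot (dir a) v = r * z.
    by rewrite /v /dot /perp/= /GRing.scale/= -[RHS]mulr1 -c2; ring.
  have F2 : dot (s *: perp (dir a)) v = r * t.
    rewrite /v /dot /perp/= /GRing.scale/=.
    by transitivity (s ^+ 2 * (r * t) * (cos a ^+ 2 + sin a ^+ 2)); [ring|rewrite s2 c2; ring].
  rewrite -F1 -F2 vE; split; rewrite /dot /perp/= /GRing.scale/=.
    by rewrite -[LHS]mulr1 -c2; ring.
  transitivity (q * sin g * s ^+ 2 * (cos a ^+ 2 + sin a ^+ 2)); first by rewrite s2 c2 !mulr1.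
  by ring.
move: E1 => [Ec Es].
have cg : 0 < cos g by rewrite -(pmulr_rgt0 _ q0) Ec mulr_gt0.
have sg : 0 < sin g by rewrite -(pmulr_rgt0 _ q0) Es mulr_gt0.
have gpi : 0 < g < pi / 2.
  have g1 : 0 < g.
    rewrite lt_def; move/andP: gI => [-> _]; rewrite andbT; apply/eqP => g0.
    by move: sg; rewrite g0 sin0 ltxx.
  have g2 : g < pi.
    rewrite ltNge; apply/negP => h; have : 0 <= sin (g - pi).
      by apply: sin_ge0_pi; clear -gI h; lra.
    by rewrite -[in g - _](subrK pi g) addrK; have := sinDpi (g - pi); rewrite subrK; clear -sg; lra.
  rewrite g1 ltNge; apply/negP => h; have : 0 <= cos (pi - g).
    by apply: cos_ge0_pihalf; clear -g2 h pi0; lra.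
  by have := cosDpi (- g); rewrite cosN addrC; clear -cg; lra.
exists q, g; split => //; [by rewrite q0| |clear -gpi pi0; lra].
rewrite (andP gpi).1/= ltNge; apply/negP => bg.
have : sin b' <= sin g.
  have : b' <= g by clear -bg b'b; lra.
  rewrite le_eqVlt => /predU1P[->//|h]; apply/ltW.
  by rewrite ltr_sin// in_itv/=; clear -gpi b'0 b'pi; lra.
have : q * sin g < q * sin b'.
  rewrite Es; have : r * z <= q.
    by rewrite -Ec ler_piMr ?cos_le1 ?ltW.
  move=> h; apply: (@lt_le_trans _ _ (r * z * sin b')); first by rewrite -mulrA ltr_pM2l.
  by rewrite ler_pM2r.
by rewrite ltr_pM2l// ltNge => /negP.
Qed.

End Sides.

(** * The region near a vertex *)

Section Vertex.
Context {R : realType}.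
Implicit Types (p : pentagon R) (k l : 'I_5) (x u v : R * R) (a b r t : R).

Lemma continuous_dir : continuous (@dir R).
Proof.
have -> : @dir R = (fun t => cos t *: (1, 0) + sin t *: (0, 1)).
  by apply/funext => t; apply: plane_eq; rewrite /= /GRing.scale/=; ring.
by move=> t; apply: cvgD; apply: cvgZr_tmp; [exact: continuous_cos|exact: continuous_sin].
Qed.

Lemma dot_dir a t t' : dot (dir (a + t)) (dir (a + t')) = cos (t - t').
Proof.
by rewrite (_ : t - t' = (a + t) - (a + t')) ?cosB//; ring.
Qed.

Lemma dir_inj a r r' t t' : 0 < r -> 0 <= r' -> 0 <= t < 2 * pi -> 0 <= t' < 2 * pi ->
  r *: dir (a + t) = r' *: dir (a + t') -> r = r' /\ t = t'.
Proof.
move=> r0 r'0 tI t'I E; have rr : r = r'.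
  by rewrite -(@enorm_dir R r (a + t)) ?ltW// E enorm_dir.
split => //; move: E; rewrite -rr => /(scalerI (lt0r_neq0 r0)) E.
apply/eqP; rewrite -subr_eq0; apply/eqP/cos_eq1; first lra.
by rewrite -(dot_dir a) E dot_dir subrr cos0.
Qed.

Lemma dirD2pi t : dir (t + 2 * pi) = dir t :> R * R.
Proof.
by apply: plane_eq => /=; rewrite [2 * pi]mulrC mulr_natr ?cosD2pi ?sinD2pi.
Qed.

(** Two points of the open sector are joined by an arc of radius [r] followed by a radial segment,
    both off the boundary. *)
Lemma region_sector p x a (d t0 t1 : R) :
  (forall r t, 0 < r < d -> t0 < t < t1 -> ~ boundary p (x + r *: dir (a + t))) ->
  forall r r' t t', 0 < r < d -> 0 < r' < d -> t0 < t < t1 -> t0 < t' < t1 ->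
  region p (x + r *: dir (a + t)) <-> region p (x + r' *: dir (a + t')).
Proof.
move=> off r r' t t' rI r'I tI t'I.
have radial : region p (x + r *: dir (a + t')) <-> region p (x + r' *: dir (a + t')).
  apply: region_segment => _ [z /= zI <-].
  have -> : (1 - z) *: (x + r *: dir (a + t')) + z *: (x + r' *: dir (a + t')) =
    x + ((1 - z) * r + z * r') *: dir (a + t').
    by apply: plane_eq; rewrite /= /GRing.scale/=; ring.
  by apply: off => //; exact: convex_itv_strict.
rewrite -radial.
pose B := (fun y => x + r *: dir (a + y)) @` `[Num.min t t', Num.max t t'].
have cB : connected B.
  apply: connected_continuous_connected; first exact: segment_connected.
  apply: continuous_subspaceT => y; apply: cvgD; first exact: cvg_cst.
  apply: cvgZl_tmp; apply: (@continuous_comp _ _ _ (fun y => a + y) (@dir R)).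
    by apply: cvgD; [exact: cvg_cst|exact: cvg_id].
  exact: continuous_dir.
have nB z : B z -> ~ boundary p z.
  move=> [y /=]; rewrite in_itv/= ge_min le_max => yI <-; apply: off => //.
  by move: yI tI t'I; clear => /andP[/orP[h|h] /orP[h'|h']] /andP[? ?] /andP[? ?]; apply/andP; split; lra.
have Bt : B (x + r *: dir (a + t)).
  by exists t => //=; rewrite in_itv/= ge_min le_max !lexx.
have Bt' : B (x + r *: dir (a + t')).
  by exists t' => //=; rewrite in_itv/= ge_min le_max !lexx !orbT.
by split; apply: region_connected cB nB _ _.
Qed.

Lemma edge_predE p k x : edge p (ord_pred k) x <->
  exists2 t : R, 0 <= t <= 1 & x = p k + t *: (p (ord_pred k) - p k).
Proof.
split => [/edgeE[t tI ->]|[t tI ->]]; [|apply/edgeE]; (exists (1 - t); first lra);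
  by rewrite ord_predK; apply: plane_eq => /=; rewrite /GRing.scale/=; ring.
Qed.

Lemma far_edges p k : simple p -> exists2 d, 0 < d & forall x l, `|x - p k| < d ->
  edge p l x -> l = k \/ l = ord_pred k.
Proof.
move=> sp; pose F := \bigcup_(l in [set l | (l != k) && (l != ord_pred k)]) edge p l.
have KF : [set p k] `&` F = set0.
  apply/seteqP; split => // _ [-> [l /= /andP[lk lpk] xl]].
  have xk : edge p k (p k) by exact: segment_left.
  rewrite eq_sym in lk; have [_ []] := sp.2 _ _ lk _ (conj xk xl).
    by move=> /sp.1 /eqP; rewrite (negbTE lk).
  move=> /sp.1 kl; move: lpk; rewrite kl ordSK eqxx.
  by [].
have [e e0 H] := compact_closed_away (@compact_set1 _ (p k)) (@other_edges_closed R p _) KF.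
exists e => // x l xk xl.
have [->|lk] := eqVneq l k; first by left.
have [->|lpk] := eqVneq l (ord_pred k); first by right.
by exfalso; apply: (H (p k) x erefl xk); exists l => //=; rewrite lk.
Qed.

Lemma corner_arc p k (u := p (ordS k) - p k) (w := p (ord_pred k) - p k) :
  simple p -> exists a b, [/\ 0 <= a < 2 * pi, 0 < b < 2 * pi,
    u = enorm u *: dir a & w = enorm w *: dir (a + b)].
Proof.
move=> sp; have [a aI uE] := polar u.
have [b bI wE] := @polar_from R a 1 w (expr1n _ _); rewrite mul1r in wE.
exists a, b; split => //; move/andP: (bI) => [b0 ->]; rewrite andbT lt_def b0 andbT.
apply/eqP => b00; rewrite b00 addr0 in wE.
have un : 0 < enorm u by rewrite enorm_gt0 edge_neq0.
have w0 : w != 0.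
  rewrite /w subr_eq0; apply/eqP => /sp.1 /eqP; rewrite (negbTE (ord_pred_neq k)).
  by [].
have wn : 0 < enorm w by rewrite enorm_gt0.
(* If both edges left the vertex in one direction, the point at distance [m] would be on both
   without being an endpoint, against simplicity. *)
pose m := Num.min (enorm u) (enorm w) / 2.
have m0 : 0 < m by rewrite divr_gt0// lt_min un.
have mu : m < enorm u by rewrite /m; have : Num.min (enorm u) (enorm w) <= enorm u by [rewrite ge_min lexx]; lra.
have mw : m < enorm w by rewrite /m; have : Num.min (enorm u) (enorm w) <= enorm w by [rewrite ge_min lexx orbT]; lra.
have xk : edge p k (p k + m *: dir a).
  apply/edgeE; exists (m / enorm u); first by rewrite divr_ge0 ?(ltW m0) ?(ltW un)//= ler_pdivrMr// mul1r ltW.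
  by rewrite -/u {2}uE scalerA divfK// gt_eqF.
have xpk : edge p (ord_pred k) (p k + m *: dir a).
  apply/edge_predE; exists (m / enorm w); first by rewrite divr_ge0 ?(ltW m0) ?(ltW wn)//= ler_pdivrMr// mul1r ltW.
  by rewrite -/w {2}wE scalerA divfK// gt_eqF.
have kpk : k != ord_pred k by rewrite eq_sym ord_pred_neq.
have [[]] := sp.2 _ _ kpk _ (conj xk xpk).
  move=> /eqP; rewrite addrC -subr_eq0 addrK => /eqP /(congr1 (@enorm R)).
  rewrite enorm_dir ?ltW// /enorm /dot/= !mul0r addr0 sqrtr0 => h.
  by rewrite h ltxx in m0.
move=> h; have : m *: dir a = u by rewrite /u -h addrAC subrr add0r.
by move=> /(congr1 (@enorm R)); rewrite enorm_dir ?ltW// => h'; rewrite h' ltxx in mu.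
Qed.

Lemma sign1 : (1 : R) ^+ 2 = 1.
Proof. by rewrite expr1n. Qed.

Lemma signN1 : (-1 : R) ^+ 2 = 1.
Proof. by rewrite sqrrN expr1n. Qed.

(* The description of a pentagon near its vertex [k], in polar coordinates
   [a + t], with [b] the counterclockwise angle from the next edge to the
   previous one. *)
Definition local_frame p k (a b d : R) : Prop :=
  [/\ 0 < d, 0 < b < 2 * pi,
    p (ordS k) - p k = enorm (p (ordS k) - p k) *: dir a &
    p (ord_pred k) - p k = enorm (p (ord_pred k) - p k) *: dir (a + b)] /\
  [/\ forall r t, 0 < r < d -> 0 <= t < 2 * pi ->
      boundary p (p k + r *: dir (a + t)) <-> t = 0 \/ t = b,
    forall r t, 0 < r < d -> 0 < t < b ->
      region p (p k + r *: dir (a + t)) <-> side_in 1 p k,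
    forall r t, 0 < r < d -> b < t < 2 * pi ->
      region p (p k + r *: dir (a + t)) <-> side_in (-1) p k,
    side_in 1 p k <-> side_in 1 p (ord_pred k) &
    side_in (-1) p k <-> side_in (-1) p (ord_pred k)].

(** Each of the two open sectors contains thin strips beside both edges at the vertex. Comparing
    them shows that the left of the next edge is inside exactly when the left of the previous edge
    is, and the same for the right; this is what carries the side around the pentagon. *)
Lemma vertex_local p k : simple p -> exists a b d, 0 <= a < 2 * pi /\ local_frame p k a b d.
Proof.
move=> sp; have pi0 := @pi_gt0 R.
have [a [b [aI bI uE wE]]] := corner_arc k sp.
move: uE wE; set u := p (ordS k) - p k; set w := p (ord_pred k) - p k => uE wE.
have [d' d'0 far] := far_edges k sp.
have un : 0 < enorm u by rewrite enorm_gt0 edge_neq0.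
have wn : 0 < enorm w.
  rewrite enorm_gt0 subr_eq0; apply/eqP => /sp.1 /eqP.
  by rewrite (negbTE (ord_pred_neq k)).
pose d := Num.min d' (Num.min (enorm u) (enorm w)).
have d0 : 0 < d by rewrite !lt_min d'0 un.
have dd' : d <= d' by rewrite /d ge_min lexx.
have du : d <= enorm u by rewrite /d !ge_min lexx orbT.
have dw : d <= enorm w by rewrite /d !ge_min lexx !orbT.
pose X r t := p k + r *: dir (a + t).
have bd r t : 0 < r < d -> 0 <= t < 2 * pi -> boundary p (X r t) <-> t = 0 \/ t = b.
  move=> /andP[r0 rd] tI; split.
    move=> [l _ xl]; have [] := far (X r t) l _ xl.
    - by rewrite /X addrAC subrr add0r (le_lt_trans (norm_dir _ (ltW r0)))//; lra.
    - move=> lk; left; move: xl; rewrite lk => /edgeE[z /andP[z0 z1]].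
      rewrite /X -/u => /addrI; rewrite {1}uE scalerA -[in X in _ = X](addr0 a) => E.
      by have [] := dir_inj r0 _ tI _ E; rewrite ?mulr_ge0 ?enorm_ge0 ?lexx ?mulr_gt0.
    - move=> lk; right; move: xl; rewrite lk => /edge_predE[z /andP[z0 z1]].
      rewrite /X -/w => /addrI; rewrite {1}wE scalerA => E.
      by have [] := dir_inj r0 _ tI _ E; rewrite ?mulr_ge0 ?enorm_ge0//; lra.
  move=> [->|->].
    exists k => //; apply/edgeE; exists (r / enorm u).
      by rewrite divr_ge0 ?(ltW r0) ?(ltW un)//= ler_pdivrMr// mul1r; lra.
    by rewrite /X addr0 -/u {2}uE scalerA divfK// gt_eqF.
  exists (ord_pred k) => //; apply/edge_predE; exists (r / enorm w).
    by rewrite divr_ge0 ?(ltW r0) ?(ltW wn)//= ler_pdivrMr// mul1r; lra.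
  by rewrite /X -/w {2}wE scalerA divfK// gt_eqF.
have [b0 b1] := andP bI.
have in1 := @region_sector p (p k) a d 0 b.
have in2 := @region_sector p (p k) a d b (2 * pi).
have {}in1 := in1 _; have {}in2 := in2 _.
have off1 r t : 0 < r < d -> 0 < t < b -> ~ boundary p (X r t).
  move=> rI tI /(bd _ _ rI _)[|t0|tb]; [clear -tI b1; lra| |]; by move: tI; rewrite ?t0 ?tb ltxx ?andbF.
have off2 r t : 0 < r < d -> b < t < 2 * pi -> ~ boundary p (X r t).
  move=> rI tI /(bd _ _ rI _)[|t0|tb]; [clear -tI b0; lra| |]; move: tI; rewrite ?t0 ?tb ?ltxx//.
  by move=> /andP[]; clear -b0; lra.
have {}in1 := in1 off1; have {}in2 := in2 off2.
have bI' : 0 < 2 * pi - b by lra.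
have next1 r t : 0 < r < d -> 0 < t < b -> region p (X r t) <-> side_in 1 p k.
  move=> rI tI.
  have [z [e [zI e0 H]]] := strip_in_sector a sign1 b0 un d0.
  have [e' e'0 H'] := edge_side k sp sign1 zI.
  have [y y1 y2] := common_lt e0 e'0.
  have [q [g [qI gI _ E]]] := H _ y1.
  have [_ <-] := H' _ y2; rewrite -/u {1 2}uE -addrA E mul1r.
  exact: in1.
have next2 r t : 0 < r < d -> b < t < 2 * pi -> region p (X r t) <-> side_in (-1) p k.
  move=> rI tI.
  have [z [e [zI e0 H]]] := strip_in_sector a signN1 bI' un d0.
  have [e' e'0 H'] := edge_side k sp signN1 zI.
  have [y y1 y2] := common_lt e0 e'0.
  have [q [g [qI gI _ E]]] := H _ y1.
  have [_ <-] := H' _ y2; rewrite -/u {1 2}uE -addrA E mulN1r.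
  rewrite -(dirD2pi (a - g)) (_ : a - g + 2 * pi = a + (2 * pi - g)); last by ring.
  by apply: in2 => //; clear -gI; lra.
(* The previous edge is travelled towards the vertex: seen from there, its parameter [z] becomes
   [1 - z] and left and right are exchanged. *)
have predE s z y : p (ord_pred k) + (1 - z) *: (p k - p (ord_pred k)) + (s * y) *: perp (p k - p (ord_pred k)) =
    p k + (z *: w + (- s * y) *: perp w).
  by apply: plane_eq; rewrite /w /= /GRing.scale/=; ring.
have prev1 r t : 0 < r < d -> 0 < t < b -> region p (X r t) <-> side_in 1 p (ord_pred k).
  move=> rI tI.
  have [z [e [zI e0 H]]] := strip_in_sector (a + b) signN1 b0 wn d0.
  have zI' : 0 < 1 - z < 1 by clear -zI; lra.
  have [e' e'0 H'] := edge_side (ord_pred k) sp sign1 zI'.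
  have [y y1 y2] := common_lt e0 e'0.
  have [q [g [qI gI _ E]]] := H _ y1.
  have [_] := H' _ y2; rewrite ord_predK predE => <-.
  rewrite {1 2}wE E mulN1r -addrA.
  by apply: in1 => //; clear -gI; lra.
have prev2 r t : 0 < r < d -> b < t < 2 * pi -> region p (X r t) <-> side_in (-1) p (ord_pred k).
  move=> rI tI.
  have [z [e [zI e0 H]]] := strip_in_sector (a + b) sign1 bI' wn d0.
  have zI' : 0 < 1 - z < 1 by clear -zI; lra.
  have [e' e'0 H'] := edge_side (ord_pred k) sp signN1 zI'.
  have [y y1 y2] := common_lt e0 e'0.
  have [q [g [qI gI _ E]]] := H _ y1.
  have [_] := H' _ y2; rewrite ord_predK predE opprK => <-.
  rewrite {1 2}wE E mul1r -addrA.
  by apply: in2 => //; clear -gI; lra.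
have dI : 0 < d / 2 < d by clear -d0; lra.
exists a, b, d; split => //; split => //; split => //.
- have h : 0 < b / 2 < b by clear -b0; lra.
  by rewrite -(next1 _ _ dI h) -(prev1 _ _ dI h).
- have h : b < (b + 2 * pi) / 2 < 2 * pi by clear -b1; lra.
  by rewrite -(next2 _ _ dI h) -(prev2 _ _ dI h).
Qed.

End Vertex.

(** * Orientation: which side of the boundary is inside *)

Section Orientation.
Context {R : realType}.
Implicit Types (p : pentagon R) (k l : 'I_5) (x u v : R * R) (a b r t s : R).

Lemma cyclic_invariant (P : 'I_5 -> Prop) :
  (forall k, P k <-> P (ord_pred k)) -> forall k l, P k <-> P l.
Proof.
move=> H; suff h k : P k <-> P ord0 by move=> k l; rewrite (h k) (h l).
have e (i j : 'I_5) : ord_pred i = j :> nat -> P i <-> P j.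
  by move=> /val_inj <-; exact: H.
have h1 : P (@Ordinal 5 1 isT) <-> P ord0 by apply: e.
have h2 : P (@Ordinal 5 2 isT) <-> P ord0 by rewrite -h1; apply: e.
have h3 : P (@Ordinal 5 3 isT) <-> P ord0 by rewrite -h2; apply: e.
have h4 : P (@Ordinal 5 4 isT) <-> P ord0 by rewrite -h3; apply: e.
case: k => [[|[|[|[|[|m]]]]] km] //.
- by rewrite (_ : Ordinal km = ord0)//; exact: val_inj.
- by rewrite (_ : Ordinal km = @Ordinal 5 1 isT)//; exact: val_inj.
- by rewrite (_ : Ordinal km = @Ordinal 5 2 isT)//; exact: val_inj.
- by rewrite (_ : Ordinal km = @Ordinal 5 3 isT)//; exact: val_inj.
- by rewrite (_ : Ordinal km = @Ordinal 5 4 isT)//; exact: val_inj.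
Qed.

Lemma side_in_all p s k l : simple p -> s = 1 \/ s = -1 ->
  side_in s p k <-> side_in s p l.
Proof.
move=> sp s1; apply: (@cyclic_invariant (side_in s p)) => {}k.
have [a [b [d [_ [_ [_ _ _ h h']]]]]] := vertex_local k sp.
by case: s1 => ->.
Qed.

Lemma area_triangles (I : finType) (f g h : I -> R * R) (A : set (R * R)) :
  (forall x, A x -> exists i, triangle (f i) (g i) (h i) x) ->
  (area A <= (\sum_i `|cross (g i - f i) (h i - f i)| / 2)%:E)%E.
Proof.
move=> cover.
have [B HB] := choice (fun i => triangle_cover (f i) (g i) (h i)).
pose U (s : seq I) := \big[setU/set0]_(i <- s) B i.
have mU (s : seq I) : measurable (U s).
  by apply: bigsetU_measurable => i _; case: (HB i).
have aU (s : seq I) : (area (U s) <= (\sum_(i <- s) `|cross (g i - f i) (h i - f i)| / 2)%:E)%E.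
  rewrite /U; elim: s => [|i s IH]; first by rewrite !big_nil /area measure0.
  rewrite !big_cons EFinD; apply: le_trans (measureU2 _ _ _) _.
  - by case: (HB i).
  - exact: mU.
  - by rewrite leeD//; case: (HB i).
apply: le_trans (aU (index_enum I)); apply: le_area => x /cover[i xi].
rewrite /U -bigcup_seq; exists i => /=; first exact: mem_index_enum.
by case: (HB i) => _ + _; apply.
Qed.

Lemma area_region_fan p o :
  (area (region p) <= (\sum_k `|cross (p k - o) (p (ordS k) - o)| / 2)%:E)%E.
Proof.
by apply: (area_triangles (f := fun=> o)) => x; exact: region_fan.
Qed.

(** An edge is covered by a degenerate triangle. *)
Lemma area_boundary p : (area (boundary p) <= 0)%E.
Proof.
apply: le_trans (@area_triangles _ p (fun k => p (ordS k)) p _ _) _.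
  move=> x [k _ /edgeE[t /andP[t0 t1] ->]]; exists k, t, 0; split => //; first lra.
  by rewrite scale0r addr0.
rewrite lee_fin big1// => k _.
by rewrite subrr /cross/= !mulr0 subrr normr0 mul0r.
Qed.

Lemma unit_area_interior p : area (region p) = 1%:E ->
  exists2 x, region p x & ~ boundary p x.
Proof.
move=> ap; apply: contrapT => h.
have : (area (region p) <= area (boundary p))%E.
  apply: le_area => x rx; apply: contrapT => bx; apply: h.
  by exists x.
move=> /le_trans /(_ (area_boundary p)); rewrite ap lee_fin.
by rewrite ler10.
Qed.

Lemma first_hit p x v : ~ boundary p x -> boundary p (x + v) ->
  exists2 z, 0 < z <= 1 & boundary p (x + z *: v) /\
    forall t, 0 <= t < z -> ~ boundary p (x + t *: v).
Proof.
move=> nx bv; pose T := `[0, 1] `&` ((fun t => x + t *: v) @^-1` boundary p).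
have cT : compact T.
  apply: compact_closedI; first exact: segment_compact.
  apply: closed_comp => [t _|]; last exact: closed_boundary.
  exact: continuous_affine_plane.
have T0 : T !=set0.
  by exists 1; split; [rewrite /= in_itv/= ler01 lexx|rewrite /preimage/= scale1r].
have [|z] := @compact_EVT_min _ R id T T0 cT.
  by apply: continuous_subspaceT => t; exact: cvg_id.
rewrite inE => -[/= zI bz] zmin; rewrite in_itv/= in zI.
exists z.
  have [z0 ->] := andP zI; rewrite andbT lt_def z0 andbT; apply/eqP => z00.
  by move: bz; rewrite z00 scale0r addr0.
split => // t /andP[t0 tz] bt; have : z <= t.
  by apply: zmin; rewrite inE; split => //=; rewrite in_itv/= t0; lra.
by rewrite leNgt tz.
Qed.

(** Walk from [x] straight towards a vertex. Up to the first hit the walk stays in the region, and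
    just before it is in a sector of a vertex or beside an edge, hence on a definite side. *)
Lemma side_exists p x k : simple p -> region p x -> ~ boundary p x ->
  side_in 1 p k \/ side_in (-1) p k.
Proof.
move=> sp rx nx; pose v := p ord0 - x.
have [|z zI [bz H]] := @first_hit p x v nx.
  by rewrite addrC subrK; exists ord0 => //; exact: segment_left.
have rH t : 0 <= t < z -> region p (x + t *: v).
  move=> tI; apply: (proj1 (region_segment _) rx) => _ [y /= yI <-].
  rewrite (_ : (1 - y) *: x + y *: (x + t *: v) = x + (y * t) *: v); last first.
    by apply: plane_eq; rewrite /= /GRing.scale/=; ring.
  by apply: H; nra.
have all1 j := @side_in_all p 1 j k sp (or_introl erefl).
have all2 j := @side_in_all p (-1) j k sp (or_intror erefl).
suff [j] : exists j, side_in 1 p j \/ side_in (-1) p j by rewrite all1 all2.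
have [z0 z1] := andP zI.
have vertex j : x + z *: v = p j -> side_in 1 p j \/ side_in (-1) p j.
  move=> E; have [a [b [d [_ [[d0 bI _ _] [bd i1 i2 _ _]]]]]] := vertex_local j sp.
  have v0 : v != 0.
    apply/eqP => v0; apply: nx; move: bz; rewrite v0 scaler0 addr0.
    by [].
  have vn : 0 < enorm v by rewrite enorm_gt0.
  have [t tI vE] := @polar_from R a 1 (- v) sign1; rewrite mul1r enormN in vE.
  pose h := Num.min (z / 2) (d / 2 / enorm v).
  have h0 : 0 < h by rewrite lt_min !divr_gt0.
  have hz : h < z by rewrite /h; have : Num.min (z / 2) (d / 2 / enorm v) <= z / 2 by [rewrite ge_min lexx]; lra.
  have hd : 0 < h * enorm v < d.
    rewrite mulr_gt0//=; have : h <= d / 2 / enorm v by rewrite /h ge_min lexx orbT.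
    by rewrite ler_pdivlMr//; lra.
  have XE : x + (z - h) *: v = p j + (h * enorm v) *: dir (a + t).
    by rewrite -E -scalerA -vE; apply: plane_eq; rewrite /= /GRing.scale/=; ring.
  have zh : 0 <= z - h < z by lra.
  have := H _ zh; have := rH _ zh; rewrite XE => rX nX.
  have tt : t <> 0 /\ t <> b by split=> e; apply: nX; apply/(bd _ _ hd tI); rewrite e; [left|right].
  have [tb|bt|tb] := ltgtP t b; last by case: tt.2.
    left; apply/(i1 _ t hd) => //; rewrite tb andbT lt_def; move/andP: tI => [-> _].
    by rewrite andbT; apply/eqP; exact: tt.1.
  by right; apply/(i2 _ t hd) => //; clear -bt tI; lra.
have [j _ /edgeE[y yI E]] := bz.
have [y0|y0] := eqVneq y 0.
  by exists j; apply: vertex; rewrite E y0 scale0r addr0.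
have [y1|y1] := eqVneq y 1.
  by exists (ordS j); apply: vertex; rewrite E y1 scale1r addrC subrK.
have {y0 y1} [y0 y1] : 0 < y /\ y < 1.
  by move/andP: yI => [h h']; rewrite !lt_def h h' y0 eq_sym y1.
move: E; set u := p (ordS j) - p j => E.
have u0 : u != 0 by exact: edge_neq0.
have uu : 0 < dot u u by exact: dot_gt0.
(* The components of the walk along the edge and across it; the edge is approached from the side
   given by the sign of [- ga]. *)
pose al := dot u v / dot u u; pose ga := dot (perp u) v / dot u u.
have vE : v = al *: u + ga *: perp u.
  have uu' : u.1 * u.1 + u.2 * u.2 != 0 by rewrite -[_ + _]/(dot u u) gt_eqF.
  by apply: plane_eq; rewrite /al /ga /dot /perp /= /GRing.scale/=; field.
have XE h : x + (z - h) *: v = p j + (y - h * al) *: u + (- ga * h) *: perp u.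
  rewrite scalerBl addrA E [in h *: v]vE.
  by apply: plane_eq; rewrite /= /GRing.scale/=; ring.
have [h1 h10 hal] : exists2 h1, 0 < h1 & forall h, 0 < h < h1 -> y / 2 <= y - h * al <= (1 + y) / 2.
  pose m := Num.min (y / 2) ((1 - y) / 2).
  have m0 : 0 < m by rewrite lt_min !divr_gt0// subr_gt0.
  have my : m <= y / 2 by rewrite /m ge_min lexx.
  have my' : m <= (1 - y) / 2 by rewrite /m ge_min lexx orbT.
  exists (m / (`|al| + 1)); first by rewrite divr_gt0// ltr_wpDl.
  move=> h /andP[h0]; rewrite ltr_pdivlMr ?ltr_wpDl// => hm.
  have : `|h * al| <= m by rewrite normrM gtr0_norm//; lra.
  by rewrite ler_norml; lra.
(* A walk parallel to the edge would have been on it already before the first hit. *)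
exists j; have [ga0|ga0] := eqVneq ga 0.
  pose h := Num.min h1 z / 2.
  have m0 : 0 < Num.min h1 z by rewrite lt_min h10.
  have hh : 0 < h < h1 by have : Num.min h1 z <= h1 by [rewrite ge_min lexx]; rewrite /h; lra.
  have hz : 0 < h < z by have : Num.min h1 z <= z by [rewrite ge_min lexx orbT]; rewrite /h; lra.
  exfalso; apply: (H (z - h)); first lra.
  rewrite XE ga0 oppr0 mul0r scale0r addr0; exists j => //; apply/edgeE.
  by exists (y - h * al) => //; have := hal _ hh; clear -y0 y1; lra.
have [s [s1 s2 sga]] : exists s, [/\ s = 1 \/ s = -1, s ^+ 2 = 1 & 0 < s * - ga].
  have [gp|gn|g0] := ltgtP ga 0; last by rewrite g0 eqxx in ga0.
    by exists 1; split; [left|exact: sign1|clear -gp; lra].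
  by exists (-1); split; [right|exact: signN1|clear -gn; lra].
have y20 : 0 < y / 2 by lra.
have y21 : (1 + y) / 2 < 1 by lra.
have [e e0 box] := edge_side_box j sp s2 y20 y21.
pose m := Num.min (Num.min h1 z) (e / (s * - ga)).
have m0 : 0 < m by rewrite !lt_min h10 z0 divr_gt0.
have mh : m <= h1 by rewrite /m !ge_min lexx.
have mz : m <= z by rewrite /m !ge_min lexx orbT.
have me : m * (s * - ga) <= e by rewrite -ler_pdivlMr// /m !ge_min lexx orbT.
have hh : 0 < m / 2 < h1 by clear -m0 mh; lra.
have t1 : 0 < m / 2 * (s * - ga) < e by rewrite mulr_gt0 ?divr_gt0//=; clear -me e0; lra.
have [_ hs] := box _ _ (hal _ hh) t1.
have : region p (x + (z - m / 2) *: v) by apply: rH; clear -m0 mz; lra.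
rewrite XE (_ : - ga * (m / 2) = s * (m / 2 * (s * - ga))); last first.
  rewrite (_ : s * (m / 2 * (s * - ga)) = s ^+ 2 * (m / 2) * - ga); last by ring.
  by rewrite s2 mul1r mulrC.
by move=> /hs; case: s1 => -> ; [left|right].
Qed.

(** From a vertex of largest abscissa the horizontal ray to the right leaves the region, so it runs
    in one of the two open sectors there, and the corresponding side is outside. *)
Lemma side_not_both p k : simple p -> ~ (side_in 1 p k /\ side_in (-1) p k).
Proof.
move=> sp [i1 i2]; pose j := [arg max_(i > (ord0 : 'I_5)) (p i).1]%O.
have jmax i : (p i).1 <= (p j).1 by rewrite /j; case: arg_maxP => //= i0 _; exact.
have [a [b [d [_ [[d0 bI _ _] [bd h1 h2 _ _]]]]]] := vertex_local j sp.
have {}i1 : side_in 1 p j by apply/(side_in_all k j sp (or_introl erefl)).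
have {}i2 : side_in (-1) p j by apply/(side_in_all k j sp (or_intror erefl)).
have [t tI E] := @polar_from R a 1 ((1, 0) : R * R) sign1.
have en : enorm ((1, 0) : R * R) = 1.
  by rewrite /enorm /dot/= mulr1 mulr0 addr0 sqrtr1.
rewrite en scale1r mul1r in E.
have dI : 0 < d / 2 < d by lra.
have nr : ~ region p (p j + (d / 2) *: dir (a + t)).
  move=> /(region_dot (1, 0))[l]; rewrite -E /dot/= /GRing.scale/=.
  by rewrite !mul1r !mul0r mulr1 !addr0; have := jmax l; lra.
have [tb|bt|tb] := ltgtP t b.
- have [t0|t0] := eqVneq t 0.
    by apply: nr; left; apply/(bd _ _ dI tI); left.
  apply/nr/(h1 _ t dI) => //; rewrite tb andbT lt_def t0.
  by case/andP: tI.
- by apply/nr/(h2 _ t dI) => //; lra.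
- by apply: nr; left; apply/(bd _ _ dI tI); right.
Qed.

(** The substitute for the Jordan curve theorem. The area provides a point of the region off the
    boundary, from which [side_exists] starts. *)
Lemma orientation p : simple p -> area (region p) = 1%:E ->
  exists2 s, s = 1 \/ s = -1 & forall k, side_in s p k /\ ~ side_in (- s) p k.
Proof.
move=> sp /unit_area_interior[x rx nx].
have [h|h] := side_exists ord0 sp rx nx.
- exists 1; [by left|move=> k].
  have hk := proj2 (side_in_all k ord0 sp (or_introl erefl)) h.
  by split=> // h'; apply: (side_not_both sp (conj hk h')).
- exists (-1); [by right|move=> k]; rewrite opprK.
  have hk := proj2 (side_in_all k ord0 sp (or_intror erefl)) h.
  by split=> // h'; apply: (side_not_both sp (conj h' hk)).
Qed.

End Orientation.

(** * Interior angles *)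

Section Angle.
Context {R : realType}.
Implicit Types (p : pentagon R) (k l : 'I_5) (x u v : R * R) (a b d r t s : R).

Lemma cross_dir a b : cross (dir a) (dir b) = sin (b - a).
Proof. by rewrite /cross /= sinB; ring. Qed.

Lemma crossZ r r' u v : cross (r *: u) (r' *: v) = r * r' * cross u v.
Proof. by rewrite /cross/= /GRing.scale/=; ring. Qed.

Lemma sin_pos_itv t : - pi < t < 2 * pi -> 0 < sin t -> 0 < t < pi.
Proof.
move=> /andP[t0 t1] st; have pi0 := @pi_gt0 R.
have tp : 0 < t.
  rewrite ltNge; apply/negP => h; have : 0 <= sin (- t) by apply: sin_ge0_pi; lra.
  by rewrite sinN; lra.
rewrite tp ltNge; apply/negP => h; have : 0 <= sin (t - pi) by apply: sin_ge0_pi; lra.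
by have := sinDpi (t - pi); rewrite subrK; lra.
Qed.

Lemma edge_prev_neq0 p k : simple p -> p (ord_pred k) - p k != 0.
Proof.
move=> sp; rewrite subr_eq0; apply/eqP => /sp.1 /eqP.
by rewrite (negbTE (ord_pred_neq k)).
Qed.

Lemma corner_frame p k a b d : simple p -> local_frame p k a b d ->
  corner p k = if b <= pi then b else 2 * pi - b.
Proof.
move=> sp [[d0 /andP[b0 b1] uE wE] _]; have pi0 := @pi_gt0 R.
have := edge_neq0 k sp; have := edge_prev_neq0 k sp; rewrite -!enorm_gt0.
rewrite /corner; move: uE wE; set u := p (ordS k) - p k; set w := p (ord_pred k) - p k.
move=> uE wE wn un.
have -> : dot u w / (enorm u * enorm w) = cos b.
  rewrite {1}uE {1}wE (_ : dot _ _ = enorm u * enorm w * dot (dir a) (dir (a + b))).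
    have := dot_dir a 0 b; rewrite addr0 => ->; rewrite sub0r cosN.
    by field; rewrite !gt_eqF.
  by rewrite /dot/= /GRing.scale/=; ring.
have [bpi|bpi] := leP b pi; first by rewrite cosK// in_itv/= (ltW b0).
have -> : cos b = cos (2 * pi - b).
  by rewrite (_ : 2 * pi - b = - b + pi *+ 2) ?cosD2pi ?cosN// -mulr_natr; ring.
by rewrite cosK// in_itv/=; lra.
Qed.

Lemma near_0_right (P : R -> Prop) (d : R) (Q : Prop) : 0 < d ->
  (forall e, 0 < e < d -> P e <-> Q) -> (\forall e \near 0^'+, P e) <-> Q.
Proof.
move=> d0 PQ; split=> [[e /= e0 H]|q].
  have m0 : 0 < Num.min e d by rewrite lt_min e0.
  have me : Num.min e d <= e by rewrite ge_min lexx.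
  have md : Num.min e d <= d by rewrite ge_min lexx orbT.
  apply/(PQ (Num.min e d / 2)); first lra.
  by apply: H; rewrite /= ?sub0r ?normrN ?gtr0_norm ?divr_gt0//; lra.
exists d => // e /=; rewrite sub0r normrN => ed e0.
by apply/(PQ e) => //; rewrite e0 (le_lt_trans (ler_norm _)).
Qed.

(** The ray tested by [corner_inside] has direction [u + w]. The signs of the sines of its angles
    with the two edges, read off from cross products, place it in the convex one of the two
    sectors. *)
Lemma corner_inside_frame p k a b d : simple p -> local_frame p k a b d ->
  (b < pi -> corner_inside p k <-> side_in 1 p k) /\
  (pi < b -> corner_inside p k <-> side_in (-1) p k).
Proof.
move=> sp [[d0 /andP[b0 b1] uE wE] [bd i1 i2 _ _]]; have pi0 := @pi_gt0 R.
have := edge_neq0 k sp; have := edge_prev_neq0 k sp; rewrite -!enorm_gt0.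
rewrite /corner_inside; move: uE wE; set u := p (ordS k) - p k; set w := p (ord_pred k) - p k.
move=> uE wE wn un.
have [t tI vE] := @polar_from R a 1 (u + w) sign1; rewrite mul1r in vE.
set q := enorm (u + w) in vE.
have E1 : q * sin t = enorm w * sin b.
  transitivity (cross (dir a) (u + w)).
    by rewrite vE -[dir a]scale1r crossZ cross_dir mul1r addrAC subrr add0r.
  rewrite {1}uE {1}wE (_ : cross _ _ = enorm w * cross (dir a) (dir (a + b))).
    by rewrite cross_dir addrAC subrr add0r.
  by rewrite /cross/= /GRing.scale/=; ring.
have E2 : q * sin (b - t) = enorm u * sin b.
  transitivity (cross (u + w) (dir (a + b))).
    rewrite vE -[X in cross _ X]scale1r crossZ cross_dir mulr1.
    by congr (_ * sin _); ring.
  rewrite {1}uE {1}wE (_ : cross _ _ = enorm u * cross (dir a) (dir (a + b))).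
    by rewrite cross_dir addrAC subrr add0r.
  by rewrite /cross/= /GRing.scale/=; ring.
have q0 : 0 <= q by exact: enorm_ge0.
have XE e : p k + e *: (u + w) = p k + (e * q) *: dir (a + t) by rewrite {1}vE scalerA.
have bt : sin b != 0 -> 0 < q.
  move=> sb; rewrite lt_def q0 andbT; apply/eqP => q00; move: E1; rewrite q00 mul0r => /esym/eqP.
  by rewrite mulf_eq0 (negbTE sb) gt_eqF.
have near0 (Q : Prop) : 0 < q -> (forall r, 0 < r < d -> region p (p k + r *: dir (a + t)) <-> Q) ->
    (\forall e \near 0^'+, region p (p k + e *: (u + w))) <-> Q.
  move=> qp H; apply: (@near_0_right _ (d / q)); first exact: divr_gt0.
  move=> e /andP[e0 ed]; rewrite XE; apply: H.
  by rewrite mulr_gt0//= -ltr_pdivlMr.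
split=> bpi.
  have sb : 0 < sin b by apply: sin_gt0_pi; lra.
  have qp := bt (lt0r_neq0 sb).
  have st : 0 < sin t by rewrite -(pmulr_rgt0 _ qp) E1 mulr_gt0.
  have sbt : 0 < sin (b - t) by rewrite -(pmulr_rgt0 _ qp) E2 mulr_gt0.
  have tI' : 0 < t < pi by apply: sin_pos_itv => //; lra.
  have btI : 0 < b - t < pi by apply: sin_pos_itv => //; clear -tI b0 b1 bpi tI'; lra.
  by apply: near0 => // r rI; apply: i1 => //; clear -tI' btI; lra.
have sb : sin b < 0.
  have : 0 < sin (b - pi) by apply: sin_gt0_pi; lra.
  by have := sinDpi (b - pi); rewrite subrK; lra.
have qp := bt (ltr0_neq0 sb).
have st : 0 < sin (- t) by rewrite sinN oppr_gt0 -(pmulr_rlt0 _ qp) E1 pmulr_rlt0.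
have sbt : 0 < sin (t - b) by rewrite -opprB sinN oppr_gt0 -(pmulr_rlt0 _ qp) E2 pmulr_rlt0.
have tn : 0 < t.
  rewrite lt_def (andP tI).1 andbT; apply/eqP => t0.
  by move: st; rewrite t0 oppr0 sin0 ltxx.
have tI' : 0 < - t + 2 * pi < pi.
  apply: sin_pos_itv; first by clear -tI tn; lra.
  by rewrite [2 * pi]mulrC mulr_natr sinD2pi.
have btI : 0 < t - b < pi by apply: sin_pos_itv => //; clear -tI b0 b1 tI' bpi; lra.
by apply: near0 => // r rI; apply: i2 => //; clear -tI btI; lra.
Qed.

Lemma angle_frame p k a b d : simple p -> local_frame p k a b d ->
  (side_in 1 p k /\ ~ side_in (-1) p k -> angle p k = b) /\
  (side_in (-1) p k /\ ~ side_in 1 p k -> angle p k = 2 * pi - b).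
Proof.
move=> sp fr; have := corner_frame sp fr.
have [in1 in2] := corner_inside_frame sp fr.
rewrite /angle; have [bpi|bpi|bpi] := ltgtP b pi => cE.
- rewrite cE; split=> -[h nh]; case: asboolP => // /(in1 bpi) //.
- rewrite cE; split=> -[h nh]; case: asboolP => [/(in2 bpi)//|].
    by move=> _; ring.
  by move=> /(in2 bpi).
(* At a straight angle the test ray says nothing, but both branches of [angle] give [pi]. *)
- by rewrite cE bpi; split => _; case: ifP => _ //; ring.
Qed.

Lemma dir_shift (b c t : R) : dir b = dir c -> dir (b + t) = dir (c + t) :> R * R.
Proof. by move=> [h1 h2]; apply: plane_eq; rewrite /= (cosD, sinD) (cosD, sinD) h1 h2. Qed.

(** The origin [a] of the angles is chosen so that the sector of the region is always
    [[0, angle p k]] counterclockwise: it is the direction of the next edge for a counterclockwise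
    pentagon and of the previous edge for a clockwise one. *)
Lemma germ p k : simple p -> area (region p) = 1%:E ->
  exists a d, [/\ 0 <= a < 2 * pi, 0 < d, 0 < angle p k < 2 * pi,
    forall r t, 0 < r < d -> 0 <= t < 2 * pi ->
      region p (p k + r *: dir (a + t)) <-> t <= angle p k &
    forall r t, 0 < r < d -> 0 < t < angle p k -> ~ boundary p (p k + r *: dir (a + t))].
Proof.
move=> sp ap; have [s s1 ori] := orientation sp ap; have pi0 := @pi_gt0 R; clear ap.
have [a [b [d [aI fr]]]] := vertex_local k sp.
have [an1 an2] := angle_frame sp fr.
move: fr => [[d0 bI uE wE] [bd i1 i2 _ _]].
move: ori => /(_ k); case: s1 => -> ; rewrite ?opprK => ori.
  have aE := an1 ori; exists a, d; split => //; rewrite ?aE//.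
  - move=> r t rI tI; have [tb|bt|tb] := ltgtP t b.
    + split => // _; have [t0|t0] := eqVneq t 0.
        by left; apply/(bd _ _ rI tI); left.
      apply/(i1 _ t rI); last exact: ori.1.
      by rewrite tb andbT lt_def t0; case/andP: tI.
    + split => // h; exfalso; apply: ori.2; apply/(i2 _ t rI) => //.
      by rewrite bt; case/andP: tI.
    + by split => // _; left; apply/(bd _ _ rI tI); right.
  - by move=> r t rI tI /(bd _ _ rI _)[|h|h]; [clear -tI bI; lra|clear -tI h; lra|clear -tI h; lra].
have aE := an2 ori.
have [a' a'I wE'] := polar (p (ord_pred k) - p k).
have wn : 0 < enorm (p (ord_pred k) - p k) by rewrite enorm_gt0 edge_prev_neq0.
have dE t : dir (a' + t) = dir (a + (b + t)).
  have : dir a' = dir (a + b).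
    by apply: (scalerI (lt0r_neq0 wn)); rewrite -wE' -wE.
  by rewrite addrA; exact: dir_shift.
exists a', d; split => //; rewrite ?aE//; first lra.
- move=> r t rI tI; rewrite dE.
  have [tb|bt|tb] := ltgtP t (2 * pi - b).
  + split => // _; have [t0|t0] := eqVneq t 0.
      by left; apply/(bd _ _ rI); [lra|right; rewrite t0 addr0].
    apply/(i2 _ (b + t) rI); last exact: ori.1.
    have : 0 < t by rewrite lt_def t0; case/andP: tI.
    by lra.
  + have E : dir (a + (b + t)) = dir (a + (b + t - 2 * pi)).
      by rewrite -[RHS]dirD2pi; congr dir; ring.
    split => // h; exfalso; apply: ori.2; apply/(i1 _ (b + t - 2 * pi) rI); first lra.
    by rewrite -E.
  + have E : dir (a + (b + t)) = dir (a + 0).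
      by rewrite -[RHS]dirD2pi tb; congr dir; ring.
    by split => // _; left; rewrite E; apply/(bd _ _ rI); [lra|left].
- by move=> r t rI tI; rewrite dE => /(bd _ _ rI _)[|h|h]; [clear -tI bI; lra|clear -tI bI h; lra|clear -tI h; lra].
Qed.

(** The five turns come from adding the five angles [2 * pi - b k] of a clockwise pentagon. *)
Lemma cos_period5 (x : R) : cos (x + 10 * pi) = cos x.
Proof.
have -> : x + 10 * pi = x + pi *+ 2 + pi *+ 2 + pi *+ 2 + pi *+ 2 + pi *+ 2.
  by rewrite -mulr_natr; ring.
by rewrite !cosD2pi.
Qed.

(* The exterior angles add up to a multiple of a full turn. *)
Lemma cos_angle_sum p : simple p -> area (region p) = 1%:E ->
  cos (\sum_k angle p k) = -1.
Proof.
move=> sp ap; have [s s1 ori] := orientation sp ap; have pi0 := @pi_gt0 R; clear ap.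
have [a Ha] := choice (fun k => vertex_local k sp).
have [b Hb] := choice Ha.
have step k : dir (a k) = dir (a (ordS k) + (b (ordS k) - pi)).
  have [d [_ [[_ _ uE _] _]]] := Hb k.
  have [d' [_ [[_ _ _ wE] _]]] := Hb (ordS k).
  rewrite ordSK in wE.
  have un : 0 < enorm (p (ordS k) - p k) by rewrite enorm_gt0 edge_neq0.
  have wu : p k - p (ordS k) = - (p (ordS k) - p k) by rewrite opprB.
  rewrite wu enormN in wE.
  apply: (scalerI (lt0r_neq0 un)); rewrite -uE.
  rewrite -[LHS]opprK wE -scalerN; congr (_ *: _).
  rewrite addrA; apply: plane_eq => /=.
    by rewrite -[in LHS](subrK pi (a (ordS k) + b (ordS k))) cosDpi opprK.
  by rewrite -[in LHS](subrK pi (a (ordS k) + b (ordS k))) sinDpi opprK.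
pose k1 := ordS (ord0 : 'I_5); pose k2 := ordS k1; pose k3 := ordS k2; pose k4 := ordS k3.
have k5 : ordS k4 = ord0 by apply: val_inj.
have sumE (f : 'I_5 -> R) : \sum_k f k = f ord0 + f k1 + f k2 + f k3 + f k4.
  by rewrite !big_ord_recl big_ord0 addr0 !addrA; do ! congr (_ + _); congr f; apply: val_inj.
have : dir (a ord0) = dir (a ord0 + (\sum_k b k - 5 * pi)).
  rewrite sumE.
  have s5 := step k4; rewrite k5 in s5.
  have s4 := step k3; have s3 := step k2; have s2 := step k1.
  rewrite {1}step; rewrite -/k1.
  rewrite (dir_shift _ s2) -/k2 -addrA.
  rewrite (dir_shift _ s3) -/k3 -addrA.
  rewrite (dir_shift _ s4) -/k4 -addrA.
  rewrite (dir_shift _ s5) -addrA; congr dir; ring.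
set S := \sum_k b k => E.
have S1 : 1 = cos (S - 5 * pi).
  have := dot_dir (a ord0) 0 (S - 5 * pi); have := dot_dir (a ord0) 0 0.
  by rewrite addr0 -E subrr cos0 => ->; rewrite sub0r cosN.
have cS : cos S = -1.
  have -> : S = S - 5 * pi + pi *+ 2 + pi *+ 2 + pi by rewrite -mulr_natr; ring.
  by rewrite cosDpi !cosD2pi -S1.
case: s1 ori => -> ori.
  rewrite (eq_bigr b) // => k _; have [d [_ fr]] := Hb k.
  exact: (angle_frame sp fr).1 (ori k).
rewrite (eq_bigr (fun k => 2 * pi - b k)); last first.
  move=> k _; have [d [_ fr]] := Hb k.
  by apply: (angle_frame sp fr).2; have := ori k; rewrite opprK.
rewrite sumrB -/S big_const_ord iter_addr_0 -mulr_natr.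
rewrite (_ : _ - S = - S + 10 * pi); last by ring.
by rewrite cos_period5 cosN.
Qed.

End Angle.

(** * Perimeter bounds for unit-area pentagons *)

Section Perimeter.
Context {R : realType}.
Implicit Types (p : pentagon R) (k l : 'I_5) (x u v f : R * R) (a b d r t s : R).

Lemma ordS5 k : ordS (ordS (ordS (ordS (ordS k)))) = k.
Proof. by apply: val_inj; case: k => [[|[|[|[|[|]]]]]]. Qed.

Lemma ord_predE k : ord_pred k = ordS (ordS (ordS (ordS k))).
Proof. by rewrite -[in LHS](ordS5 k) ordSK. Qed.

Lemma cyclic_sum (g : 'I_5 -> R) k : \sum_j g j =
  g k + g (ordS k) + g (ordS (ordS k)) + g (ordS (ordS (ordS k))) + g (ord_pred k).
Proof.
rewrite ord_predE; pose P k := \sum_j g j = g k + g (ordS k) + g (ordS (ordS k)) +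
  g (ordS (ordS (ordS k))) + g (ordS (ordS (ordS (ordS k)))).
rewrite -/(P k).
suff h : P ord0.
  suff : P ord0 <-> P k by move=> [+ _]; apply.
  apply: cyclic_invariant => {}k; rewrite /P; set z := \sum_j _.
  have -> : k = ordS (ord_pred k) by rewrite ord_predK.
  by rewrite ordSK ordS5; split => ->; ring.
rewrite /P !big_ord_recl big_ord0 addr0 !addrA.
by do ! congr (_ + _); congr g; apply: val_inj.
Qed.

Lemma cos_corner p k : simple p ->
  [/\ 0 <= corner p k <= pi, corner p k <= angle p k &
  dot (p (ordS k) - p k) (p (ord_pred k) - p k) =
  dist (p k) (p (ordS k)) * dist (p k) (p (ord_pred k)) * cos (corner p k)].
Proof.
move=> sp; have pi0 := @pi_gt0 R.
have [a [b [d [_ fr]]]] := vertex_local k sp.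
have cE := corner_frame sp fr.
have [[d0 /andP[b0 b1] uE wE] _] := fr.
have cI : 0 <= corner p k <= pi by rewrite cE; case: (leP b pi) => h; lra.
split => //; first by rewrite /angle; case: ifP => _ //; clear -cI; lra.
have -> : cos (corner p k) = cos b.
  rewrite cE; case: (leP b pi) => // _.
  by rewrite (_ : 2 * pi - b = - b + pi *+ 2) ?cosD2pi ?cosN// -mulr_natr; ring.
rewrite {1}uE {1}wE (_ : dot _ _ = enorm (p (ordS k) - p k) * enorm (p (ord_pred k) - p k) * dot (dir a) (dir (a + b))).
  by have := dot_dir a 0 b; rewrite addr0 => ->; rewrite sub0r cosN.
by rewrite /dot/= /GRing.scale/=; ring.
Qed.

Lemma perimeterE p k : perimeter p =
  dist (p k) (p (ordS k)) + dist (p (ordS k)) (p (ordS (ordS k))) +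
  dist (p (ordS (ordS k))) (p (ordS (ordS (ordS k)))) +
  dist (p (ordS (ordS (ordS k)))) (p (ord_pred k)) + dist (p (ord_pred k)) (p k).
Proof.
by rewrite /perimeter (cyclic_sum _ k) /edge_length ord_predE ordS5.
Qed.

(** In the fan from the vertex after [k] two triangles degenerate, and the others are those of
    [five_point_bound]. That bound is applied to the geometric corner, which never exceeds the
    angle, and it decreases in the angle. *)
Lemma perimeter_angle_bound p k : simple p -> area (region p) = 1%:E ->
  (386 + 371 / 1000) / 100 - 99 / 1000 * (angle p k / pi) <= perimeter p.
Proof.
move=> sp ap; have [cI ca dE] := cos_corner k sp; have pi0 := @pi_gt0 R.
have := area_region_fan p (p (ordS k)); rewrite ap lee_fin {ap}.
rewrite (cyclic_sum _ k) -!mulrDl.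
rewrite [in cross (p k - _) _]subrr [in cross _ (p (ordS (ord_pred k)) - _)]ord_predK.
rewrite (_ : cross (p k - p (ordS k)) 0 = 0); last by rewrite /cross/= !mulr0 subrr.
rewrite [in cross (p (ordS k) - _) _]subrr.
rewrite (_ : cross 0 _ = 0); last by rewrite /cross/= !mul0r subrr.
rewrite normr0 !add0r ler_pdivlMr// mul1r.
rewrite -[ordS (ordS (ordS (ordS k)))]ord_predE => h.
have E : cross (p (ordS k) - p k) (p (ord_pred k) - p k) = cross (p (ord_pred k) - p (ordS k)) (p k - p (ordS k)).
  by rewrite /cross/=; ring.
have h' := h; rewrite -E in h'.
have {}h' := five_point_bound dE cI h'.
have : corner p k / pi <= angle p k / pi by rewrite ler_pM2r ?invr_gt0.
move: h'; rewrite -(perimeterE p k).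
by move: (corner p k / pi) (angle p k / pi) (perimeter p) => y z L; clear; lra.
Qed.

(* The boundary directions at a reflex vertex are not both in the half-plane
   opposite to an outer direction. *)
Lemma reflex_not_max p k f : simple p -> area (region p) = 1%:E -> f != 0 ->
  pi < angle p k -> exists j, dot f (p k) < dot f (p j).
Proof.
move=> sp ap f0 ang; have pi0 := @pi_gt0 R; apply: contrapT => /forallNP nj.
have kmax j : dot f (p j) <= dot f (p k) by rewrite leNgt; apply/negP/nj.
have [a [d [aI d0 /andP[an0 an1] H _]]] := germ k sp ap; clear ap.
have fn : 0 < enorm f by rewrite enorm_gt0.
have [t tI fE] := @polar_from R a 1 f sign1; rewrite mul1r in fE.
have dI : 0 < d / 2 < d by lra.
have dots z : dot f (p k + (d / 2) *: dir (a + z)) =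
    dot f (p k) + d / 2 * enorm f * cos (t - z).
  rewrite dotDr dotZr; congr (_ + _).
  by rewrite -(dot_dir a) {1}fE /dot/= /GRing.scale/=; ring.
have out z : 0 <= z < 2 * pi -> z <= angle p k -> cos (t - z) <= 0.
  move=> zI za; have [j] := region_dot f ((H _ _ dI zI).2 za).
  rewrite dots => h; have := kmax j => h'.
  have : d / 2 * enorm f * cos (t - z) <= 0 by lra.
  by rewrite pmulr_rle0 ?mulr_gt0 ?divr_gt0.
have ta : angle p k < t.
  rewrite ltNge; apply/negP => /(out _ tI); rewrite subrr cos0.
  by rewrite ler10.
have zI0 : 0 <= (0 : R) < 2 * pi by lra.
have := out 0 zI0 (ltac:(clear -an0; lra)); have anI : 0 <= angle p k < 2 * pi by clear -an0 an1; lra.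
have := out _ anI (lexx _); rewrite subr0.
have [h|h] := leP (pi / 2) (t - angle p k); last first.
  by have := @cos_gt0_pihalf R (t - angle p k) (ltac:(clear -h ta pi0; lra)); clear; lra.
have : 0 < cos (- t + pi *+ 2) by apply: cos_gt0_pihalf; rewrite -mulr_natr; lra.
by rewrite cosD2pi cosN; lra.
Qed.

Lemma dist_path (q : nat -> R * R) m n :
  dist (q m) (q (m + n)%N) <= \sum_(m <= i < m + n) dist (q i) (q i.+1).
Proof.
elim: n => [|n IH].
  by rewrite addn0 big_geq// /dist subrr /enorm /dot/= !mul0r addr0 sqrtr0.
rewrite addnS big_nat_recr ?leq_addr//=.
by apply: le_trans (dist_triangle _ (q (m + n)%N) _) _; rewrite lerD2r.
Qed.

Lemma perimeter_ge_triangle p (i j k : 'I_5) : (i < j)%N -> (j < k)%N ->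
  dist (p i) (p j) + dist (p j) (p k) + dist (p k) (p i) <= perimeter p.
Proof.
move=> ij jk; pose q (m : nat) := p (inord (m %% 5)).
have qE (l : 'I_5) : q l = p l by congr p; rewrite modn_small// inord_val.
have qS m : q m.+1 = p (ordS (inord (m %% 5))).
  by congr p; apply: val_inj; rewrite /= !inordK ?ltn_pmod// -addn1 -[in RHS]addn1 modnDml.
have P (l l' : 'I_5) : (l <= l')%N -> dist (p l) (p l') <= \sum_(l <= m < l') dist (q m) (q m.+1).
  by move=> ll; have := dist_path q l (l' - l); rewrite subnKC// !qE.
have := P _ _ (ltnW ij); have := P _ _ (ltnW jk).
(* The third arc passes through vertex 0, where the periodic sequence [q] closes up:
   [q 5 = p ord0]. *)
have : dist (p k) (p i) <= \sum_(k <= m < 5) dist (q m) (q m.+1) + \sum_(0 <= m < i) dist (q m) (q m.+1).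
  apply: le_trans (dist_triangle _ (p ord0) _) _; apply: lerD.
    have := dist_path q k (5 - k); rewrite subnKC ?(ltnW (ltn_ord k))// qE.
    by rewrite (_ : q 5%N = p ord0)//; congr p; apply: val_inj; rewrite /= inordK.
  exact: P.
have -> : perimeter p = \sum_(0 <= m < 5) dist (q m) (q m.+1).
  rewrite big_mkord; apply: eq_bigr => l _; rewrite /edge_length qE qS.
  by rewrite modn_small// inord_val.
have k5 : (k <= 5)%N by exact: ltnW (ltn_ord k).
rewrite (big_cat_nat (leq0n k) k5) (big_cat_nat (leq0n j) (ltnW jk)).
rewrite (big_cat_nat (leq0n i) (ltnW ij)) /=.
move: (\sum_(0 <= m < i) _) (\sum_(i <= m < j) _) (\sum_(j <= m < k) _) (\sum_(k <= m < 5) _).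
by move=> s1 s2 s3 s4; lra.
Qed.

Lemma three_others (K : pred 'I_5) : #|[pred k | K k]| = 2 ->
  exists i j k : 'I_5, [/\ (i < j)%N, (j < k)%N &
    forall l, ~~ K l -> [\/ l = i, l = j | l = k]].
Proof.
rewrite -sum1_card big_mkcond /= !big_ord_recl big_ord0 /= !inE.
pose o1 := lift ord0 (ord0 : 'I_4); pose o2 := lift ord0 (lift ord0 (ord0 : 'I_3)).
pose o3 : 'I_5 := lift ord0 (lift ord0 (lift ord0 (ord0 : 'I_2))).
pose o4 : 'I_5 := lift ord0 (lift ord0 (lift ord0 (lift ord0 (ord0 : 'I_1)))).
rewrite -/o1 -/o2 -/o3 -/o4.
have all5 (l : 'I_5) : [\/ l = ord0, l = o1, l = o2 | l = o3 \/ l = o4].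
  case: l => [[|[|[|[|[|m]]]]] lm] //.
  - by apply: Or41; apply: val_inj.
  - by apply: Or42; apply: val_inj.
  - by apply: Or43; apply: val_inj.
  - by apply: Or44; left; apply: val_inj.
  - by apply: Or44; right; apply: val_inj.
case K0: (K ord0); case K1: (K o1); case K2: (K o2); case K3: (K o3); case K4: (K o4) => // _;
  [exists o2, o3, o4|exists o1, o3, o4|exists o1, o2, o4|exists o1, o2, o3|exists ord0, o3, o4
  |exists ord0, o2, o4|exists ord0, o2, o3|exists ord0, o1, o4|exists ord0, o1, o3|exists ord0, o1, o2];
  split => // l; case: (all5 l) => [->|->|->|[->|->]]; rewrite ?K0 ?K1 ?K2 ?K3 ?K4// => _;
  by [apply: Or31|apply: Or32|apply: Or33].
Qed.

Lemma dot_perpE u v : dot (perp u) v = cross u v.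
Proof. by rewrite /dot /perp /cross/=; ring. Qed.

Lemma dotNl u v : dot (- u) v = - dot u v.
Proof. by rewrite /dot/=; ring. Qed.

(** A set dominated by three points in every direction lies in their triangle: the barycentric
    coordinates are affine functions, so suitable directions show that they are nonnegative. *)
Lemma area_dominated (A : set (R * R)) (a b c : R * R) : a != b ->
  (forall x f, f != 0 -> A x -> [\/ dot f x <= dot f a, dot f x <= dot f b | dot f x <= dot f c]) ->
  (area A <= (`|cross (b - a) (c - a)| / 2)%:E)%E.
Proof.
move=> ab dom; have ba : b - a != 0 by rewrite subr_eq0 eq_sym.
have {}dom x f (m : R) : f != 0 -> A x -> 0 <= m -> dot f (b - a) <= m -> dot f (c - a) <= m ->
    dot f (x - a) <= m.
  move=> f0 Ax m0 hb hc; have E y : dot f y = dot f a + dot f (y - a) by rewrite -dotDr addrC subrK.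
  have Ex := E x; have Eb := E b; have Ec := E c.
  by have [h|h|h] := dom x f f0 Ax; lra.
have nz f y : dot f y != 0 -> f != 0.
  by apply: contraNneq => ->; rewrite /dot/= !mul0r addr0.
set D := cross (b - a) (c - a).
have [D0|D0] := eqVneq D 0.
  have g0 : perp (b - a) != 0.
    by apply: (@nz _ (perp (b - a))); rewrite dot_perp2 gt_eqF// dot_gt0.
  have gN0 : - perp (b - a) != 0 by rewrite oppr_eq0.
  have line x : A x -> cross (b - a) (x - a) = 0.
    move=> Ax; have cbb : cross (b - a) (b - a) = 0 by rewrite /cross; ring.
    have := dom x _ 0 g0 Ax (lexx _); have := dom x _ 0 gN0 Ax (lexx _).
    rewrite !dotNl !dot_perpE -/D D0 cbb oppr0 => /(_ (lexx _) (lexx _)) h1 /(_ (lexx _) (lexx _)) h2.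
    lra.
  pose q := dot (b - a) (b - a); have q0 : 0 < q by exact: dot_gt0.
  pose M := q + `|dot (b - a) (c - a)|.
  have M0 : 0 <= M by rewrite addr_ge0// ltW.
  have := ler_norm (dot (b - a) (c - a)); have := ler_norm (- dot (b - a) (c - a)).
  rewrite normrN => n1 n2.
  have bound x : A x -> `|dot (b - a) (x - a)| <= M.
    move=> Ax; rewrite ler_norml.
    have h1 := dom x (b - a) M ba Ax M0; have := dom x (- (b - a)) M; rewrite oppr_eq0.
    move=> /(_ ba Ax M0); rewrite !dotNl -/q => h2; apply/andP; split.
      by rewrite lerNl; apply: h2; rewrite /M; lra.
    by apply: h1; rewrite -/q /M; lra.
  (* For collinear points the set lies on a bounded part of a line, covered by one flat triangle. *)
  apply: le_trans (@area_triangles _ unit (fun=> a - (M / q) *: (b - a))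
     (fun=> a + (M / q) *: (b - a)) (fun=> a) A _) _; last first.
    rewrite lee_fin big_const card_unit/= addr0.
    rewrite (_ : cross _ _ = 0) ?normr0 ?mul0r ?divr_ge0//.
    by rewrite /cross/= /GRing.scale/=; ring.
  move=> x Ax; exists tt; have [M00|M00] := eqVneq M 0.
    by move: M00; rewrite /M; have := normr_ge0 (dot (b - a) (c - a)); lra.
  have Mp : 0 < M by rewrite lt_def M00.
  pose z := dot (b - a) (x - a) / q.
  have xE : x = a + z *: (b - a).
    have h := line x Ax; have : x - a = z *: (b - a).
      have qq : (b - a).1 * (b - a).1 + (b - a).2 * (b - a).2 != 0.
        by rewrite -[_ + _]/(dot (b - a) (b - a)) gt_eqF.
      move: h qq; rewrite /z /q /cross /dot; move: (b - a) (x - a) => [e1 e2] [y1 y2] /= h qq.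
      apply: plane_eq => /=; rewrite /GRing.scale/=; apply: (mulIf qq); rewrite mulrAC divfK//.
        transitivity ((e1 * y1 + e2 * y2) * e1 - e2 * (e1 * y2 - e2 * y1)); first ring.
        by rewrite h mulr0 subr0.
      transitivity ((e1 * y1 + e2 * y2) * e2 + e1 * (e1 * y2 - e2 * y1)); first ring.
      by rewrite h mulr0 addr0.
    by move=> <-; rewrite addrC subrK.
  have zb : `|z| <= M / q by rewrite /z normrM normfV (gtr0_norm q0) ler_pM2r ?invr_gt0// bound.
  move: zb; rewrite ler_norml => /andP[z1 z2].
  pose y := M / q; have y0 : 0 < y by rewrite divr_gt0.
  exists ((z + y) / (2 * y)), 0; split => //.
  - by apply: divr_ge0; [move: z1; rewrite -/y; lra|rewrite mulr_ge0// ltW].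
  - have y2 : 0 < 2 * y by lra.
    by rewrite addr0 ler_pdivrMr//; move: z2; rewrite -/y; lra.
  - rewrite xE scale0r addr0 -/y; apply: plane_eq => /=; rewrite /GRing.scale/=; field; clear -y0; lra.
rewrite (_ : _ / 2 = \sum_(i : unit) `|D| / 2); last by rewrite big_const card_unit/= addr0.
apply: (@area_triangles _ unit (fun=> a) (fun=> b) (fun=> c)) => x Ax; exists tt.
(* Barycentric coordinates by Cramer's rule; each of the three inequalities for them tests one
   direction normal to a side. *)
pose s := cross (x - a) (c - a) / D; pose t := cross (b - a) (x - a) / D.
have dZ (z : R) u v : dot (z *: u) v = z * dot u v by rewrite /dot/= /GRing.scale/=; ring.
have DD : D^-1 * D = 1 by rewrite mulVf.
have c0 u : cross u u = 0 by rewrite /cross; ring.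
have cN u v : cross u v = - cross v u by rewrite /cross; ring.
have s0 : 0 <= s.
  pose f := D^-1 *: perp (c - a).
  have fb : dot f (b - a) = -1 by rewrite dZ dot_perpE cN -/D mulrN DD.
  have fc : dot f (c - a) = 0 by rewrite dZ dot_perpE c0 mulr0.
  have f0 : f != 0 by apply: (@nz _ (b - a)); rewrite fb oppr_eq0 oner_eq0.
  have := dom x f 0 f0 Ax (lexx _); rewrite fb fc lexx oppr_le0 ler01 => /(_ isT isT).
  by rewrite dZ dot_perpE cN mulrN mulrC -/s oppr_le0.
have t0 : 0 <= t.
  pose f := - (D^-1 *: perp (b - a)).
  have fb : dot f (b - a) = 0 by rewrite dotNl dZ dot_perpE c0 mulr0 oppr0.
  have fc : dot f (c - a) = -1 by rewrite dotNl dZ dot_perpE -/D DD.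
  have f0 : f != 0 by apply: (@nz _ (c - a)); rewrite fc oppr_eq0 oner_eq0.
  have := dom x f 0 f0 Ax (lexx _); rewrite fb fc lexx oppr_le0 ler01 => /(_ isT isT).
  by rewrite dotNl dZ dot_perpE mulrC -/t oppr_le0.
have st : s + t <= 1.
  pose f := D^-1 *: (perp (b - a) - perp (c - a)).
  have fE y : dot f y = (cross (b - a) y - cross (c - a) y) / D.
    by rewrite dZ mulrC; congr (_ / _); rewrite /dot /cross/=; ring.
  have fb : dot f (b - a) = 1 by rewrite fE c0 [cross (c - a) _]cN opprK add0r -/D divff.
  have fc : dot f (c - a) = 1 by rewrite fE c0 subr0 -/D divff.
  have f0 : f != 0 by apply: (@nz _ (c - a)); rewrite fc oner_eq0.
  have := dom x f 1 f0 Ax ler01; rewrite fb fc lexx => /(_ isT isT).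
  by rewrite fE [cross (c - a) _]cN opprK mulrDl -/t -/s addrC.
exists s, t; split => //.
move: D0; rewrite /s /t /D /cross /=; clear; case: a b c x => [a1 a2] [b1 b2] [c1 c2] [x1 x2] /= D0.
by apply: plane_eq => /=; rewrite /GRing.scale/=; field.
Qed.

(** In no direction is a reflex vertex extremal, so the region is dominated by the three other
    vertices. Their triangle thus has area at least 1, and by the triangle inequality its perimeter
    is no longer than that of the pentagon. *)
Lemma type2_perimeter p : type2 p -> area (region p) = 1%:E ->
  (455 + 9 / 10) / 100 <= perimeter p.
Proof.
move=> [sp K2] ap.
have [i [j [k [ij jk oth]]]] := @three_others (fun k => pi < angle p k) K2.
apply: le_trans (perimeter_ge_triangle p ij jk); apply: triangle_bound.
have ijn : p i != p j.
  by apply/eqP => /sp.1 e; move: ij; rewrite e ltnn.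
have := @area_dominated (region p) (p i) (p j) (p k) ijn.
rewrite ap lee_fin => h; rewrite -(@ler_pM2r _ 2^-1) ?invr_gt0// divff//; apply: h.
move=> x f f0 /(region_dot f)[l xl].
pose m := [arg max_(m > l) dot f (p m)]%O.
have mmax l' : dot f (p l') <= dot f (p m) by rewrite /m; case: arg_maxP => //= i0 _; exact.
have mr : ~~ (pi < angle p m).
  apply/negP => /(reflex_not_max sp ap f0)[l' h]; have := mmax l'.
  by rewrite leNgt h.
have xm := le_trans xl (mmax l).
by have [<-|<-|<-] := oth m mr; [apply: Or31|apply: Or32|apply: Or33].
Qed.

Lemma angle_gt0 p k : simple p -> area (region p) = 1%:E -> 0 < angle p k < 2 * pi.
Proof. by move=> sp ap; have [a [d []]] := germ k sp ap. Qed.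

(** Two angles above [pi] bring the sum beyond [2 * pi], and cosine -1 leaves only odd multiples of
    [pi]. The charging needs this lower bound alone. *)
Lemma type2_angle_sum p : type2 p -> area (region p) = 1%:E ->
  3 * pi <= \sum_k angle p k.
Proof.
move=> [sp K2] ap; have cS := cos_angle_sum sp ap; have pi0 := @pi_gt0 R.
have S2 : 2 * pi < \sum_k angle p k.
  have [k0 K0] : exists k0, pi < angle p k0.
    have : (0 < #|[pred k | (pi < angle p k)%R]|)%N by rewrite K2.
    by case/card_gt0P => k0; rewrite inE; exists k0.
  apply: (@le_lt_trans _ _ (\sum_(k | pi < angle p k) pi)).
    by rewrite sumr_const (_ : #|_| = 2) ?mulr_natl// mulrC mulr_natr.
  apply: (@lt_le_trans _ _ (\sum_(k | pi < angle p k) angle p k)).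
    rewrite [X in X < _](bigD1 k0)//= [X in _ < X](bigD1 k0)//= ltr_leD//.
    by apply: ler_sum => k /andP[/ltW].
  rewrite [X in _ <= X](bigID (fun k => pi < angle p k))/= lerDl sumr_ge0// => k _.
  by have := angle_gt0 k sp ap => /andP[/ltW].
rewrite leNgt; apply/negP => S3; set S := \sum_k _ in cS S2 S3 *.
have : S - 3 * pi = 0; last by lra.
apply: cos_eq1; first lra.
have := cosDpi (S - 3 * pi + pi *+ 2); rewrite cosD2pi.
rewrite (_ : S - 3 * pi + pi *+ 2 + pi = S); last by rewrite -mulr_natr; ring.
by rewrite cS => /oppr_inj.
Qed.

End Perimeter.

(** * Translates of pentagons, and segments as sets *)

Section Translation.
Context {R : realType}.
Implicit Types (p : pentagon R) (k l : 'I_5) (x u v : R * R).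

Definition translate p v : pentagon R := fun k => p k + v.

Lemma edge_translate p v k x : edge (translate p v) k x <-> edge p k (x - v).
Proof.
have E : translate p v (ordS k) - translate p v k = p (ordS k) - p k.
  by rewrite /translate opprD addrACA subrr addr0.
split=> /edgeE[t tI xE]; apply/edgeE; exists t => //.
  by rewrite xE E /translate addrAC addrK.
by rewrite E /translate addrAC -xE subrK.
Qed.

Lemma boundary_translate p v x : boundary (translate p v) x <-> boundary p (x - v).
Proof. by split=> -[k _ /edge_translate h]; exists k. Qed.

Lemma region_translate_sub p v x : region p (x - v) -> region (translate p v) x.
Proof.
move=> [bx|[nx bd]]; first by left; apply/boundary_translate.
right; split; first by move/boundary_translate.
have sub : connected_component (~` boundary (translate p v)) x `<=`
    (fun y => y + v) @` connected_component (~` boundary p) (x - v).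
  move=> y [C [Cx CB cC] Cy]; exists (y - v); last by rewrite subrK.
  exists ((fun z => z - v) @` C); last by exists y.
  split.
  - by exists x.
  - by move=> _ [z Cz <-] /boundary_translate; exact: CB.
  - apply: connected_continuous_connected => //.
    apply: continuous_subspaceT => z; apply: cvgB; [exact: cvg_id|exact: cvg_cst].
have [M [Mr H]] := bd; exists (M + `|v|); split; first by rewrite realD ?normr_real.
move=> M' MM' y /sub[z /H Hz <-].
apply: le_trans (ler_normD _ _) _; rewrite -lerBrDr.
by apply: Hz; rewrite ltrBrDr.
Qed.

Lemma translateK p v : translate (translate p v) (- v) = p.
Proof. by apply/funext => k; rewrite /translate addrK. Qed.

Lemma region_translate p v x : region (translate p v) x <-> region p (x - v).
Proof.
split=> [h|]; last exact: region_translate_sub.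
rewrite -[p in region p](translateK p v); apply: region_translate_sub.
by rewrite opprK subrK.
Qed.

Lemma simple_translate p v : simple p -> simple (translate p v).
Proof.
move=> [inj H]; split=> [k l /addIr /inj //|k l kl x [/edge_translate xk /edge_translate xl]].
have [h1 h2] := H k l kl _ (conj xk xl).
have E k' : x - v = p k' -> x = translate p v k' by rewrite /translate => <-; rewrite subrK.
by split; [case: h1 => /E; [left|right]|case: h2 => /E; [left|right]].
Qed.

Lemma off_boundary_ball p x : ~ boundary p x -> exists2 e : R, 0 < e &
  forall y, `|y - x| < e -> ~ boundary p y /\ (region p y <-> region p x).
Proof.
move=> nx; have KF : [set x] `&` boundary p = set0.
  by apply/seteqP; split => // _ [-> /nx].
have [e e0 H] := compact_closed_away (@compact_set1 _ x) (@closed_boundary R p) KF.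
exists e => // y xy; split; first exact: (H x y erefl xy).
apply: region_segment => _ [t /= /andP[t0 t1] <-]; apply: (H x) => //.
rewrite (_ : _ - x = (1 - t) *: (y - x)); last first.
  by apply: plane_eq; rewrite /= /GRing.scale/=; ring.
rewrite normrZ ger0_norm ?subr_ge0//; apply: le_lt_trans xy.
by rewrite ler_piMl// lerBlDr lerDl.
Qed.

Lemma region_interior p x : region p x -> ~ boundary p x -> interior (region p) x.
Proof.
move=> rx /off_boundary_ball[e e0 H]; rewrite /interior; apply/nbhs_ballP.
exists e => //= y; rewrite -ball_normE /= distrC => /H[_ h]; exact/h.
Qed.

Lemma not_region_ball p x : ~ region p x -> exists2 e : R, 0 < e &
  forall y, `|y - x| < e -> ~ region p y.
Proof.
move=> nx; have /off_boundary_ball[e e0 H] : ~ boundary p x by move=> bx; apply: nx; left.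
by exists e => // y /H[_ h] /h.
Qed.

Lemma region_bounded p : exists2 M : R, 0 <= M & forall x, region p x -> `|x| <= M.
Proof.
pose M := \sum_k `|p k|; have M0 : 0 <= M by apply: sumr_ge0.
have pM k : `|p k| <= M by rewrite /M (bigD1 k)//= lerDl sumr_ge0.
exists M => // x rx; rewrite prod_normE ge_max !ler_norml.
have b1 k := le_trans (norm_fst_le (p k)) (pM k).
have b2 k := le_trans (norm_snd_le (p k)) (pM k).
have [k1] := region_dot (1, 0) rx; have [k2] := region_dot (-1, 0) rx.
have [k3] := region_dot (0, 1) rx; have [k4] := region_dot (0, -1) rx.
rewrite /dot/= !mul1r !mulN1r !mul0r !addr0 !add0r.
have := b1 k1; have := b1 k2; have := b2 k3; have := b2 k4; rewrite !ler_norml.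
by clear; move=> /andP[? ?] /andP[? ?] /andP[? ?] /andP[? ?] ? ? ? ?; apply/andP; split; apply/andP; split; lra.
Qed.

(** Shared edges are given as equal sets of points; an endpoint is recovered as an extreme point,
    never strictly between two points of the segment. *)
Lemma segment_endpoint (a b c d : R * R) : segment a b = segment c d -> a = c \/ a = d.
Proof.
move=> E; have : segment c d a by rewrite -E; exact: segment_left.
have : segment a b c by rewrite E; exact: segment_left.
have : segment a b d by rewrite E; exact: segment_right.
rewrite !segmentE => -[s /=]; rewrite in_itv/= => /andP[s0 s1] dE.
move=> [t /=]; rewrite in_itv/= => /andP[t0 t1] cE.
move=> [r /=]; rewrite in_itv/= => /andP[r0 r1] aE.
have {aE} : ((1 - r) * t + r * s) *: (b - a) = 0.
  apply: (addrI a); rewrite addr0 -[RHS]aE -dE -cE.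
  by apply: plane_eq; rewrite /= /GRing.scale/=; ring.
move=> /eqP; rewrite scaler_eq0 => /orP[/eqP h|/eqP ba]; last first.
  by left; rewrite -cE ba scaler0 addr0.
have h1 : 0 <= (1 - r) * t by rewrite mulr_ge0 ?subr_ge0.
have h2 : 0 <= r * s by rewrite mulr_ge0.
have /eqP : (1 - r) * t = 0 by lra.
have /eqP : r * s = 0 by lra.
rewrite !mulf_eq0 => /orP[/eqP r00|/eqP s00]; last by right; rewrite -dE s00 scale0r addr0.
move=> /orP[|/eqP t00]; first by rewrite r00 subr0 oner_eq0.
by left; rewrite -cE t00 scale0r addr0.
Qed.

Lemma segment_sym (a b : R * R) : segment a b = segment b a.
Proof.
apply/seteqP; split => _ [t /= /andP[t0 t1] <-]; (exists (1 - t); first by rewrite /=; lra);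
  by rewrite subKr addrC.
Qed.

Lemma segment_ends (a b c d : R * R) : segment a b = segment c d ->
  (a = c /\ b = d) \/ (a = d /\ b = c).
Proof.
move=> E; have Ea := segment_endpoint E.
have Eb : b = c \/ b = d by apply: (@segment_endpoint b a); rewrite segment_sym.
have Ec : c = a \/ c = b by apply: (@segment_endpoint c d); rewrite -E.
have Ed : d = a \/ d = b by apply: (@segment_endpoint d c); rewrite -segment_sym -E.
by case: Ea Eb Ec Ed => -> [] -> [] ? [] ?; auto.
Qed.

End Translation.

(** * Arcs of a circle *)

Section Arcs.
Context {R : realType}.
Implicit Types (a b t x : R).
Local Notation mu := (@lebesgue_measure R).

(** The circle is [[0, 2 * pi[]; the second alternative is the part of the arc, starting at [a] with
    length [b], that runs past a full turn. *)
Definition open_arc a b : set R :=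
  [set t | 0 <= t < 2 * pi /\ (a < t < a + b \/ t < a + b - 2 * pi)].

Definition closed_arc a b : set R :=
  [set t | 0 <= t < 2 * pi /\ (a <= t <= a + b \/ t <= a + b - 2 * pi)].

Lemma measure_itv_oo x y : x <= y -> mu `]x, y[ = (y - x)%:E.
Proof.
move=> xy; rewrite lebesgue_measure_itv/= lte_fin; case: ltP => [_|yx]; first by rewrite -EFinB.
by have -> : y - x = 0 by [lra].
Qed.

Lemma measure_itv_co x y : x <= y -> mu `[x, y[ = (y - x)%:E.
Proof.
move=> xy; rewrite lebesgue_measure_itv/= lte_fin; case: ltP => [_|yx]; first by rewrite -EFinB.
by have -> : y - x = 0 by [lra].
Qed.

Lemma measure_itv_cc x y : x <= y -> mu `[x, y] = (y - x)%:E.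
Proof.
move=> xy; rewrite lebesgue_measure_itv/= lte_fin; case: ltP => [_|yx]; first by rewrite -EFinB.
by have -> : y - x = 0 by [lra].
Qed.

Lemma open_arc_measure a b : 0 <= a < 2 * pi -> 0 < b < 2 * pi ->
  measurable (open_arc a b) /\ mu (open_arc a b) = b%:E.
Proof.
move=> aI bI; have [ab|ab] := leP (a + b) (2 * pi).
  have -> : open_arc a b = `]a, a + b[%classic.
    apply/seteqP; split => t /=; rewrite in_itv/=; first by move=> [? [//|?]]; lra.
    by move=> tI; split; [lra|left].
  split; first exact: measurable_itv.
  by rewrite measure_itv_oo; [congr EFin; ring|lra].
have -> : open_arc a b = `]a, 2 * pi[%classic `|` `[0, a + b - 2 * pi[%classic.
  apply/seteqP; split => t /=; rewrite !in_itv/=.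
    by move=> [tI [h|h]]; [left|right]; lra.
  by move=> [h|h]; (split; first lra); [left|right]; lra.
split; first by apply: measurableU; exact: measurable_itv.
rewrite measureU; [|exact: measurable_itv|exact: measurable_itv|].
  apply: eq_trans (_ : ((2 * pi - a)%:E + (a + b - 2 * pi)%:E)%E = _); last first.
    by rewrite -EFinD; congr EFin; ring.
  congr (_ + _)%E; first by apply: measure_itv_oo; lra.
  apply: eq_trans (lebesgue_measure_itv _) _ => /=; rewrite lte_fin ifT; last lra.
  by rewrite -EFinB subr0.
by apply/seteqP; split => t //=; rewrite !in_itv/= => -[]; lra.
Qed.

Lemma closed_arc_measure a b : 0 <= a < 2 * pi -> 0 < b < 2 * pi ->
  measurable (closed_arc a b) /\ (mu (closed_arc a b) <= b%:E)%E.
Proof.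
move=> aI bI; have [ab|ab] := ltP (a + b) (2 * pi).
  have -> : closed_arc a b = `[a, a + b]%classic.
    apply/seteqP; split => t /=; rewrite in_itv/=; first by move=> [? [//|?]]; lra.
    by move=> tI; split; [lra|left].
  split; first exact: measurable_itv.
  apply: (@le_trans _ _ (a + b - a)%:E); last by rewrite lee_fin; lra.
  by rewrite lebesgue_measure_itv/= lte_fin ifT; [rewrite -EFinB|lra].
have -> : closed_arc a b = `[a, 2 * pi[%classic `|` `[0, a + b - 2 * pi]%classic.
  apply/seteqP; split => t /=; rewrite !in_itv/=.
    by move=> [tI [h|h]]; [left|right]; lra.
  by move=> [h|h]; (split; first lra); [left|right]; lra.
split; first by apply: measurableU; exact: measurable_itv.
apply: le_trans (measureU2 _ _ _) _; [exact: measurable_itv|exact: measurable_itv|].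
apply: (@le_trans _ _ ((2 * pi - a)%:E + (a + b - 2 * pi)%:E)%E); last first.
  by rewrite -EFinD lee_fin; lra.
have h1 : a <= 2 * pi by lra.
have h2 : 0 <= a + b - 2 * pi by lra.
apply: leeD; first by rewrite -(measure_itv_co h1).
have := measure_itv_cc h2; rewrite subr0 => <-.
exact: lexx.
Qed.

(** Compares measures in the circle. Together with [closed_arcs_cover] it squeezes the sum of the
    angles at a vertex to [2 * pi], without any cyclic ordering of the tiles. *)
Lemma open_arcs_disjoint (I : choiceType) (s : seq I) (a b : I -> R) :
  (forall i, 0 <= a i < 2 * pi) -> (forall i, 0 < b i < 2 * pi) ->
  uniq s ->
  (forall i j t, i \in s -> j \in s -> open_arc (a i) (b i) t -> open_arc (a j) (b j) t -> i = j) ->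
  \sum_(i <- s) b i <= 2 * pi.
Proof.
move=> aI bI us dis; have pi0 := @pi_gt0 R.
pose U (s : seq I) := \big[setU/set0]_(i <- s) open_arc (a i) (b i).
have mU s' : measurable (U s').
  by apply: bigsetU_measurable => i _; case: (open_arc_measure (aI i) (bI i)).
have inU (s' : seq I) t : U s' t -> exists2 i, i \in s' & open_arc (a i) (b i) t.
  by rewrite /U -bigcup_seq => -[i /= si ti]; exists i.
have : mu (U s) = (\sum_(i <- s) b i)%:E.
  elim: s us dis => [_ _|i s IH /= /andP[si us] dis].
    by rewrite /U !big_nil measure0.
  rewrite /U !big_cons EFinD -IH//; last first.
    by move=> i' j' t i's j's; apply: dis; rewrite inE ?i's ?j's orbT.
  have [mA eA] := open_arc_measure (aI i) (bI i).
  rewrite -eA; apply: measureU => //; first exact: mU.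
  apply/seteqP; split => // t [ti /inU[j js tj]].
  have ij : i = j by apply: (dis i j t) => //; rewrite inE ?eqxx ?js ?orbT.
  by rewrite ij js in si.
rewrite -lee_fin => <-; apply: (@le_trans _ _ (mu `[0, 2 * pi[)).
  apply: le_lebesgue_measure => t /inU[i _ [tI _]].
  by rewrite /= in_itv.
rewrite lebesgue_measure_itv/= lte_fin ifT; last lra.
by rewrite -EFinB subr0.
Qed.

Lemma closed_arcs_cover (I : choiceType) (s : seq I) (a b : I -> R) :
  (forall i, 0 <= a i < 2 * pi) -> (forall i, 0 < b i < 2 * pi) ->
  (forall t, 0 <= t < 2 * pi -> exists2 i, i \in s & closed_arc (a i) (b i) t) ->
  2 * pi <= \sum_(i <- s) b i.
Proof.
move=> aI bI cover; have pi0 := @pi_gt0 R.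
pose U (s : seq I) := \big[setU/set0]_(i <- s) closed_arc (a i) (b i).
have mU s' : measurable (U s').
  by apply: bigsetU_measurable => i _; case: (closed_arc_measure (aI i) (bI i)).
have aU : (mu (U s) <= (\sum_(i <- s) b i)%:E)%E.
  rewrite /U; elim: s {cover} => [|i s IH]; first by rewrite !big_nil measure0.
  have [mA eA] := closed_arc_measure (aI i) (bI i).
  rewrite !big_cons EFinD; apply: le_trans (measureU2 _ _ _) _ => //; first exact: mU.
  exact: leeD.
rewrite -lee_fin; apply: le_trans aU.
apply: (@le_trans _ _ (mu `[0, 2 * pi[)).
  rewrite lebesgue_measure_itv/= lte_fin ifT; last lra.
  by rewrite -EFinB subr0.
apply: le_lebesgue_measure => t /=; rewrite in_itv/= => /cover[i si ti].
by rewrite /U -bigcup_seq; exists i.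
Qed.

End Arcs.

(** * Angles around a vertex of the tiling *)

Section Vertices.
Context {R : realType} {n : nat}.
Variables (e1 e2 : R * R) (P : 'I_n -> pentagon R).
Hypothesis Ptiling : torus_tiling e1 e2 P.
Hypothesis Pedge : edge_to_edge e1 e2 P.
Hypothesis Parea : unit_area_tiling P.

Let lift (s : 'I_n * (int * int)) : pentagon R := lift_tile e1 e2 P s.

Definition lattice_vec (z : int * int) : R * R := e1 *~ z.1 + e2 *~ z.2.

Lemma lift_tileE s : lift s = translate (P s.1) (lattice_vec s.2).
Proof. by []. Qed.

(** Cramer's rule for the lattice coordinates. *)
Lemma lattice_vec_cross (z : int * int) :
  cross (lattice_vec z) e2 = z.1%:~R * cross e1 e2 /\ cross e1 (lattice_vec z) = z.2%:~R * cross e1 e2.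
Proof.
rewrite /lattice_vec -(scaler_int z.1) -(scaler_int z.2); split.
  rewrite (_ : cross _ e2 = z.1%:~R * cross e1 e2 + z.2%:~R * cross e2 e2).
    by rewrite [cross e2 e2](_ : _ = 0) ?mulr0 ?addr0// /cross; ring.
  by rewrite /cross/= /GRing.scale/=; move: (z.1%:~R) (z.2%:~R) => b c; ring.
rewrite (_ : cross e1 _ = z.2%:~R * cross e1 e2 + z.1%:~R * cross e1 e1).
  by rewrite [cross e1 e1](_ : _ = 0) ?mulr0 ?addr0// /cross; ring.
by rewrite /cross/= /GRing.scale/=; move: (z.1%:~R) (z.2%:~R) => b c; ring.
Qed.

Let basis : cross e1 e2 != 0.
Proof. by have [] := Ptiling. Qed.

Lemma lattice_vec_inj : injective lattice_vec.
Proof.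
move=> z z' E; have [h1 h2] := lattice_vec_cross z; have [h1' h2'] := lattice_vec_cross z'.
case: z z' E h1 h2 h1' h2' => [a b] [a' b'] /= E.
rewrite E => h1 h2; rewrite h1 h2 => /(mulIf basis) /intr_inj -> /(mulIf basis) /intr_inj ->.
by [].
Qed.

Lemma lattice_vec0 : lattice_vec (0, 0) = 0.
Proof. by rewrite /lattice_vec/= !mulr0z addr0. Qed.

Lemma lift0 i : lift (i, (0, 0)) = P i.
Proof. by apply/funext => k; rewrite lift_tileE /translate lattice_vec0 addr0. Qed.

Lemma lift_simple s : simple (lift s).
Proof. by rewrite lift_tileE; apply: simple_translate; have [_ +] := Ptiling. Qed.

Lemma tile_simple i : simple (P i).
Proof. by have [_ +] := Ptiling. Qed.

(** The regions of the [n] chosen lifts are bounded, so a lift meeting the ball is a translate by a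
    bounded vector; Cramer's rule bounds its integer coordinates. *)
Lemma finitely_many_tiles (B : R) : exists L : seq ('I_n * (int * int)),
  forall s x, region (lift s) x -> `|x| <= B -> s \in L.
Proof.
have [M HM] := choice (fun i => let: ex_intro2 m m0 h := region_bounded (P i) in ex_intro (fun m => 0 <= m /\ forall x, region (P i) x -> `|x| <= m) m (conj m0 h)).
pose C := B + \sum_i M i.
have shiftB s x : region (lift s) x -> `|x| <= B -> `|lattice_vec s.2| <= C.
  rewrite lift_tileE => /region_translate /(HM s.1).2 h xB.
  rewrite -[lattice_vec s.2](subKr x) (le_trans (ler_normB _ _))// lerD//.
  apply: le_trans h _; rewrite (bigD1 s.1)//= lerDl sumr_ge0// => i _.
  by have [] := HM i.
pose D := 2 * C * (`|e1| + `|e2|) / `|cross e1 e2|.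
have cn : 0 < `|cross e1 e2| by rewrite normr_gt0.
have crossB (u v : R * R) : `|cross u v| <= 2 * (`|u| * `|v|).
  have h1 := norm_fst_le u; have h2 := norm_snd_le u.
  have h3 := norm_fst_le v; have h4 := norm_snd_le v.
  apply: le_trans (ler_normB _ _) _; rewrite !normrM.
  have : `|u.1| * `|v.2| <= `|u| * `|v| by apply: ler_pM.
  have : `|u.2| * `|v.1| <= `|u| * `|v| by apply: ler_pM.
  by lra.
have zB s x : region (lift s) x -> `|x| <= B -> `|s.2.1%:~R : R| <= D /\ `|s.2.2%:~R : R| <= D.
  move=> sx xB; have hC := shiftB _ _ sx xB; have [E1 E2] := lattice_vec_cross s.2.
  have n1 := normr_ge0 e1; have n2 := normr_ge0 e2; have n3 := normr_ge0 (lattice_vec s.2).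
  rewrite /D !ler_pdivlMr// -!normrM -E1 -E2; split.
    apply: le_trans (crossB _ _) _.
    have : `|lattice_vec s.2| * `|e2| <= C * `|e2| by rewrite ler_wpM2r.
    have : 0 <= C * `|e1| by rewrite mulr_ge0// (le_trans n3).
    by lra.
  apply: le_trans (crossB _ _) _.
  have : `|e1| * `|lattice_vec s.2| <= `|e1| * C by rewrite ler_wpM2l.
  have : 0 <= C * `|e2| by rewrite mulr_ge0// (le_trans n3).
  by lra.
pose N := Num.bound `|D|.
pose Z := [seq (m%:Z - N%:Z)%R | m <- iota 0 (2 * N)%N].
have inZ (a : int) : `|a%:~R : R| <= D -> a \in Z.
  move=> aD; have aN : `|a%:~R : R| < N%:R by apply: le_lt_trans aD _; exact: le_lt_trans (ler_norm D) (archi_boundP (normr_ge0 D)).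
  have {}aN : (`|a| < N%:Z)%R by rewrite -(ltr_int R) intr_norm.
  apply/mapP; exists (absz (a + N%:Z)%R); last first.
    by rewrite gez0_abs; [rewrite addrK|move: aN; rewrite ltr_norml => /andP[]; lia].
  rewrite mem_iota; apply/andP; split => //.
  by move: aN; rewrite ltr_norml => /andP[]; lia.
exists [seq (i, z) | i <- enum 'I_n, z <- [seq (a, b) | a <- Z, b <- Z]].
move=> [i [a b]] x sx xB; have [ha hb] := zB _ _ sx xB.
apply: (allpairs_f (fun i z => (i, z))); first by rewrite mem_enum.
by apply: (allpairs_f (fun a b => (a, b))); exact: inZ.
Qed.

Lemma tiles_near v : exists2 r : R, 0 < r &
  forall s x, `|x - v| < r -> region (lift s) x -> region (lift s) v.
Proof.
have [L HL] := finitely_many_tiles (`|v| + 1).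
have [r r0 Hr] : exists2 r : R, 0 < r & forall s x, s \in L ->
    `|x - v| < r -> region (lift s) x -> region (lift s) v.
  elim: L {HL} => [|s L [r r0 IH]]; first by exists 1.
  have [sv|sv] := pselect (region (lift s) v).
    exists r => // s' x; rewrite inE => /predU1P[->//|s'L]; exact: IH.
  have [e e0 He] := not_region_ball sv.
  exists (Num.min r e); first by rewrite lt_min r0.
  move=> s' x; rewrite lt_min inE => /predU1P[->|s'L] /andP[xr xe]; last exact: IH.
  by move=> /(He _ xe).
exists (Num.min r 1); first by rewrite lt_min r0 ltr01.
move=> s x; rewrite lt_min => /andP[xr x1] sx; apply: (Hr s x) => //.
apply: (HL s x) => //; rewrite -(subrK v x) (le_trans (ler_normD _ _))//.
by rewrite addrC lerD2l ltW.
Qed.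

(** Here the tiling is used to be edge-to-edge. On a common edge, the vertex [k] of the simple tile
    [s0] can only be an endpoint, and equal segments have the same endpoints. *)
Lemma vertex_of_tile s0 k s : region (lift s) (lift s0 k) -> exists l, lift s l = lift s0 k.
Proof.
move=> sv; have [<-|s0s] := eqVneq s0 s; first by exists k.
have s0v : region (lift s0) (lift s0 k) by left; exists k => //; exact: segment_left.
have [[k' [l [_ h]]]|[k' [l [E v_in]]]] := Pedge s0s s0v sv; first by exists l.
have {}v_in : lift s0 k = lift s0 k' \/ lift s0 k = lift s0 (ordS k').
  have [<-|k'k] := eqVneq k' k; first by left.
  have vk : edge (lift s0) k (lift s0 k) by exact: segment_left.
  by have [[h|h] _] := (lift_simple s0).2 _ _ k'k _ (conj v_in vk); [left|right].
have [[h1 h2]|[h1 h2]] := segment_ends E; case: v_in => ->.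
- by exists l.
- by exists (ordS l).
- by exists (ordS l).
- by exists l.
Qed.

(* The vertex [w'.2] of the tile [w'.1] lies, modulo the lattice, at that of [w]. *)
Definition same_vertex (w w' : 'I_n * 'I_5) : bool :=
  `[< exists z, lift (w'.1, z) w'.2 = P w.1 w.2 >].

Lemma same_vertex_refl w : same_vertex w w.
Proof. by apply/asboolP; exists (0, 0); rewrite lift0. Qed.

Lemma same_vertex_sym w w' : same_vertex w w' -> same_vertex w' w.
Proof.
move=> /asboolP[z]; rewrite lift_tileE /translate/= => E; apply/asboolP; exists (- z).
rewrite lift_tileE /translate/= -E.
by rewrite /lattice_vec /= !mulrNz -opprD addrK.
Qed.

(** On a small circle around the vertex every tile there cuts out an arc as long as its angle. The
    open arcs are disjoint because interiors are, and the closed arcs cover because a tile met by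
    the circle contains the centre, hence has it as a vertex. *)
Lemma vertex_angle_sum w : \sum_(w' | same_vertex w w') tile_angle P w' = 2 * pi.
Proof.
set v := P w.1 w.2.
have [z Hz] : exists z : 'I_n * 'I_5 -> int * int, forall w', same_vertex w w' -> lift (w'.1, z w') w'.2 = v.
  have := fun w' : 'I_n * 'I_5 => pselect (exists z, lift (w'.1, z) w'.2 = v).
  move=> H; exists (fun w' => if H w' is left h then projT1 (cid h) else (0, 0)).
  move=> w' /asboolP h; case: (H w') => // h'; exact: (projT2 (cid h')).
pose sw w' := (w'.1, z w') : 'I_n * (int * int).
have G w' := germ w'.2 (tile_simple w'.1) (Parea w'.1).
have [a Ha] := choice G; have {Ha G} [d Ha] := choice Ha.
have aI w' : 0 <= a w' < 2 * pi by have [] := Ha w'.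
have d0 w' : 0 < d w' by have [] := Ha w'.
have bI w' : 0 < tile_angle P w' < 2 * pi by have [] := Ha w'.
have [r0 r00 Hr0] := tiles_near v.
have [r [rp rr0 rd]] : exists r, [/\ 0 < r, r < r0 & forall w', r < d w'].
  have [r rp rd] : exists2 r, 0 < r & forall w', w' \in enum {: 'I_n * 'I_5} -> r < d w'.
    elim: (enum _) => [|w' L [r rp IH]]; first by exists 1.
    exists (Num.min r (d w') / 2); first by rewrite divr_gt0// lt_min rp d0.
    have h1 : Num.min r (d w') <= r by rewrite ge_min lexx.
    have h2 : Num.min r (d w') <= d w' by rewrite ge_min lexx orbT.
    have h3 : 0 < Num.min r (d w') by rewrite lt_min rp d0.
    move=> w''; rewrite inE => /predU1P[->|/IH]; lra.
  exists (Num.min r r0 / 2).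
  have h1 : Num.min r r0 <= r by rewrite ge_min lexx.
  have h2 : Num.min r r0 <= r0 by rewrite ge_min lexx orbT.
  have h3 : 0 < Num.min r r0 by rewrite lt_min rp.
  by split; [lra|lra|move=> w'; have := rd w' (mem_enum _ _); lra].
have rI w' : 0 < r < d w' by rewrite rp rd.
have tr w' x : same_vertex w w' -> region (lift (sw w')) (v + x) <-> region (P w'.1) (P w'.1 w'.2 + x).
  move=> /Hz h; rewrite lift_tileE; split => [/region_translate|h']; last apply/region_translate.
    by rewrite -h lift_tileE /translate/= addrAC addrK.
  by rewrite -h lift_tileE /translate/= addrAC addrK.
have trb w' x : same_vertex w w' -> boundary (lift (sw w')) (v + x) <-> boundary (P w'.1) (P w'.1 w'.2 + x).
  move=> /Hz h; rewrite lift_tileE; split => [/boundary_translate|h']; last apply/boundary_translate.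
    by rewrite -h lift_tileE /translate/= addrAC addrK.
  by rewrite -h lift_tileE /translate/= addrAC addrK.
have dirE w' t u : t = a w' + u \/ t = a w' + u - 2 * pi -> dir t = dir (a w' + u) :> R * R.
  by move=> [->//|->]; rewrite -[LHS]dirD2pi; congr dir; ring.
have inner w' t : same_vertex w w' -> open_arc (a w') (tile_angle P w') t ->
    interior (region (lift (sw w'))) (v + r *: dir t).
  move=> ww' [tI tA]; have [_ _ _ reg off] := Ha w'.
  have [u uI tE] : exists2 u, 0 < u < tile_angle P w' & t = a w' + u \/ t = a w' + u - 2 * pi.
    case: tA => h; [exists (t - a w'); [lra|left; ring]|exists (t - a w' + 2 * pi); [|right; ring]].
    by have := aI w'; lra.
  have b2 := bI w'.
  apply: region_interior.
    apply/(tr _ _ ww'); rewrite (dirE _ _ _ tE); apply/(reg _ u (rI w')); first lra.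
    by case/andP: uI => _ /ltW.
  by move=> /(trb _ _ ww'); rewrite (dirE _ _ _ tE); apply: off.
(* Two corners of one tile of the torus may meet here, but then through different lifts, since the
   vertices of one lift are distinct. *)
have sw_inj w1 w2 : same_vertex w w1 -> same_vertex w w2 -> sw w1 = sw w2 -> w1 = w2.
  case: w1 w2 => [i k] [j l] h1 h2 E; have := Hz _ h1; rewrite -/(sw _) E -(Hz _ h2).
  move=> /(lift_simple _).1 /= kl; case: E => -> _.
  by rewrite kl.
pose s := [seq w' <- index_enum {: 'I_n * 'I_5} | same_vertex w w'].
rewrite -big_filter -/s; apply/eqP; rewrite eq_le; apply/andP; split.
  apply: (open_arcs_disjoint (a := a)) => //; first exact: filter_uniq (index_enum_uniq _).
  move=> w1 w2 t; rewrite !mem_filter => /andP[h1 _] /andP[h2 _] t1 t2.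
  apply: sw_inj => //; apply: contrapT => /eqP ne.
  have [_ _ _ dis] := Ptiling; have := dis _ _ ne.
  move=> /seteqP[sub _]; apply: (sub (v + r *: dir t)).
  by split; exact: inner.
apply: (closed_arcs_cover (a := a)) => // t tI.
have [_ _ cov _] := Ptiling.
have [s1 _ s1x] : (\bigcup_s region (lift s)) (v + r *: dir t) by rewrite cov.
have s1v : region (lift s1) v.
  apply: Hr0 s1x; rewrite addrAC subrr add0r.
  by apply: le_lt_trans rr0; apply: norm_dir; exact: ltW.
have [l lv] : exists l, lift s1 l = v.
  have := @vertex_of_tile (w.1, (0, 0)) w.2 s1; rewrite lift0 -/v; exact.
pose w' := (s1.1, l) : 'I_n * 'I_5.
have ww' : same_vertex w w' by apply/asboolP; exists s1.2; rewrite /=; case: (s1) lv.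
have sws1 : sw w' = s1.
  have := Hz _ ww'; rewrite -lv lift_tileE [in RHS]lift_tileE /translate /= => /addrI /lattice_vec_inj zE.
  by rewrite /sw zE -surjective_pairing.
exists w'; first by rewrite mem_filter ww' mem_index_enum.
split => //.
have [u uI uE] := @polar_from R (a w') 1 (r *: dir t) sign1.
rewrite enorm_dir ?(ltW rp)// mul1r in uE.
(* Both [t] and [a w'] are reduced modulo a full turn, so at most one turn separates [t] from
   [a w' + u]. *)
have tu : t = a w' + u \/ t = a w' + u - 2 * pi.
  move/(scalerI (lt0r_neq0 rp)): uE => uE; have aw := aI w'.
  have c : cos (t - (a w' + u)) = 1.
    by have := dot_dir 0 t (a w' + u); rewrite !add0r -uE => <-; have := dot_dir 0 t t; rewrite add0r subrr cos0.
  have [h|h] := ltP (a w' + u - t) (2 * pi).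
    left; apply/eqP; rewrite -subr_eq0; apply/eqP; apply: cos_eq1 => //; lra.
  right; have : t - (a w' + u) + 2 * pi = 0; last lra.
  by apply: cos_eq1; [lra|rewrite [2 * pi]mulrC mulr_natr cosD2pi].
have [_ _ _ reg _] := Ha w'.
have uA : u <= tile_angle P w'.
  by apply/(reg _ u (rI w') uI); rewrite -(dirE _ _ _ tu); apply/(tr _ _ ww'); rewrite sws1.
have aw := aI w'.
by case: tu => ->; [left|right]; lra.
Qed.

End Vertices.

(** * The interior of a tile beside one of its edges *)

Section Edges.
Context {R : realType}.
Implicit Types (p : pentagon R) (a b u v : R * R).

(** The side is expressed relative to the segment from [a] to [b], whichever tile it belongs to. A
    tile that travels it backwards has the same midpoint and the opposite normal, whence the change
    of sign. *)
Lemma edge_interior p v l a b : simple p -> area (region p) = 1%:E ->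
  edge (translate p v) l = segment a b ->
  exists2 s : R, s = 1 \/ s = -1 & exists2 e, 0 < e & forall t, 0 < t < e ->
    interior (region (translate p v)) (a + 2^-1 *: (b - a) + (s * t) *: perp (b - a)).
Proof.
move=> sp ap E; have [s s1 /(_ l)[hs _]] := orientation sp ap.
have s2 : s ^+ 2 = 1 by case: s1 => ->; rewrite ?sqrrN expr1n.
have zI : 0 < (2^-1 : R) < 1 by lra.
have [e e0 He] := edge_side l sp s2 zI.
have H t : 0 < t < e -> interior (region (translate p v))
    (p l + v + 2^-1 *: (p (ordS l) - p l) + (s * t) *: perp (p (ordS l) - p l)).
  move=> /He[nb rg]; set x := (X in interior _ X).
  have xv : x - v = p l + 2^-1 *: (p (ordS l) - p l) + (s * t) *: perp (p (ordS l) - p l).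
    by apply: plane_eq; rewrite /x /= /GRing.scale/=; ring.
  apply: region_interior; first by apply/region_translate; rewrite xv; apply/rg.
  by move/boundary_translate; rewrite xv.
have [[h1 h2]|[h1 h2]] := segment_ends E.
  exists s => //; exists e => // t /H.
  by rewrite -h1 -h2 /translate opprD addrACA subrr addr0.
exists (- s); first by case: s1 => ->; rewrite ?opprK; [right|left].
exists e => // t /H; congr (interior _ _).
by rewrite -h1 -h2 /translate; apply: plane_eq; rewrite /= /GRing.scale/=; field.
Qed.

Lemma edge_inj p k l : simple p -> edge p k = edge p l -> k = l.
Proof.
move=> [inj _] /segment_ends[[/inj //]|[/inj h1 /inj h2]].
have := ordS5 l; move: h2; rewrite h1.
by case: l {h1} => [[|[|[|[|[|m]]]]] h] // /(congr1 val).
Qed.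

End Edges.

(** * Edges of the torus *)

Section TorusEdges.
Context {R : realType} {n : nat}.
Variables (e1 e2 : R * R) (P : 'I_n -> pentagon R).
Hypothesis Ptiling : torus_tiling e1 e2 P.
Hypothesis Parea : unit_area_tiling P.

Lemma segment_translate (a b c d v : R * R) : segment a b = segment c d ->
  segment (a + v) (b + v) = segment (c + v) (d + v).
Proof. by move=> /segment_ends[[-> ->]//|[-> ->]]; rewrite segment_sym. Qed.

Lemma lattice_vecN z : lattice_vec e1 e2 (- z) = - lattice_vec e1 e2 z.
Proof. by rewrite /lattice_vec /= !mulrNz -opprD. Qed.

Lemma lattice_vecD z z' : lattice_vec e1 e2 (z + z') = lattice_vec e1 e2 z + lattice_vec e1 e2 z'.
Proof. by rewrite /lattice_vec /= !mulrzDr addrACA. Qed.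

Local Notation eqE := (same_edge e1 e2 P).

Lemma same_edgeP f g : reflect (exists z, segment (P g.1 g.2 + lattice_vec e1 e2 z) (P g.1 (ordS g.2) + lattice_vec e1 e2 z) = segment (P f.1 f.2) (P f.1 (ordS f.2))) (eqE f g).
Proof. exact: asboolP. Qed.

Lemma same_edge_refl f : eqE f f.
Proof. by apply/same_edgeP; exists (0, 0); rewrite lattice_vec0 !addr0. Qed.

Lemma same_edge_sym f g : eqE f g -> eqE g f.
Proof.
move=> /same_edgeP[z /(@segment_translate _ _ _ _ (- lattice_vec e1 e2 z))].
by rewrite !addrK => E; apply/same_edgeP; exists (- z); rewrite lattice_vecN -E.
Qed.

Lemma same_edge_trans f g h : eqE f g -> eqE g h -> eqE f h.
Proof.
move=> /same_edgeP[z Ez] /same_edgeP[w /(@segment_translate _ _ _ _ (lattice_vec e1 e2 z)) Ew].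
by apply/same_edgeP; exists (w + z); rewrite lattice_vecD !(addrA _ (lattice_vec e1 e2 w)) Ew.
Qed.

Lemma same_edge_equivalence : {in [set: 'I_n * 'I_5]%SET & &, equivalence_rel eqE}.
Proof.
move=> f g h _ _ _; split=> [|fg]; first exact: same_edge_refl.
by apply/idP/idP => [/(same_edge_trans (same_edge_sym fg))|/(same_edge_trans fg)].
Qed.

Lemma same_edge_length f g : eqE f g -> edge_length (P f.1) f.2 = edge_length (P g.1) g.2.
Proof.
move=> /same_edgeP[z /segment_ends E]; rewrite /edge_length /dist.
have : P g.1 (ordS g.2) + lattice_vec e1 e2 z - (P g.1 g.2 + lattice_vec e1 e2 z) = P g.1 (ordS g.2) - P g.1 g.2.
  by rewrite opprD addrACA subrr addr0.
by case: E => -[-> ->] <- //; rewrite -opprB enormN.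
Qed.

(** An edge has two sides. Of three tile edges along the same segment, two would have their
    interiors on the same side, and these interiors would overlap. *)
Lemma same_edge_card f : (#|[set g | eqE f g]%SET| <= 2)%N.
Proof.
rewrite leqNgt; apply/negP => /card_gt2P[g1 [g2 [g3 [[m1 m2 m3] [n12 n23 n31]]]]].
have [_ sP _ dis] := Ptiling.
move: m1 m2 m3; rewrite !inE => -[z1 E1] [z2 E2] [z3 E3].
have lift_neq g g' z z' : g != g' ->
    edge (lift_tile e1 e2 P (g.1, z)) g.2 = edge (lift_tile e1 e2 P (g'.1, z')) g'.2 ->
    (g.1, z) != (g'.1, z').
  case: g g' => [i k] [j l] /= ne E; apply: contra_neq ne => -[ij zz].
  rewrite ij zz in E *; congr (_, _); apply: edge_inj E.
  by apply: simple_translate (sP j).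
have int g z (E : edge (lift_tile e1 e2 P (g.1, z)) g.2 = segment (P f.1 f.2) (P f.1 (ordS f.2))) :=
  edge_interior (sP g.1) (Parea g.1) (E : edge (translate (P g.1) (lattice_vec e1 e2 z)) g.2 = _).
have clash g g' z z' (s : R) :
    edge (lift_tile e1 e2 P (g.1, z)) g.2 = segment (P f.1 f.2) (P f.1 (ordS f.2)) ->
    edge (lift_tile e1 e2 P (g'.1, z')) g'.2 = segment (P f.1 f.2) (P f.1 (ordS f.2)) ->
    g != g' ->
    (exists2 e, 0 < e & forall t, 0 < t < e -> interior (region (lift_tile e1 e2 P (g.1, z)))
        (P f.1 f.2 + 2^-1 *: (P f.1 (ordS f.2) - P f.1 f.2) + (s * t) *: perp (P f.1 (ordS f.2) - P f.1 f.2))) ->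
    (exists2 e, 0 < e & forall t, 0 < t < e -> interior (region (lift_tile e1 e2 P (g'.1, z')))
        (P f.1 f.2 + 2^-1 *: (P f.1 (ordS f.2) - P f.1 f.2) + (s * t) *: perp (P f.1 (ordS f.2) - P f.1 f.2))) ->
    False.
  move=> E E' ne [e e0 He] [e' e'0 He'].
  have ne' : (g.1, z) != (g'.1, z') by apply: lift_neq => //; rewrite E E'.
  have /seteqP[sub _] := dis _ _ ne'.
  pose t := Num.min e e' / 2.
  have h1 : Num.min e e' <= e by rewrite ge_min lexx.
  have h2 : Num.min e e' <= e' by rewrite ge_min lexx orbT.
  have h3 : 0 < Num.min e e' by rewrite lt_min e0.
  apply: (sub (P f.1 f.2 + 2^-1 *: (P f.1 (ordS f.2) - P f.1 f.2) +
    (s * t) *: perp (P f.1 (ordS f.2) - P f.1 f.2))); split; [apply: (He t)|apply: (He' t)]; rewrite /t; lra.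
have [s1 h1 H1] := int _ _ E1; have [s2 h2 H2] := int _ _ E2; have [s3 h3 H3] := int _ _ E3.
case: h1 H1 h2 H2 h3 H3 => -> H1 [] -> H2 [] -> H3;
  by [exact: clash E1 E2 n12 H1 H2|exact: clash E2 E3 n23 H2 H3|exact: clash E3 E1 n31 H3 H1].
Qed.

Lemma sum_perimeter_le : \sum_i perimeter (P i) <= 2 * tiling_perimeter e1 e2 P.
Proof.
rewrite /perimeter pair_bigA /= /tiling_perimeter.
have part := equivalence_partitionP same_edge_equivalence.
set Q := equivalence_partition _ _ in part *.
have tr := transversalP part; set X := transversal _ _ in tr *.
have EQ := pblock_transversal tr.
rewrite (eq_bigl (fun e => e \in finset.cover Q)); last by move=> e; rewrite (cover_partition part) finset.in_setT.
rewrite (finset.big_trivIset _ (partition_trivIset part)) /= -EQ.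
rewrite (big_imset _ (pblock_inj tr)) /= mulr_sumr; apply: ler_sum => x _.
rewrite (eq_bigr (fun=> edge_length (P x.1) x.2)); last first.
  move=> y; rewrite pblock_equivalence_partition ?finset.in_setT//; last exact: same_edge_equivalence.
  by move=> /same_edge_length ->.
rewrite sumr_const -[X in X <= _]mulr_natl ler_wpM2r ?dist_ge0// ler_nat.
apply: leq_trans (same_edge_card x); apply: subset_leq_card; apply/fintype.subsetP => y.
by rewrite pblock_equivalence_partition ?finset.in_setT ?finset.in_set//; exact: same_edge_equivalence.
Qed.

End TorusEdges.

(** * Tangents to a circle *)

Section Tangents.
Context {R : realType}.
Implicit Types (p : pentagon R) (u w m q : R * R).

(* Two tangents from the origin, of lengths [a |u|] and [b |w|], to the circle of
   centre [q] and radius [r], enclosing the angle of cosine [C]. *)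
Lemma tangent_corner u w m m' q (a b r C : R) : 0 < r -> -1 < C < 1 -> 0 <= a -> 0 <= b ->
  dot m m = r ^+ 2 -> dot m' m' = r ^+ 2 -> dot m u = 0 -> dot m' w = 0 ->
  u != 0 -> w != 0 -> q + m = a *: u -> q + m' = b *: w ->
  dot u w = enorm u * enorm w * C ->
  [/\ dot m m' = - C * r ^+ 2, (a * enorm u) ^+ 2 * (1 - C) = r ^+ 2 * (1 + C) &
      (b * enorm w) ^+ 2 * (1 - C) = r ^+ 2 * (1 + C)].
Proof.
move=> r0 CI a0 b0 mm mm' mu0 mw0 u0 w0 qm qm' uw.
have q1 : dot m q = - r ^+ 2.
  by have := congr1 (dot m) qm; rewrite dotDr dotZr mu0 mulr0 mm => /eqP; rewrite addr_eq0 => /eqP.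
have q2 : dot m' q = - r ^+ 2.
  by have := congr1 (dot m') qm'; rewrite dotDr dotZr mw0 mulr0 mm' => /eqP; rewrite addr_eq0 => /eqP.
(* The power of the origin with respect to the circle, that is, the square of both tangent
   lengths. *)
set D := dot q q - r ^+ 2.
have dZ v (c : R) : dot (c *: v) (c *: v) = c ^+ 2 * dot v v by rewrite /dot/= /GRing.scale/=; ring.
have eD : (a * enorm u) ^+ 2 = D.
  rewrite exprMn sqr_enorm -dZ -qm /D.
  rewrite (_ : dot (q + m) (q + m) = dot q q + 2 * dot m q + dot m m); last by rewrite /dot/=; ring.
  by rewrite q1 mm; ring.
have eD' : (b * enorm w) ^+ 2 = D.
  rewrite exprMn sqr_enorm -dZ -qm' /D.
  rewrite (_ : dot (q + m') (q + m') = dot q q + 2 * dot m' q + dot m' m'); last by rewrite /dot/=; ring.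
  by rewrite q2 mm'; ring.
have ab : a * enorm u = b * enorm w.
  apply/eqP; rewrite -(@eqrXn2 _ 2) ?mulr_ge0 ?enorm_ge0//; first by rewrite eD eD'.
have CD : C * D = D - r ^+ 2 + dot m m'.
  have -> : C * D = a * b * dot u w.
    by rewrite -eD expr2 {2}ab uw; ring.
  have -> : a * b * dot u w = dot (q + m) (q + m').
    by rewrite qm qm' /dot/= /GRing.scale/=; ring.
  rewrite (_ : dot (q + m) (q + m') = dot q q + dot m q + dot m' q + dot m m'); last by rewrite /dot/=; ring.
  by rewrite q1 q2 /D; ring.
(* The Gram determinant of the three plane vectors [m], [m'], [q] vanishes. *)
have gram : (D + r ^+ 2) * (r ^+ 2 * r ^+ 2 - dot m m' ^+ 2) = 2 * (r ^+ 2 * r ^+ 2) * (r ^+ 2 - dot m m').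
  have : dot q q * (dot m m * dot m' m' - dot m m' ^+ 2) =
    dot m q ^+ 2 * dot m' m' + dot m' q ^+ 2 * dot m m - 2 * dot m q * dot m' q * dot m m'.
    by rewrite /dot; ring.
  by rewrite mm mm' q1 q2 /D subrK => ->; ring.
(* Otherwise the origin is on the circle, both tangents are the tangent there, and [C] would be 1 or
   -1. *)
have D0 : D != 0.
  apply/eqP => DE; have a00 : a = 0.
    move/eqP: eD; rewrite DE sqrf_eq0 mulf_eq0 => /orP[/eqP//|].
    by rewrite gt_eqF// enorm_gt0.
  have b00 : b = 0.
    move/eqP: eD'; rewrite DE sqrf_eq0 mulf_eq0 => /orP[/eqP//|].
    by rewrite gt_eqF// enorm_gt0.
  have mE : m' = m.
    by apply: (addrI q); rewrite qm qm' a00 b00 !scale0r.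
  have : dot m m * cross u w = 0.
    rewrite (_ : _ * _ = dot m u * cross m w - dot m w * cross m u); last by rewrite /dot /cross; ring.
    by rewrite mu0 -mE mw0 !mul0r subr0.
  move=> /eqP; rewrite mulf_eq0 mm sqrf_eq0 gt_eqF//= => /eqP cr.
  have := cross_dot u w; rewrite cr uw !exprMn expr0n add0r.
  have u1 : 0 < enorm u ^+ 2 by rewrite exprn_gt0// enorm_gt0.
  have w1 : 0 < enorm w ^+ 2 by rewrite exprn_gt0// enorm_gt0.
  rewrite -[RHS]mulr1; move/mulfI => H.
  have : C ^+ 2 = 1 by apply: H; rewrite mulf_neq0// gt_eqF.
  by move=> C2; have : 0 < (1 - C) * (1 + C) by [apply: mulr_gt0; clear -CI; lra]; clear -C2; nra.
have r2 : 0 < r ^+ 2 by rewrite exprn_gt0.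
have E : (1 - C) * D = r ^+ 2 * (1 + C).
  have ME : dot m m' = r ^+ 2 - (1 - C) * D by rewrite mulrBl mul1r CD; ring.
  have C1 : 1 - C != 0 by rewrite gt_eqF//; lra.
  apply: (mulfI D0); apply: (mulfI D0); apply: (mulfI C1).
  move: gram; rewrite ME => gram; clear -gram.
  by move: (r ^+ 2) gram => s; lra.
split; first by have : dot m m' = r ^+ 2 - (1 - C) * D by [rewrite mulrBl mul1r CD; ring]; lra.
  by rewrite eD mulrC.
by rewrite eD' mulrC.
Qed.

End Tangents.

(** * Area of a house-shaped pentagon *)

Section House.
Context {R : realType}.
Implicit Types (p : pentagon R) (u w m q a f c x : R * R).

Lemma area_union3 (A B C S : set (R * R)) :
  measurable A -> measurable B -> measurable C ->
  A `&` B = set0 -> A `&` C = set0 -> B `&` C = set0 ->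
  A `<=` S -> B `<=` S -> C `<=` S -> (area A + area B + area C <= area S)%E.
Proof.
move=> mA mB mC AB AC BC AS BS CS.
have -> : (area A + area B + area C)%E = area (A `|` B `|` C).
  rewrite /area measureU//; first by rewrite measureU.
    exact: measurableU.
  by rewrite setIUl AC BC setU0.
by apply: le_area => x [[/AS|/BS]|/CS].
Qed.

Lemma barycenter_lt (y0 y1 y2 s t h : R) : 0 < s -> 0 < t -> s + t < 1 ->
  y0 <= h -> y1 <= h -> y2 <= h -> y0 < h \/ y1 < h \/ y2 < h ->
  y0 + s * (y1 - y0) + t * (y2 - y0) < h.
Proof.
move=> s0 t0 st h0 h1 h2 H.
have k0 : 0 <= (1 - s - t) * (h - y0) by apply: mulr_ge0; lra.
have k1 : 0 <= s * (h - y1) by apply: mulr_ge0; lra.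
have k2 : 0 <= t * (h - y2) by apply: mulr_ge0; lra.
suff : 0 < (1 - s - t) * (h - y0) + s * (h - y1) + t * (h - y2) by lra.
case: H => [h'|[h'|h']].
- by have : 0 < (1 - s - t) * (h - y0) by [apply: mulr_gt0; lra]; lra.
- by have : 0 < s * (h - y1) by [apply: mulr_gt0; lra]; lra.
- by have : 0 < t * (h - y2) by [apply: mulr_gt0; lra]; lra.
Qed.

(* The area of the Prismatic pentagon of inradius [r]: a house of half-width
   [r], with its floor at [X = r] and a roof descending at 60 degrees from the axis. *)
Lemma house_area c a f (r : R) (A : set (R * R)) : 0 < r ->
  dot a a = 1 -> dot f f = 1 -> dot a f = 0 ->
  (forall X Y, X < r -> -r < Y < r ->
     - Num.sqrt 3 * X + Y < 2 * r -> - Num.sqrt 3 * X - Y < 2 * r -> A (c + X *: a + Y *: f)) ->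
  ((r ^+ 2 * (2 + Num.sqrt 3))%:E <= area A)%E.
Proof.
move=> r0 aa ff af HA; set s := Num.sqrt 3 in HA *.
have s0 : 0 < s by rewrite sqrtr_gt0.
have s2 : s * s = 3 by rewrite -expr2 sqr_sqrtr.
clearbody s.
(* With [g = r / sqrt 3] the eaves are at [X = - g] and the ridge at [X = - 2 * g]. *)
have [g g0 sg] : exists2 g, 0 < g & s * g = r.
  by exists (r / s); [rewrite divr_gt0|rewrite mulrCA divff ?mulr1// gt_eqF].
pose pt X Y := c + X *: a + Y *: f.
have ptX X Y : dot a (pt X Y - c) = X.
  rewrite (_ : dot _ _ = X * dot a a + Y * dot a f); first by rewrite aa af mulr1 mulr0 addr0.
  by rewrite /dot /pt/= /GRing.scale/=; ring.
have ptY X Y : dot f (pt X Y - c) = Y.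
  rewrite (_ : dot _ _ = X * dot a f + Y * dot f f); first by rewrite ff af mulr1 mulr0 add0r.
  by rewrite /dot /pt/= /GRing.scale/=; ring.
have cr : `|cross a f| = 1.
  have := cross_dot a f; rewrite af !sqr_enorm aa ff expr0n addr0 mulr1 => /eqP.
  by rewrite sqrf_eq1 => /orP[] /eqP ->; rewrite ?normrN normr1.
have crE X0 Y0 X1 Y1 X2 Y2 : `|cross (pt X1 Y1 - pt X0 Y0) (pt X2 Y2 - pt X0 Y0)| / 2 =
    `|(X1 - X0) * (Y2 - Y0) - (Y1 - Y0) * (X2 - X0)| / 2.
  have -> : cross (pt X1 Y1 - pt X0 Y0) (pt X2 Y2 - pt X0 Y0) =
      ((X1 - X0) * (Y2 - Y0) - (Y1 - Y0) * (X2 - X0)) * cross a f.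
    by rewrite /cross /pt /= /GRing.scale/=; ring.
  by rewrite normrM cr mulr1.
have triE X0 Y0 X1 Y1 X2 Y2 x : open_triangle (pt X0 Y0) (pt X1 Y1) (pt X2 Y2) x ->
    exists2 st : R * R, [/\ 0 < st.1, 0 < st.2 & st.1 + st.2 < 1] &
    x = pt (X0 + st.1 * (X1 - X0) + st.2 * (X2 - X0)) (Y0 + st.1 * (Y1 - Y0) + st.2 * (Y2 - Y0)).
  move=> [k [t [k0 t0 kt ->]]]; exists (k, t) => //.
  by apply: plane_eq; rewrite /pt /= /GRing.scale/=; ring.
have triA X0 Y0 X1 Y1 X2 Y2 :
    let ok X Y := [/\ X <= r, -r <= Y, Y <= r, - s * X + Y <= 2 * r & - s * X - Y <= 2 * r] in
    ok X0 Y0 -> ok X1 Y1 -> ok X2 Y2 ->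
    X0 < r \/ X1 < r \/ X2 < r ->
    - Y0 < r \/ - Y1 < r \/ - Y2 < r -> Y0 < r \/ Y1 < r \/ Y2 < r ->
    - s * X0 + Y0 < 2 * r \/ - s * X1 + Y1 < 2 * r \/ - s * X2 + Y2 < 2 * r ->
    - s * X0 - Y0 < 2 * r \/ - s * X1 - Y1 < 2 * r \/ - s * X2 - Y2 < 2 * r ->
    open_triangle (pt X0 Y0) (pt X1 Y1) (pt X2 Y2) `<=` A.
  move=> ok [a0 b0 c0 d0 e0] [a1 b1 c1 d1 e1] [a2 b2 c2 d2 e2] h1 h2 h3 h4 h5 x.
  move=> /triE[[k t] /= [k0 t0 kt] ->]; apply: HA.
  - exact: barycenter_lt.
  - have : - Y0 + k * (- Y1 - - Y0) + t * (- Y2 - - Y0) < r by apply: barycenter_lt => //; clear -b0 b1 b2 h2; lra.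
    have : Y0 + k * (Y1 - Y0) + t * (Y2 - Y0) < r by apply: barycenter_lt.
    by clear; lra.
  - by have := barycenter_lt k0 t0 kt d0 d1 d2 h4; clear; lra.
  - by have := barycenter_lt k0 t0 kt e0 e1 e2 h5; clear; lra.
(* The walls form a rectangle, cut along a diagonal into two triangles, and the third triangle is
   the roof. The total is [2 * r * (r + g) + r * g], and [3 * g = sqrt 3 * r]. *)
have [A1 [mA1 sA1 aA1]] := open_triangle_core (pt r r) (pt r (- r)) (pt (- g) r).
have [A2 [mA2 sA2 aA2]] := open_triangle_core (pt r (- r)) (pt (- g) (- r)) (pt (- g) r).
have [A3 [mA3 sA3 aA3]] := open_triangle_core (pt (- g) r) (pt (- g) (- r)) (pt (- 2 * g) 0).
have rg : 0 < r * g by rewrite mulr_gt0.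
have sr : 0 < s * r by rewrite mulr_gt0.
have rr : 0 < r * r by rewrite mulr_gt0.
rewrite crE in aA1; rewrite crE in aA2; rewrite crE in aA3.
have : (((r * (r + g))%:E + (r * (r + g))%:E + (r * g)%:E)%E <= area A)%E.
  apply: le_trans (area_union3 mA1 mA2 mA3 _ _ _ _ _ _).
  - apply: leeD; [apply: leeD|].
    + apply: le_trans aA1; rewrite lee_fin -normrN ger0_norm; [|clear -rg rr; nra]; clear -rg rr; nra.
    + apply: le_trans aA2; rewrite lee_fin -normrN ger0_norm; [|clear -rg rr; nra]; clear -rg rr; nra.
    + apply: le_trans aA3; rewrite lee_fin -normrN ger0_norm; [|clear -rg rr; nra]; clear -rg rr; nra.
  - apply/seteqP; split => // x [/sA1 /triE[[k t] /= [k0 t0 kt] ->]].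
    move=> /sA2 /triE[[k' t'] /= [k'0 t'0 k't']] E.
    have := congr1 (fun x => dot a (x - c)) E; have := congr1 (fun x => dot f (x - c)) E.
    rewrite /= !ptX !ptY => EY EX.
    have /(mulfI (lt0r_neq0 r0)) h1 : r * (1 - k) = r * t' by clear -EY; lra.
    have rg0 : r + g != 0 by rewrite gt_eqF//; clear -r0 g0; lra.
    have /(mulfI rg0) h2 : (r + g) * t = (r + g) * (k' + t') by clear -EX; lra.
    by clear -h1 h2 kt k'0; lra.
  - apply/seteqP; split => // x [/sA1 /triE[[k t] /= [k0 t0 kt] ->]].
    move=> /sA3 /triE[[k' t'] /= [k'0 t'0 k't']] E.
    have := congr1 (fun x => dot a (x - c)) E; rewrite /= !ptX => EX.
    have h1 : 0 < (1 - t) * (r + g) by apply: mulr_gt0; clear -r0 g0 k0 t0 kt; lra.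
    have h2 : 0 < t' * g by apply: mulr_gt0.
    by clear -h1 h2 EX; lra.
  - apply/seteqP; split => // x [/sA2 /triE[[k t] /= [k0 t0 kt] ->]].
    move=> /sA3 /triE[[k' t'] /= [k'0 t'0 k't']] E.
    have := congr1 (fun x => dot a (x - c)) E; rewrite /= !ptX => EX.
    have h1 : 0 < (1 - k - t) * (r + g) by apply: mulr_gt0; clear -r0 g0 k0 t0 kt; lra.
    have h2 : 0 < t' * g by apply: mulr_gt0.
    by clear -h1 h2 EX; lra.
  - apply: subset_trans sA1 _; apply: triA; clear -r0 g0 s0 sg sr; rewrite ?mulNr; try split; lra.
  - apply: subset_trans sA2 _; apply: triA; clear -r0 g0 s0 sg sr; rewrite ?mulNr; try split; lra.
  - apply: subset_trans sA3 _; apply: triA; clear -r0 g0 s0 sg sr; rewrite ?mulNr; try split; lra.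
rewrite -!EFinD; congr (_ <= _)%E; congr EFin.
have -> : r * (r + g) + r * (r + g) + r * g = 2 * r ^+ 2 + r * (3 * g) by ring.
by rewrite -s2 -mulrA sg; ring.
Qed.

End House.

(** * Circumscribed pentagons *)

Section Prismatic.
Context {R : realType}.
Implicit Types (p q : pentagon R) (u w m a f c x : R * R).

Lemma cyclic_forall (Q : 'I_5 -> Prop) k : Q k -> Q (ordS k) -> Q (ordS (ordS k)) ->
  Q (ordS (ordS (ordS k))) -> Q (ord_pred k) -> forall j, Q j.
Proof.
rewrite ord_predE => h0 h1 h2 h3 h4 j.
have : j \in [:: k; ordS k; ordS (ordS k); ordS (ordS (ordS k)); ordS (ordS (ordS (ordS k)))].
  by case: k j {h0 h1 h2 h3 h4} => [[|[|[|[|[|k]]]]] hk] [[|[|[|[|[|j]]]]] hj].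
by rewrite !inE => /orP[|/orP[|/orP[|/orP[]]]] /eqP ->.
Qed.

Lemma angle_dot p k : simple p -> angle p k < pi ->
  dot (p (ordS k) - p k) (p (ord_pred k) - p k) =
  dist (p k) (p (ordS k)) * dist (p k) (p (ord_pred k)) * cos (angle p k).
Proof.
move=> sp ap; have [cI _ ->] := cos_corner k sp; congr (_ * cos _).
by move: ap; rewrite /angle; case: ifP => // _; lra.
Qed.

Lemma incircle_data q : circumscribed q -> exists c (r : R) (tau : 'I_5 -> R),
  [/\ 0 < r, region q c, forall k, 0 <= tau k <= 1 &
    forall k, let m := q k + tau k *: (q (ordS k) - q k) - c in
      dot m m = r ^+ 2 /\ dot m (q (ordS k) - q k) = 0].
Proof.
move=> [c [r [r0 disk tan]]]; exists c, r.
have H k : exists t, 0 <= t <= 1 /\ (let m := q k + t *: (q (ordS k) - q k) - c in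
    dot m m = r ^+ 2 /\ dot m (q (ordS k) - q k) = 0).
  have [x [/edgeE[t tI ->] dr d0]] := tan k; exists t; split => //; split => //.
  by rewrite -sqr_enorm -/(dist _ _) dr.
have [tau Ht] := choice H; exists tau; split => //.
- by apply: disk; rewrite /= /dist subrr -(scale0r (0 : R * R)) /enorm dotZr mul0r sqrtr0 ltW.
- by move=> k; have [] := Ht k.
- by move=> k; have [] := Ht k.
Qed.

(** The segment from [x] to the centre stays strictly on the inner side of all the edge lines, hence
    misses the boundary. *)
Lemma incircle_half_planes q c (r : R) (m : 'I_5 -> R * R) x : 0 < r -> region q c ->
  (forall k, exists t : R, m k = q k + t *: (q (ordS k) - q k) - c) ->
  (forall k, dot (m k) (m k) = r ^+ 2 /\ dot (m k) (q (ordS k) - q k) = 0) ->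
  (forall k, dot (m k) (x - c) < r ^+ 2) -> region q x.
Proof.
move=> r0 qc mE mm Hx; apply/region_segment; last exact: qc.
move=> z; rewrite segment_sym segmentE => -[s /=]; rewrite in_itv/= => /andP[s0 s1] <-.
move=> [k _ /edgeE[t tI E]]; have [t' mk] := mE k; have [h1 h2] := mm k.
have : dot (m k) (s *: (x - c)) = r ^+ 2.
  have -> : s *: (x - c) = m k + (t - t') *: (q (ordS k) - q k).
    rewrite -[LHS](addKr c) E mk; apply: plane_eq; rewrite /= /GRing.scale/=; ring.
  by rewrite dotDr dotZr h1 h2 mulr0 addr0.
rewrite dotZr; have := Hx k; have : 0 < r ^+ 2 by rewrite exprn_gt0.
move: (dot _ _) (r ^+ 2) => D r2 r20 Dr H.
have [s00|s00] := eqVneq s 0; first by move: H; rewrite s00 mul0r; lra.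
have sp : 0 < s by rewrite lt0r s00.
have : 0 < s * (r2 - D) by rewrite mulr_gt0// subr_gt0.
have : 0 <= (1 - s) * r2 by rewrite mulr_ge0 ?subr_ge0// ltW.
by lra.
Qed.

(** Both tangent lengths at the vertex are [r] times the cotangent of half the angle, written with
    squares. *)
Lemma incircle_corner q c (r : R) (tau : 'I_5 -> R) k : simple q -> 0 < r ->
  (forall k, 0 <= tau k <= 1) ->
  let m k := q k + tau k *: (q (ordS k) - q k) - c in
  (forall k, dot (m k) (m k) = r ^+ 2 /\ dot (m k) (q (ordS k) - q k) = 0) ->
  angle q k < pi -> -1 < cos (angle q k) < 1 ->
  [/\ dot (m k) (m (ord_pred k)) = - cos (angle q k) * r ^+ 2,
      (tau k * edge_length q k) ^+ 2 * (1 - cos (angle q k)) = r ^+ 2 * (1 + cos (angle q k)) &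
      ((1 - tau (ord_pred k)) * edge_length q (ord_pred k)) ^+ 2 * (1 - cos (angle q k)) =
        r ^+ 2 * (1 + cos (angle q k))].
Proof.
move=> sq r0 tI m mm aI cI.
have [h1 h2] := mm k; have [] := mm (ord_pred k); rewrite ord_predK => h1' h2'.
have -> : edge_length q (ord_pred k) = enorm (q (ord_pred k) - q k).
  by rewrite /edge_length ord_predK distC.
apply: (@tangent_corner _ _ _ _ _ (c - q k)) => //.
- by have /andP[] := tI k.
- by have /andP[] := tI (ord_pred k); lra.
- apply/eqP; rewrite -oppr_eq0; apply/eqP; rewrite -[RHS]h2' -/(m (ord_pred k)).
  by move: (m _) => v; rewrite /dot/=; ring.
- exact: edge_neq0.
- exact: edge_prev_neq0.
- by apply: plane_eq; rewrite /m /= /GRing.scale/=; ring.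
- by rewrite /m ord_predK; apply: plane_eq; rewrite /= /GRing.scale/=; ring.
- by rewrite angle_dot.
Qed.

End Prismatic.

(** * Perimeter of the Prismatic pentagon *)

Section PrismaticPerimeter.
Context {R : realType}.
Implicit Types (p q : pentagon R) (u w v m a f c x : R * R).

Lemma orthonormal_dot a f v w : dot a a = 1 -> dot f f = 1 -> dot a f = 0 ->
  dot v w = dot a v * dot a w + dot f v * dot f w.
Proof.
move=> aa ff af; have : dot v w * (dot a a * dot f f - dot a f ^+ 2) =
  dot a v * dot a w * dot f f + dot f v * dot f w * dot a a -
  dot a f * (dot a v * dot f w + dot a w * dot f v) by rewrite /dot; ring.
by rewrite aa ff af expr0n subr0 !mulr1 mul0r subr0.
Qed.

Lemma sqr_solution (A r h C d : R) : 0 <= A -> 0 <= h -> C < 1 ->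
  A ^+ 2 * (1 - C) = r ^+ 2 * (1 + C) -> h ^+ 2 * (1 - C) = r ^+ 2 * (1 + C) -> A = h.
Proof.
move=> A0 h0 C1 E1 E2; apply/eqP; rewrite -(@eqrXn2 _ 2)//; apply/eqP.
have C0 : 1 - C != 0 by rewrite subr_eq0 gt_eqF.
by apply: (mulIf C0); rewrite E1.
Qed.

(** These are the unit normals of the sides in cyclic order, [a] that of the floor and [f] and [n4]
    those of the walls. The products of neighbours determine the shape up to the sign of
    [dot a n2]. *)
Lemma house_frame (a f n2 n3 n4 : R * R) :
  dot a a = 1 -> dot f f = 1 -> dot n2 n2 = 1 -> dot n3 n3 = 1 -> dot n4 n4 = 1 ->
  dot f a = 0 -> dot n2 f = 2^-1 -> dot n3 n2 = 2^-1 -> dot n4 n3 = 2^-1 -> dot a n4 = 0 ->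
  [/\ dot f n4 = -1, dot f n2 = 2^-1, dot f n3 = - 2^-1, dot a n3 = dot a n2 & dot a n2 ^+ 2 = 3 / 4].
Proof.
move=> aa ff n22 n33 n44 fa n2f n32 n43 an4.
have dC v w : dot v w = dot w v by rewrite /dot; ring.
have af : dot a f = 0 by rewrite dC.
have e v w := orthonormal_dot v w aa ff af.
have fn2 : dot f n2 = 2^-1 by rewrite dC.
move: (e n2 n2) (e n3 n3) (e n4 n4) (e n3 n2) (e n4 n3); rewrite n22 n33 n44 n32 n43 an4 fn2.
move: (dot a n2) (dot a n3) (dot f n3) (dot f n4) => x y z w.
clear; move=> h1 h2 h3 h4 h5.
have w2 : (w - 1) * (w + 1) = 0 by lra.
have /eqP := w2; rewrite mulf_eq0 => /orP[/eqP w1|/eqP w1].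
  have wE : w = 1 by lra.
  have z1 : z = 2^-1 by move: h5; rewrite wE; lra.
  have xy : x * y = 4^-1 by move: h4; rewrite z1; lra.
  have yy : y * y = 3 / 4 by move: h2; rewrite z1; lra.
  have xx : x * x = 3 / 4 by lra.
  have : (x * y) * (x * y) = (x * x) * (y * y) by ring.
  by rewrite xy xx yy; lra.
have wE : w = -1 by lra.
have z1 : z = - 2^-1 by move: h5; rewrite wE; lra.
have xy : x * y = 3 / 4 by move: h4; rewrite z1; lra.
have yy : y * y = 3 / 4 by move: h2; rewrite z1; lra.
have xx : x * x = 3 / 4 by lra.
have : (y - x) ^+ 2 = 0 by lra.
move=> /eqP; rewrite sqrf_eq0 subr_eq0 => /eqP yx.
by split => //; rewrite ?expr2.
Qed.

(** With inradius [r] the perimeter is [2 * r * (2 + sqrt 3)], while the house inside the region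
    gives [r ^+ 2 * (2 + sqrt 3) <= 1]. An upper bound is what the comparison needs. *)
Lemma prismatic_perimeter q : prismatic q -> area (region q) = 1%:E ->
  perimeter q <= 2 * Num.sqrt (2 + Num.sqrt 3).
Proof.
move=> [sq circ [k' [l' [adj ra]]]] aq.
have [k [ak ak1 ao]] : exists k, [/\ angle q k = pi / 2, angle q (ordS k) = pi / 2 &
    forall j, j != k -> j != ordS k -> angle q j = 2 * pi / 3].
  have [kl h1 h2 h3] := ra; case/orP: adj => /eqP E.
    by exists k'; split => //; rewrite -E.
  by exists l'; split => //; [rewrite -E|move=> m h4 h5; apply: h3 => //; rewrite E].
set k0 := k in ak; set k1 := ordS k in ak1 ao; pose k2 := ordS k1; pose k3 := ordS k2; pose k4 := ord_pred k.
have Sk4 : ordS k4 = k0 by rewrite /k4 ord_predK.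
have k3E : ordS k3 = k4 by rewrite /k4 ord_predE.
have p1 : ord_pred k1 = k0 by rewrite ordSK.
have p2 : ord_pred k2 = k1 by rewrite ordSK.
have p3 : ord_pred k3 = k2 by rewrite ordSK.
have p4 : ord_pred k4 = k3 by rewrite -k3E ordSK.
have [a2 a3 a4] : [/\ angle q k2 = 2 * pi / 3, angle q k3 = 2 * pi / 3 & angle q k4 = 2 * pi / 3].
  by split; apply: ao; rewrite /k4 ?ord_predE /k3 /k2 /k1; case: (k) => [[|[|[|[|[|]]]]]].
have pi0 := @pi_gt0 R.
have [c [r [tau [r0 qc tI Hm]]]] := incircle_data circ.
pose m k := q k + tau k *: (q (ordS k) - q k) - c.
set s := Num.sqrt 3; have s0 : 0 < s by rewrite sqrtr_gt0.
have s2 : s ^+ 2 = 3 by rewrite sqr_sqrtr.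
have right j : angle q j = pi / 2 -> [/\ dot (m j) (m (ord_pred j)) = 0,
    tau j * edge_length q j = r & (1 - tau (ord_pred j)) * edge_length q (ord_pred j) = r].
  move=> aj; have cj : cos (angle q j) = 0 by rewrite aj cos_pihalf.
  have [||h1 h2 h3] := incircle_corner sq r0 tI Hm (k := j); [by rewrite aj; clear -pi0; lra|by rewrite cj; clear; lra|].
  rewrite cj in h1 h2 h3; have /andP[t0 t1] := tI j; have /andP[t0' t1'] := tI (ord_pred j).
  have rr : r ^+ 2 * (1 - 0) = r ^+ 2 * (1 + 0) by rewrite subr0 addr0.
  split; first by rewrite h1 oppr0 mul0r.
    by apply: sqr_solution h2 rr => //; rewrite ?mulr_ge0 ?dist_ge0 ?(ltW r0).
  by apply: sqr_solution h3 rr => //; rewrite ?mulr_ge0 ?dist_ge0 ?subr_ge0 ?(ltW r0).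
have obtuse j : angle q j = 2 * pi / 3 -> [/\ dot (m j) (m (ord_pred j)) = r ^+ 2 / 2,
    tau j * edge_length q j = r / s & (1 - tau (ord_pred j)) * edge_length q (ord_pred j) = r / s].
  move=> aj; have cj : cos (angle q j) = - (1 / 2) by rewrite aj cos_2pi3.
  have [||h1 h2 h3] := incircle_corner sq r0 tI Hm (k := j); [by rewrite aj; clear -pi0; lra|by rewrite cj; clear; lra|].
  rewrite cj in h1 h2 h3; have /andP[t0 t1] := tI j; have /andP[t0' t1'] := tI (ord_pred j).
  have rs : (r / s) ^+ 2 * (1 - - (1 / 2)) = r ^+ 2 * (1 + - (1 / 2)) by rewrite expr_div_n s2; field.
  have rs0 : 0 <= r / s by rewrite divr_ge0 ?ltW.
  have c1 : - (1 / 2) < 1 :> R by clear; lra.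
  split; first by rewrite h1; field.
    by apply: sqr_solution h2 rs => //; rewrite mulr_ge0 ?dist_ge0.
  by apply: sqr_solution h3 rs => //; rewrite mulr_ge0 ?dist_ge0 ?subr_ge0.
have [m04 A0 B4] := right _ ak; have [m10 A1 B0] := right _ ak1.
have [m21 A2 B1] := obtuse _ a2; have [m32 A3 B2] := obtuse _ a3; have [m43 A4 B3] := obtuse _ a4.
rewrite p1 p2 p3 p4 -/k4 in m04 B4 m10 B0 m21 B1 m32 B2 m43 B3.
(* Four tangents of length [r] at the right angles and six of length [r / sqrt 3] at the others. *)
have perE : perimeter q = 2 * r * (2 + s).
  have sr : r / s = r * s / 3 by rewrite -s2; field; rewrite gt_eqF.
  rewrite sr in A2 A3 A4 B1 B2 B3.
  rewrite /perimeter (cyclic_sum _ k) -/k1 -/k2 -/k3 -/k4 -/k0.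
  by clear -A0 B0 A1 B1 A2 B2 A3 B3 A4 B4; lra.
have mm j : dot (m j) (m j) = r ^+ 2 by have [] := Hm j.
pose N j := r^-1 *: m j.
have rV : r^-1 ^+ 2 * r ^+ 2 = 1 by rewrite -exprMn mulVf ?expr1n// gt_eqF.
have NE i j : dot (N i) (N j) = r^-1 ^+ 2 * dot (m i) (m j) by rewrite /dot /N/= /GRing.scale/=; ring.
have nn j : dot (N j) (N j) = 1 by rewrite NE mm.
have n10 : dot (N k1) (N k0) = 0 by rewrite NE m10 mulr0.
have n04 : dot (N k0) (N k4) = 0 by rewrite NE m04 mulr0.
have half : r^-1 ^+ 2 * (r ^+ 2 / 2) = 2^-1 by rewrite mulrA rV mul1r.
have n21 : dot (N k2) (N k1) = 2^-1 by rewrite NE m21.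
have n32 : dot (N k3) (N k2) = 2^-1 by rewrite NE m32.
have n43 : dot (N k4) (N k3) = 2^-1 by rewrite NE m43.
have [f4 f2 f3 a32 a22] := house_frame (nn _) (nn _) (nn _) (nn _) (nn _) n10 n21 n32 n43 n04.
have inside X Y : (forall j, X * dot (N k0) (N j) + Y * dot (N k1) (N j) < r) ->
    region q (c + X *: N k0 + Y *: N k1).
  move=> H; apply: (incircle_half_planes (m := m) r0 qc) => [j|j|j]; [by exists (tau j)|by split; have [] := Hm j|].
  have -> : dot (m j) (c + X *: N k0 + Y *: N k1 - c) = r * (X * dot (N k0) (N j) + Y * dot (N k1) (N j)).
    have -> : m j = r *: N j by rewrite /N scalerA divff ?scale1r// gt_eqF.
    by rewrite /dot/= /GRing.scale/=; ring.
  by rewrite expr2 ltr_pM2l.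
have n01 : dot (N k0) (N k1) = 0 by rewrite -n10 /dot; ring.
have allk (Q : 'I_5 -> Prop) : Q k0 -> Q k1 -> Q k2 -> Q k3 -> Q k4 -> forall j, Q j := @cyclic_forall Q k.
have x2 : dot (N k0) (N k2) = s / 2 \/ dot (N k0) (N k2) = - (s / 2).
  have /eqP : (dot (N k0) (N k2)) ^+ 2 = (s / 2) ^+ 2 by rewrite a22 expr_div_n s2; field.
  by rewrite eqf_sqr => /orP[] /eqP ->; [left|right].
(* For the other sign the five half-planes would contain a whole ray, opposite to the floor normal,
   but the region is bounded. *)
have xneg : dot (N k0) (N k2) = - (s / 2).
  case: x2 => // x2; exfalso.
  have [M M0 HM] := region_bounded q.
  have N0 : 0 < `|N k0|.
    by rewrite normr_gt0; apply/eqP => E; have /eqP := nn k0; rewrite E /dot/= !mul0r addr0 eq_sym oner_eq0.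
  pose L := (M + `|c| + 1) / `|N k0|.
  have L0 : 0 <= L by rewrite divr_ge0 ?addr_ge0.
  have Ls : 0 <= L * s by rewrite mulr_ge0// ltW.
  have : region q (c + (- L) *: N k0 + 0 *: N k1).
    apply: inside; apply: allk; rewrite ?n04 ?n01 ?nn ?a32 ?x2; clear -L0 Ls r0; lra.
  move=> /HM; rewrite scale0r addr0 leNgt => /negP; apply.
  have := lerB_normD ((- L) *: N k0) c; rewrite [_ + c]addrC.
  have -> : `|(- L) *: N k0| = M + `|c| + 1.
    by rewrite normrZ normrN (ger0_norm L0) /L mulfVK// gt_eqF.
  by clear; lra.
have area_le : r ^+ 2 * (2 + s) <= 1.
  rewrite -lee_fin -aq; apply: (house_area (c := c) r0 (nn k0) (nn k1) n01) => X Y Xr Yr h1 h2.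
  rewrite -/s in h1 h2.
  apply: inside; apply: allk; rewrite ?nn ?n01 ?n10 ?n04 ?a32 ?xneg ?f2 ?f3 ?f4; clear -Xr Yr h1 h2; lra.
have s2p : 0 < 2 + s by rewrite addr_gt0.
have H : (r * (2 + s)) ^+ 2 <= Num.sqrt (2 + s) ^+ 2.
  by rewrite sqr_sqrtr ?(ltW s2p)// exprMn [(2 + s) ^+ 2]expr2 mulrA -[X in _ <= X]mul1r ler_pM2r.
rewrite perE -mulrA ler_pM2l//; move: H.
by rewrite ler_sqr ?nnegrE ?sqrtr_ge0// mulr_ge0 ?(ltW r0) ?(ltW s2p).
Qed.

End PrismaticPerimeter.

(** * Charging the Type 2 pentagons *)

Section Charging.
Context {R : realType} {n : nat}.
Variables (e1 e2 : R * R) (P : 'I_n -> pentagon R).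
Hypothesis Ptiling : torus_tiling e1 e2 P.
Hypothesis Pedge : edge_to_edge e1 e2 P.
Hypothesis Parea : unit_area_tiling P.
Hypothesis Pkind : forall i, efficient (P i) \/ type2 (P i).
Hypothesis Pangles : forall i, efficient (P i) ->
  (#|[pred k : 'I_5 | `[< tiles_with_efficient P (i, k) >]]| <= 4)%N.

Let eff i : bool := `[< efficient (P i) >].
Let around := same_vertex e1 e2 P.

Let angle_ge0 w : 0 <= tile_angle P w.
Proof.
have [_ sP _ _] := Ptiling.
by have /andP[/ltW] := angle_gt0 w.2 (sP w.1) (Parea w.1).
Qed.

(** If all corners at a vertex belonged to efficient pentagons, taking each of them once would show
    that the angle tiles. As at most four of the five angles do, some vertex of the tile is
    different. *)
Lemma inefficient_neighbour i : eff i ->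
  exists kb : 'I_5 * ('I_n * 'I_5), around (i, kb.1) kb.2 /\ ~~ eff kb.2.1.
Proof.
move=> /asboolP ei; have [k nk] : exists k, ~ tiles_with_efficient P (i, k).
  apply: contrapT => H; have := Pangles ei; rewrite (eq_card (B := predT)) ?card_ord// => k.
  by rewrite !inE; apply/asboolP; apply: contrapT => h; apply: H; exists k.
have [b [ab nb]] : exists b, around (i, k) b /\ ~~ eff b.1; last by exists (k, b).
apply: contrapT => H; apply: nk; exists [set w | around (i, k) w]%SET, (fun=> 1%N); split.
- by rewrite finset.in_set; exact: same_vertex_refl.
- move=> w; rewrite finset.in_set => aw; rewrite andbT /=.
  by apply: contrapT => /negP nw; apply: H; exists w.
- rewrite -(vertex_angle_sum Ptiling Pedge Parea (i, k)).
  by apply: eq_big => [w|w _]; rewrite ?finset.in_set// mul1r.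
Qed.

(** Efficient tiles are grouped by the chosen inefficient corner [w]. The chosen angles of a group
    are distinct corners at the vertex of [w], other than [w], hence amount to at most [2 * pi]
    minus its angle. *)
Lemma efficient_angles_le (k : 'I_n -> 'I_5) (b : 'I_n -> 'I_n * 'I_5) :
  (forall i, eff i -> around (i, k i) (b i) /\ ~~ eff (b i).1) ->
  \sum_(i | eff i) tile_angle P (i, k i) <=
  \sum_(w | ~~ eff w.1) (2 * pi - tile_angle P w).
Proof.
move=> H; rewrite (partition_big b (fun w => ~~ eff w.1)) => [|i /H[]//].
apply: ler_sum => w nw; rewrite lerBrDr -(vertex_angle_sum Ptiling Pedge Parea w).
rewrite [X in _ <= X](bigD1 w)/=; last exact: same_vertex_refl.
rewrite [X in X <= _]addrC lerD2l.
rewrite [X in _ <= X](eq_bigl (fun v => xpredT v.1 && (around w (v.1, v.2) && ((v.1, v.2) != w)))); last by case.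
rewrite [X in _ <= X](eq_bigr (fun v => tile_angle P (v.1, v.2))); last by case.
rewrite -(pair_big_dep xpredT (fun i j => around w (i, j) && ((i, j) != w)) (fun i j => tile_angle P (i, j)))/=.
(* Tile by tile: the single chosen angle of [i] against all corners of [i] at the vertex of [w]. *)
rewrite big_mkcond; apply: ler_sum => i _; case: ifP => [/andP[ei /eqP biw]|_]; last first.
  by apply: sumr_ge0.
have [ab nb] := H i ei; rewrite (bigD1 (k i))/=; first by rewrite lerDl sumr_ge0.
rewrite -biw; apply/andP; split; first exact: same_vertex_sym ab.
by apply: contraTneq ei => E; rewrite -[i]/((i, k i).1) E.
Qed.

Lemma sum_perimeter_ge : n%:R * ((386 + 371 / 1000) / 100) <= \sum_i perimeter (P i).
Proof.
have pi0 := @pi_gt0 R; have [_ sP _ _] := Ptiling.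
have F i : exists kb : 'I_5 * ('I_n * 'I_5), eff i -> around (i, kb.1) kb.2 /\ ~~ eff kb.2.1.
  have [ei|ei] := boolP (eff i); first by have [kb h] := inefficient_neighbour ei; exists kb.
  by exists (ord0, (i, ord0)).
have [kb Hkb] := choice F.
have le1 := efficient_angles_le (k := fun i => (kb i).1) (b := fun i => (kb i).2) Hkb.
have le2 : \sum_(w | ~~ eff w.1) (2 * pi - tile_angle P w) <= \sum_(i | ~~ eff i) 7 * pi.
  rewrite (eq_bigl (fun w : 'I_n * 'I_5 => ~~ eff w.1 && xpredT w.2)); last by move=> w; rewrite andbT.
  rewrite (eq_bigr (fun w : 'I_n * 'I_5 => 2 * pi - angle (P w.1) w.2)); last by [].
  rewrite -(pair_big (fun i => ~~ eff i) xpredT (fun i j => 2 * pi - angle (P i) j))/=.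
  apply: ler_sum => i ni; have t2 : type2 (P i).
    by have [e|//] := Pkind i; move/asboolP: ni.
  rewrite sumrB sumr_const card_ord.
  by have := type2_angle_sum t2 (Parea i); lra.
have lb i : (386 + 371 / 1000) / 100 - (if eff i then 99 / 1000 / pi * tile_angle P (i, (kb i).1)
    else - (99 / 1000 / pi * (7 * pi))) <= perimeter (P i).
  case: ifP => [ei|/negP ni].
    apply: le_trans (perimeter_angle_bound (kb i).1 (sP i) (Parea i)).
    by rewrite /tile_angle/= mulrAC -mulrA.
  have t2 : type2 (P i) by have [e|//] := Pkind i; case: ni; apply/asboolP.
  apply: le_trans (type2_perimeter t2 (Parea i)).
  (* The tight numerical point of the charging: 3.86371 + 0.693 = 4.55671, against 4.559. *)
  suff -> : 99 / 1000 / pi * (7 * pi) = 99 * 7 / 1000 :> R by lra.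
  by rewrite [7 * _]mulrC mulrA divfK ?lt0r_neq0//; ring.
apply: le_trans (ler_sum _ (fun i _ => lb i)).
rewrite sumrB sumr_const card_ord [X in X <= _]mulr_natl lerDl oppr_ge0.
rewrite (bigID eff)/= (eq_bigr (fun i => 99 / 1000 / pi * tile_angle P (i, (kb i).1))); last by move=> i ->.
rewrite [X in _ + X](eq_bigr (fun i => - (99 / 1000 / pi * (7 * pi)))); last by move=> i /negbTE ->.
have c0 : 0 <= 99 / 1000 / pi :> R by apply: divr_ge0; [lra|exact: ltW].
move: (99 / 1000 / pi) c0 => c c0.
rewrite sumrN subr_le0; apply: (@le_trans _ _ (c * \sum_(i | eff i) tile_angle P (i, (kb i).1))).
  by rewrite mulr_sumr.
apply: (@le_trans _ _ (c * \sum_(i | ~~ eff i) 7 * pi)); last by rewrite mulr_sumr.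
by rewrite ler_wpM2l// (le_trans le1 le2).
Qed.

End Charging.

(** * Comparison with the Prismatic pentagon *)

Lemma sqrtr_lt (R : realType) (x y : R) : 0 <= x -> 0 <= y -> x < y * y -> Num.sqrt x < y.
Proof.
by move=> x0 y0 xy; rewrite -ltr_sqr ?nnegrE ?sqrtr_ge0// sqr_sqrtr// expr2.
Qed.

Theorem proposition2p19 (R : realType) (n : nat) (e1 e2 : R * R)
    (P : 'I_n -> pentagon R)
    (Ptiling : torus_tiling e1 e2 P)
    (Pedge : edge_to_edge e1 e2 P)
    (Parea : unit_area_tiling P)
    (Pkind : forall i, efficient (P i) \/ type2 (P i))
    (Pangles : forall i, efficient (P i) ->
       (#|[pred k : 'I_5 | `[< tiles_with_efficient P (i, k) >]]| <= 4)%N) :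
  (forall q : pentagon R, prismatic q -> area (region q) = 1%:E ->
     perimeter q / 2 < perimeter_per_tile e1 e2 P) /\
  Num.sqrt (2 + Num.sqrt 3) < perimeter_per_tile e1 e2 P.
Proof.
suff H : Num.sqrt (2 + Num.sqrt 3) < perimeter_per_tile e1 e2 P.
  split => // q pq aq; apply: le_lt_trans H.
  by rewrite ler_pdivrMr// mulrC prismatic_perimeter.
have n0 : 0 < n%:R :> R.
  rewrite ltr0n lt0n; apply/eqP => nE; have [_ _ cov _] := Ptiling.
  have [[[i hi] _] _ _] : (\bigcup_s region (lift_tile e1 e2 P s)) 0 by rewrite cov.
  by move: hi; rewrite nE.
have le1 := sum_perimeter_ge Ptiling Pedge Parea Pkind Pangles.
have le2 := sum_perimeter_le Ptiling Parea.
rewrite /perimeter_per_tile ltr_pdivlMr//.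
(* The strict inequality of the theorem comes from rounding up: 3.86371 / 2 squared is about
   3.732064, above 2 + 1.73206, and 1.73206 exceeds [sqrt 3]. *)
have h : Num.sqrt (2 + Num.sqrt 3) < (386 + 371 / 1000) / 200 :> R.
  have s3 : Num.sqrt 3 < (173 + 206 / 1000) / 100 :> R by apply: sqrtr_lt; clear; lra.
  have s0 : 0 <= Num.sqrt 3 :> R by exact: sqrtr_ge0.
  by apply: sqrtr_lt; clear -s3 s0; lra.
have := ltr_pM2r n0 (Num.sqrt (2 + Num.sqrt 3)) ((386 + 371 / 1000) / 200).
rewrite h => h'; apply: lt_le_trans h' _.
by clear -le1 le2; lra.
Qed.
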